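(* Let $q$ be a product of (not necessarily distinct) primes, each congruent to $1$ modulo $6$. Then there exist infinitely many primes $p$ for which there exists $a\in(\mathbb{Z}/pq\mathbb{Z})^*$ such that $a\bmod p$ generates $(\mathbb{Z}/p\mathbb{Z})^*$, $a^{(p-1)/2}\equiv-1\pmod{pq}$, and $S=S_{pq}(a)$ satisfies $|S\cap(S+1)|\equiv-2\pmod q$.
   Context: $S_{pq}(a)=\{a^j:0\le j<p-1\}\subseteq\mathbb{Z}/pq\mathbb{Z}$ and $S+1=\{s+1:s\in S\}$. *)

(* Defs.v *)
From HB Require Import structures.
From mathcomp Require Import all_boot all_order all_algebra.
Set Implicit Arguments. Unset Strict Implicit. Unset Printing Implicit Defensive.
Import GRing.Theory.
Local Open Scope ring_scope.

(* S_{pq}(a) = { a^j : 0 <= j < p-1 } as a subset of Z/mZ (m = p*q). *)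
Definition Spq (m p : nat) (a : 'Z_m) : {set 'Z_m} :=
  [set a ^+ (val j) | j : 'I_(p.-1)].

Definition shift1 (m : nat) (S : {set 'Z_m}) : {set 'Z_m} :=
  [set s + 1 | s in S].

Definition generates_units_mod (p a : nat) : Prop :=
  coprime a p /\ forall b : nat, coprime b p -> exists j : nat, b = a ^ j %[mod p].

(* Main.v *)
Require Import Defs.
From HB Require Import structures.
From mathcomp Require Import all_boot all_order all_algebra.
From mathcomp Require Import all_fingroup all_solvable all_field all_character.
From mathcomp Require Import boolp reals exp complex Rstruct.
From mathcomp Require classical_sets.
From mathcomp Require Import zify ring lra.
From Stdlib Require Import Classical_Prop Classical_Pred_Type.
Set Implicit Arguments. Unset Strict Implicit. Unset Printing Implicit Defensive.
Import Order.TTheory GRing.Theory Num.Theory.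
Local Open Scope ring_scope.

(** Take [p = 7 mod 12] prime, [g] a primitive root modulo [p], [z] of order 6 modulo [q],
    and [a = (g mod p, z mod q)].  Then [a ^ k] lies in [S + 1] iff, for some [l], both
    [g ^ k = g ^ l + 1] modulo [p] and [z ^ k = z ^ l + 1] modulo [q].  The second equation
    depends on [(k, l)] modulo 6, and [q] divides the norm of [zeta ^ k - zeta ^ l - 1] with
    [zeta] a complex sixth root of unity; as [q] is prime to 6 this leaves
    [(k, l) = (1, 2), (5, 4)], and three more pairs when [q = 7].  So the cardinal is a sum of
    cyclotomic numbers of order 6, which are linear in the cubic Jacobi sum when 2 is a cube
    modulo [p].  The Jacobi sum is [- pi] or its conjugate, where [pi = 1 mod 3] is an
    Eisenstein prime of norm [p], and the required congruence becomes
    [N(pi - 1) + 36 = 0 mod q] (a linear variant for [q = 7]), together with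
    [pi = 1 + 2 omega] or [3 + 2 omega] modulo 4.

    Infinitely many such [pi] exist by an elementary proof of Dirichlet's theorem modulo [4 q]:
    the averages of the sums of [chi(x) Lambda(x) / N(x)] show that at most one character has a
    vanishing value [L(1, chi)] and that it is then real.  Rather than excluding this
    exceptional character we use that no nontrivial real character is trivial on
    the set of admissible classes, so that one of these classes contains infinitely many primes. *)

(** * Eisenstein integers *)

(** The residues [1 + 2 omega] and [3 + 2 omega] modulo 4 serve three ends. Their norm is 3 modulo
    4, and primary elements have norm 1 modulo 3, whence [p = 7 mod 12]; then [(p - 1) / 2] is an
    odd multiple of 3 and the power of [a] is -1 modulo [q] as well. No square is 3 modulo 4, so the
    norm of [pi] is a rational prime, and no admissible class is a square, so squares of primes
    never enter the prime sums. Finally [pi = 1 mod 2] makes 2 a cube modulo [p]. The weighted prime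
    sum of a class [g] grows like the sum of [chi(g^-1) * delta(chi)], where [delta] is 1 at the
    trivial character, -1 at an exceptional one and 0 elsewhere. Nonnegativity at [g = 1] leaves
    room for one exception; in a class where it takes the value -1 the sum is 2. If [u], [v] are the
    images of [pi] under the two reductions to ['Z_q], the congruence reads
    [(u - 1) * (v - 1) = - 36], a curve parametrised by [u = 1 + t], [v = (t - 36) / t]. The
    involution [t -> - 36 / t] exchanges [u] and [v]; this symmetry drives the triviality of real
    characters. *)

Record eis (R : Type) : Type := Eis { ere : R; eim : R }.

Section EisStructure.
Definition eis_pair (R : Type) (x : eis R) : R * R := (ere x, eim x).
Definition pair_eis (R : Type) (x : R * R) : eis R := Eis x.1 x.2.
Lemma eis_pairK (R : Type) : cancel (@eis_pair R) (@pair_eis R).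
Proof. by case. Qed.

HB.instance Definition _ (R : eqType) := Equality.copy (eis R) (can_type (@eis_pairK R)).
HB.instance Definition _ (R : choiceType) := Choice.copy (eis R) (can_type (@eis_pairK R)).
HB.instance Definition _ (R : countType) := Countable.copy (eis R) (can_type (@eis_pairK R)).
HB.instance Definition _ (R : finType) := Finite.copy (eis R) (can_type (@eis_pairK R)).

Variable R : comNzRingType.
Implicit Types x y z : eis R.

Lemma eis_eqP x y : ere x = ere y -> eim x = eim y -> x = y.
Proof. by case: x y => [a b] [c d] /= -> ->. Qed.

Definition eis_add x y := Eis (ere x + ere y) (eim x + eim y).
Definition eis_opp x := Eis (- ere x) (- eim x).
Definition eis_mul x y :=
  Eis (ere x * ere y - eim x * eim y)
      (ere x * eim y + eim x * ere y - eim x * eim y).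

Fact eis_addA : associative eis_add.
Proof. by move=> x y z; apply: eis_eqP; rewrite /= addrA. Qed.
Fact eis_addC : commutative eis_add.
Proof. by move=> x y; apply: eis_eqP; rewrite /= addrC. Qed.
Fact eis_add0 : left_id (Eis 0 0) eis_add.
Proof. by move=> x; apply: eis_eqP; rewrite /= add0r. Qed.
Fact eis_addN : left_inverse (Eis 0 0) eis_opp eis_add.
Proof. by move=> x; apply: eis_eqP; rewrite /= addNr. Qed.
HB.instance Definition _ := GRing.isZmodule.Build (eis R) eis_addA eis_addC eis_add0 eis_addN.

Fact eis_mulA : associative eis_mul.
Proof. by move=> x y z; apply: eis_eqP => /=; ring. Qed.
Fact eis_mulC : commutative eis_mul.
Proof. by move=> x y; apply: eis_eqP => /=; ring. Qed.
Fact eis_mul1 : left_id (Eis 1 0) eis_mul.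
Proof. by move=> x; apply: eis_eqP => /=; ring. Qed.
Fact eis_mulDl : left_distributive eis_mul eis_add.
Proof. by move=> x y z; apply: eis_eqP => /=; ring. Qed.
Fact eis_1neq0 : Eis 1 0 != 0 :> eis R.
Proof. by apply/eqP => -[/eqP]; rewrite oner_eq0. Qed.
HB.instance Definition _ := GRing.Zmodule_isComNzRing.Build (eis R)
  eis_mulA eis_mulC eis_mul1 eis_mulDl eis_1neq0.

Definition eis_norm x : R := ere x ^+ 2 - ere x * eim x + eim x ^+ 2.
Definition eis_conj x : eis R := Eis (ere x - eim x) (- eim x).
Definition omega : eis R := Eis 0 1.
Definition eisC (a : R) : eis R := Eis a 0.

Lemma ereD x y : ere (x + y) = ere x + ere y. Proof. by []. Qed.
Lemma eimD x y : eim (x + y) = eim x + eim y. Proof. by []. Qed.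
Lemma ereN x : ere (- x) = - ere x. Proof. by []. Qed.
Lemma eimN x : eim (- x) = - eim x. Proof. by []. Qed.
Lemma ereM x y : ere (x * y) = ere x * ere y - eim x * eim y. Proof. by []. Qed.
Lemma eimM x y : eim (x * y) = ere x * eim y + eim x * ere y - eim x * eim y.
Proof. by []. Qed.
Lemma ere1 : ere (1 : eis R) = 1. Proof. by []. Qed.
Lemma eim1 : eim (1 : eis R) = 0. Proof. by []. Qed.
Lemma ere0 : ere (0 : eis R) = 0. Proof. by []. Qed.
Lemma eim0 : eim (0 : eis R) = 0. Proof. by []. Qed.
Definition eisE := (ereD, eimD, ereN, eimN, ereM, eimM, ere1, eim1, ere0, eim0).

Lemma eis_normM x y : eis_norm (x * y) = eis_norm x * eis_norm y.
Proof. by rewrite /eis_norm !eisE; ring. Qed.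
Lemma eis_norm1 : eis_norm 1 = 1.
Proof. by rewrite /eis_norm !eisE; ring. Qed.
Lemma eis_norm0 : eis_norm 0 = 0.
Proof. by rewrite /eis_norm !eisE; ring. Qed.
Lemma eis_normX x n : eis_norm (x ^+ n) = eis_norm x ^+ n.
Proof. by elim: n => [|n IH]; rewrite ?expr0 ?eis_norm1 // !exprS eis_normM IH. Qed.
Lemma mul_conj x : x * eis_conj x = eisC (eis_norm x).
Proof. by apply: eis_eqP; rewrite ?eisE /eis_norm /=; ring. Qed.
Lemma eis_normJ x : eis_norm (eis_conj x) = eis_norm x.
Proof. by rewrite /eis_norm /=; ring. Qed.
Lemma eis_conjK x : eis_conj (eis_conj x) = x.
Proof. by apply: eis_eqP => /=; ring. Qed.

Fact eisC_is_zmod_morphism : zmod_morphism eisC.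
Proof. by move=> x y; apply: eis_eqP => /=; rewrite ?subr0. Qed.
Fact eisC_is_monoid_morphism : monoid_morphism eisC.
Proof. by split=> // x y; apply: eis_eqP; rewrite !eisE /=; ring. Qed.
HB.instance Definition _ := GRing.isZmodMorphism.Build R (eis R) eisC eisC_is_zmod_morphism.
HB.instance Definition _ := GRing.isMonoidMorphism.Build R (eis R) eisC eisC_is_monoid_morphism.

Fact eis_conj_is_zmod_morphism : zmod_morphism eis_conj.
Proof. by move=> x y; apply: eis_eqP => /=; rewrite ?eisE; ring. Qed.
Fact eis_conj_is_monoid_morphism : monoid_morphism eis_conj.
Proof. by split=> [|x y]; apply: eis_eqP => /=; rewrite ?eisE /=; ring. Qed.
HB.instance Definition _ :=
  GRing.isZmodMorphism.Build (eis R) (eis R) eis_conj eis_conj_is_zmod_morphism.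
HB.instance Definition _ :=
  GRing.isMonoidMorphism.Build (eis R) (eis R) eis_conj eis_conj_is_monoid_morphism.

Lemma omega2 : omega ^+ 2 = - omega - 1.
Proof. by rewrite expr2; apply: eis_eqP; rewrite !eisE /=; ring. Qed.
Lemma omega3 : omega ^+ 3 = 1.
Proof. by rewrite exprS omega2; apply: eis_eqP; rewrite !eisE /=; ring. Qed.
End EisStructure.

Section EisUnit.
Variable R : comUnitRingType.
Implicit Types x y : eis R.
(** Units are detected by the norm. This makes [eis 'Z_m] a finite ring with decidable units, whose
    unit group carries the characters of the Dirichlet argument. *)
Definition eis_unit : pred (eis R) := fun x => eis_norm x \is a GRing.unit.
Definition eis_inv x :=
  if eis_unit x then eis_conj x * eisC (eis_norm x)^-1 else x.
Fact eis_mulVx : {in eis_unit, left_inverse 1 eis_inv *%R}.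
Proof.
move=> x ux; rewrite /eis_inv; have -> : eis_unit x by [].
by rewrite mulrC mulrA mul_conj -rmorphM /= divrr // rmorph1.
Qed.
Fact eis_unitP x y : y * x = 1 -> eis_unit x.
Proof.
move=> yx; rewrite /eis_unit; apply/unitrP; exists (eis_norm y).
by split; rewrite -eis_normM ?[x * y]mulrC yx eis_norm1.
Qed.
Fact eis_inv_out : {in [predC eis_unit], eis_inv =1 id}.
Proof. by move=> x /negPf nux; rewrite /eis_inv; have -> : eis_unit x = false by []. Qed.
HB.instance Definition _ :=
  GRing.ComNzRing_hasMulInverse.Build (eis R) eis_mulVx eis_unitP eis_inv_out.
Lemma eis_unitE x : (x \is a GRing.unit) = (eis_norm x \is a GRing.unit).
Proof. by []. Qed.
End EisUnit.

HB.instance Definition _ (R : finComUnitRingType) := Finite.on (eis R).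

Lemma int_norm_ge0 (x : eis int) : 0 <= eis_norm x.
Proof. rewrite /eis_norm; case: x => a b /=; nia. Qed.

Lemma int_norm_eq0 (x : eis int) : (eis_norm x == 0) = (x == 0).
Proof.
apply/idP/eqP => [|->]; last by rewrite eis_norm0.
case: x => a b; rewrite /eis_norm /= => h; apply: eis_eqP => /=; nia.
Qed.

Fact eis_int_idomain (x y : eis int) : x * y = 0 -> (x == 0) || (y == 0).
Proof.
move=> xy; rewrite -(int_norm_eq0 x) -(int_norm_eq0 y) -mulf_eq0 -eis_normM xy.
by rewrite eis_norm0.
Qed.
HB.instance Definition _ := GRing.ComUnitRing_isIntegral.Build (eis int) eis_int_idomain.

Definition nrm (x : eis int) : nat := `|eis_norm x|%N.
Lemma nrmE x : (nrm x)%:Z = eis_norm x.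
Proof. by rewrite /nrm gez0_abs // int_norm_ge0. Qed.
Lemma nrmM x y : nrm (x * y) = (nrm x * nrm y)%N.
Proof. by rewrite /nrm eis_normM abszM. Qed.
Lemma nrm1 : nrm 1 = 1%N. Proof. by []. Qed.
Lemma nrm_eq0 x : (nrm x == 0)%N = (x == 0).
Proof. by rewrite -int_norm_eq0 /nrm absz_eq0. Qed.
Lemma nrm_gt0 x : (0 < nrm x)%N = (x != 0).
Proof. by rewrite lt0n nrm_eq0. Qed.
Lemma nrmJ x : nrm (eis_conj x) = nrm x.
Proof. by rewrite /nrm eis_normJ. Qed.
Lemma nrmX x n : nrm (x ^+ n) = (nrm x ^ n)%N.
Proof. by rewrite /nrm eis_normX abszX. Qed.

(** * Divisibility, primary elements and primes of Z[omega] *)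

Section EisensteinDivisibility.
Implicit Types x y z d n u : eis int.

(** Tests whether both coordinates of [n / d = n * eis_conj d / N(d)] are integers; a boolean is
    wanted because finite lists are filtered with it later. For [d = 0] this test would accept every
    [n], hence the separate case. *)
Definition edvd d n :=
  if d == 0 then n == 0 else
  let w := n * eis_conj d in
  (eis_norm d %| ere w)%Z && (eis_norm d %| eim w)%Z.

Lemma edvdP d n : reflect (exists e, n = d * e) (edvd d n).
Proof.
rewrite /edvd; have [->|d0] := eqVneq d 0.
  by apply: (iffP eqP) => [->|[e ->]]; [exists 0|]; rewrite mul0r.
have Nd0 : eis_norm d != 0 by rewrite int_norm_eq0.
apply: (iffP andP) => [[/dvdzP [a Ha] /dvdzP [b Hb]]|[e ->]].
  exists (Eis a b).
  have cd0 : eis_conj d != 0 by rewrite -nrm_eq0 nrmJ nrm_eq0.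
  apply: (mulIf cd0); rewrite mulrAC mul_conj.
  by apply: eis_eqP; rewrite ?Ha ?Hb !eisE /=; ring.
rewrite mulrAC mul_conj; split; apply/dvdzP; rewrite !eisE /=.
  by exists (ere e); ring.
by exists (eim e); ring.
Qed.

Lemma edvd_mulr d x y : edvd d x -> edvd d (x * y).
Proof. by move=> /edvdP [e ->]; apply/edvdP; exists (e * y); rewrite mulrA. Qed.
Lemma edvd_mull d x y : edvd d y -> edvd d (x * y).
Proof. by rewrite mulrC; apply: edvd_mulr. Qed.
Lemma edvdD d x y : edvd d x -> edvd d y -> edvd d (x + y).
Proof.
by move=> /edvdP [e ->] /edvdP [f ->]; apply/edvdP; exists (e + f); rewrite mulrDr.
Qed.
Lemma edvd_trans y x z : edvd x y -> edvd y z -> edvd x z.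
Proof. by move=> + /edvdP [e ->]; apply: edvd_mulr. Qed.
Lemma edvdxx x : edvd x x.
Proof. by apply/edvdP; exists 1; rewrite mulr1. Qed.
Lemma edvd_nrm d n : edvd d n -> (nrm d %| nrm n)%N.
Proof. by move=> /edvdP [e ->]; rewrite nrmM dvdn_mulr. Qed.

Lemma int_round (a N : int) : 0 < N -> exists q, `|2 * (a - q * N)| <= N.
Proof.
move=> N0; exists ((2 * a + N) %/ (2 * N))%Z.
have := divz_eq (2 * a + N) (2 * N); have := modz_ge0 (2 * a + N) (_ : 2 * N != 0).
have := ltz_pmod (2 * a + N) (_ : 0 < 2 * N).
move: (_ %/ _)%Z (_ %% _)%Z => q r H1 H2 H3.
have := H1 ltac:(lia); have := H2 ltac:(lia); lia.
Qed.

(** Rounding both coordinates of [a / d] leaves errors of at most 1/2 each, and the norm form on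
    that square is at most 3/4. *)
Lemma eis_euclid a d : d != 0 -> exists q r, a = q * d + r /\ (nrm r < nrm d)%N.
Proof.
move=> d0; have N0 : 0 < eis_norm d by rewrite lt_neqAle eq_sym int_norm_eq0 d0 int_norm_ge0.
set w := a * eis_conj d.
have [q1 H1] := int_round (ere w) N0; have [q2 H2] := int_round (eim w) N0.
set q := Eis q1 q2; exists q, (a - q * d); split; first by ring.
have E : eis_norm (a - q * d) * eis_norm d =
   eis_norm (Eis (ere w - q1 * eis_norm d) (eim w - q2 * eis_norm d)).
  rewrite -[X in _ * X = _]eis_normJ -eis_normM; congr eis_norm.
  rewrite mulrBl -mulrA mul_conj -/w; apply: eis_eqP; rewrite !eisE /=; ring.
have : eis_norm (a - q * d) < eis_norm d.
  have NE e f : eis_norm (Eis e f) = e ^+ 2 - e * f + f ^+ 2 by [].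
  move: E H1 H2; rewrite [X in _ = X -> _]NE.
  move: (ere w - _) (eim w - _) => e f.
  move: (eis_norm (a - q * d)) (eis_norm d) N0 => m N N0 E H1 H2.
  have h1 : 0 <= (N - 2 * e) * (N + 2 * e) by apply: mulr_ge0; lia.
  have h2 : 0 <= (N - 2 * f) * (N + 2 * f) by apply: mulr_ge0; lia.
  have h3 : 0 <= (N + 2 * e) * (N + 2 * f) by apply: mulr_ge0; lia.
  have h4 : 0 <= (N - 2 * e) * (N - 2 * f) by apply: mulr_ge0; lia.
  have h5 : 4 * (m * N) <= 3 * N * N by rewrite E; lia.
  nia.
by rewrite -!nrmE ltz_nat.
Qed.

Lemma eis_bezout a b : a != 0 -> exists d s t,
  [/\ d != 0, edvd d a, edvd d b & d = s * a + t * b].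
Proof.
have [n] := ubnP (nrm a); elim: n a b => // n IH a b Ha a0.
have [q [r [-> Hr]]] := eis_euclid b a0.
have [r0|r0] := eqVneq r 0.
  exists a, 1, 0; split => //; rewrite ?edvdxx // ?r0 ?addr0 ?edvd_mull ?edvdxx //; ring.
have [d [s [t [d0 da db E]]]] := IH r a ltac:(lia) r0.
exists d, (t - s * q), s; split => //; last by rewrite E; ring.
by rewrite edvdD // edvd_mull.
Qed.

(** Congruent to 1 modulo 3. Exactly one of the six associates of an element prime to 3 is primary,
    so primary elements are a multiplicative set of generators of the ideals prime to 3. *)
Definition primary x := ((3 %| ere x - 1) && (3 %| eim x))%Z.
Definition eunits : seq (eis int) :=
  [:: 1; -1; omega _; - omega _; 1 + omega _; - (1 + omega _)].

Lemma nrm_unit u : nrm u = 1%N -> u \in eunits.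
Proof.
rewrite /nrm /eis_norm; case: u => a b /= H.
have {}H : a ^+ 2 - a * b + b ^+ 2 = 1 by have := int_norm_ge0 (Eis a b); rewrite /eis_norm /=; lia.
have Hb : -1 <= b <= 1 by nia.
have Ha : -1 <= a <= 1 by nia.
have : a = -1 \/ a = 0 \/ a = 1 by lia.
have : b = -1 \/ b = 0 \/ b = 1 by lia.
by case=> [?|[?|?]]; case=> [?|[?|?]]; subst a b; move: H; vm_compute.
Qed.

Lemma primaryP x : reflect (exists s t, x = Eis (1 + 3 * s) (3 * t)) (primary x).
Proof.
apply: (iffP andP) => [[/dvdzP [s Hs] /dvdzP [t Ht]]|[s [t ->]]].
  by exists s, t; apply: eis_eqP => /=; lia.
by split; apply/dvdzP; [exists s|exists t]; rewrite /=; lia.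
Qed.

Lemma primaryM x y : primary x -> primary y -> primary (x * y).
Proof.
move=> /primaryP [a [b ->]] /primaryP [c [d ->]]; apply/primaryP.
exists (a + c + 3 * a * c - 3 * b * d), (b + d + 3 * a * d + 3 * b * c - 3 * b * d).
by apply: eis_eqP; rewrite !eisE /=; ring.
Qed.
Lemma primaryX x k : primary x -> primary (x ^+ k).
Proof. by move=> px; elim: k => // k IH; rewrite exprS primaryM. Qed.
Lemma primary_conj x : primary x -> primary (eis_conj x).
Proof.
move=> /primaryP [a [b ->]]; apply/primaryP; exists (a - b), (- b).
by apply: eis_eqP => /=; ring.
Qed.
Lemma primary_neq0 x : primary x -> x != 0.
Proof. by move=> px; apply/eqP => x0; move: px; rewrite x0. Qed.
Lemma primary_nrm_gt0 x : primary x -> (0 < nrm x)%N.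
Proof. by rewrite nrm_gt0; apply: primary_neq0. Qed.

Lemma primary_nrm_mod3 x : primary x -> (nrm x %% 3)%N = 1%N.
Proof.
move=> /primaryP [a [b E]]; have := nrmE x; rewrite {2}E /eis_norm /=.
move=> H; suff : ((nrm x)%:Z = 1 %[mod 3])%Z by lia.
rewrite H; apply/eqP; rewrite eqz_mod_dvd; apply/dvdzP.
by exists (2 * a + 3 * a ^+ 2 - b - 3 * a * b + 3 * b ^+ 2); ring.
Qed.

Lemma primary_mul_unit u x : primary x -> primary (u * x) -> nrm u = 1%N -> u = 1.
Proof.
move=> /primaryP [a [b ->]] /primaryP [c [d]] + /nrm_unit.
rewrite !inE => /[swap] /orP [/eqP -> //|].
by do 4?[case/orP]; move=> /eqP -> [] /=; lia.
Qed.

(** The norm is [(a + b) ^ 2] modulo 3, so the hypothesis excludes three of the nine residue pairs;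
    each of the six remaining pairs is moved to (1, 0) by one of the six units. *)
Lemma primary_associate x : (nrm x %% 3)%N != 0%N ->
  exists u, nrm u = 1%N /\ primary (u * x).
Proof.
move=> H.
have {}H : (eis_norm x %% 3)%Z != 0 by rewrite -nrmE; lia.
case: x H => a b; rewrite /eis_norm /= => H.
have pu u y : u \in eunits -> primary (u * y) -> exists v, nrm v = 1%N /\ primary (v * y).
  by move=> uu py; exists u; split => //; move: uu; rewrite !inE; do 5?[case/orP]; move/eqP->.
have Hab : ((a + b) %% 3)%Z != 0.
  apply/eqP => Hab; move/eqP: H; apply.
  have := divz_eq (a + b) 3; rewrite Hab addr0; set k := (_ %/ _)%Z => Hk.
  have -> : a ^+ 2 - a * b + b ^+ 2 = (a + b) ^+ 2 - 3 * (a * b) by ring.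
  rewrite Hk (_ : _ - _ = (3 * k ^+ 2 - a * b) * 3); last by ring.
  by rewrite modzMl.
have Ea := divz_eq a 3; have Eb := divz_eq b 3.
set s := (a %/ 3)%Z in Ea; set t := (b %/ 3)%Z in Eb.
have Ca : (a %% 3)%Z = 0 \/ (a %% 3)%Z = 1 \/ (a %% 3)%Z = 2 by lia.
have Cb : (b %% 3)%Z = 0 \/ (b %% 3)%Z = 1 \/ (b %% 3)%Z = 2 by lia.
move: Ca Cb => [Ha|[Ha|Ha]] [Hb|[Hb|Hb]]; try lia;
  rewrite Ha in Ea; rewrite Hb in Eb; rewrite Ea Eb.
- apply: (pu (- (1 + omega _))) => //; apply/primaryP; exists (t - s), (- s).
  by apply: eis_eqP; rewrite !eisE /=; ring.
- apply: (pu (1 + omega _)) => //; apply/primaryP; exists (s - t - 1), s.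
  by apply: eis_eqP; rewrite !eisE /=; ring.
- apply: (pu 1) => //; apply/primaryP; exists s, t.
  by apply: eis_eqP; rewrite !eisE /=; ring.
- apply: (pu (- omega _)) => //; apply/primaryP; exists t, (t - s).
  by apply: eis_eqP; rewrite !eisE /=; ring.
- apply: (pu (-1)) => //; apply/primaryP; exists (- s - 1), (- t).
  by apply: eis_eqP; rewrite !eisE /=; ring.
- apply: (pu (omega _)) => //; apply/primaryP; exists (- t - 1), (s - t).
  by apply: eis_eqP; rewrite !eisE /=; ring.
Qed.

Lemma primary_cofactor x y : primary x -> primary (x * y) -> primary y.
Proof.
move=> /primaryP [a [b ->]] /primaryP [c [d]]; case: y => e f [] /= H1 H2.
apply/primaryP; exists (c - a * e + b * f), (d - a * f - b * e + b * f).
by apply: eis_eqP => /=; lia.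
Qed.

(** Irreducibility inside the monoid of primary elements, where no units interfere; the prime above
    3 is left out. *)
Definition eprime x := primary x /\ x <> 1 /\
  forall d, primary d -> edvd d x -> d = 1 \/ d = x.

Lemma primary_nrm1 x : primary x -> nrm x = 1%N -> x = 1.
Proof. by move=> px /primary_mul_unit h; apply: (h 1); rewrite ?mulr1. Qed.

Lemma eprime_nrm_gt1 x : eprime x -> (1 < nrm x)%N.
Proof.
move=> [px [x1 _]]; rewrite ltn_neqAle primary_nrm_gt0 // andbT eq_sym.
by apply/eqP => /(primary_nrm1 px).
Qed.

Lemma primary_proper_divisor x d : primary x -> primary d -> edvd d x -> d <> x ->
  (nrm d < nrm x)%N.
Proof.
move=> px pd /edvdP [e E] dx; rewrite E nrmM.
have d0 := primary_nrm_gt0 pd.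
have pe : primary e by apply: (primary_cofactor pd); rewrite -E.
have e0 := primary_nrm_gt0 pe.
suff : nrm e <> 1%N by nia.
by move=> /(primary_nrm1 pe) e1; apply: dx; rewrite E e1 mulr1.
Qed.

Lemma exists_eprime x : primary x -> x <> 1 -> exists y, eprime y /\ edvd y x.
Proof.
have [n] := ubnP (nrm x); elim: n x => // n IH x Hn px x1.
have [H|H] := classic (forall d, primary d -> edvd d x -> d = 1 \/ d = x).
  by exists x; split => //; apply: edvdxx.
have [d Hd] := not_all_ex_not _ _ H.
have [pd {}Hd] := imply_to_and _ _ Hd; have [dx {}Hd] := imply_to_and _ _ Hd.
have [d1 dnx] := not_or_and _ _ Hd.
have := primary_proper_divisor px pd dx dnx => lt.
have [y [py yd]] := IH d ltac:(lia) pd d1.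
by exists y; split => //; apply: edvd_trans dx.
Qed.

(** A gcd of [x] and [a] divides [x], so its norm is prime to 3 and it has a primary associate. That
    associate is 1 or [x], and a Bezout relation concludes in the first case. *)
Lemma eprime_dvdM x a b : eprime x -> edvd x (a * b) -> edvd x a \/ edvd x b.
Proof.
move=> [px [x1 xd]] xab.
have [d [s [t [d0 dx da E]]]] := eis_bezout a (primary_neq0 px).
have Nd : (nrm d %% 3)%N != 0%N.
  have := primary_nrm_mod3 px; have /dvdnP [k ->] := edvd_nrm dx.
  by apply: contra_eqN => /eqP; rewrite -modnMmr => ->; rewrite muln0 mod0n.
have [u [Nu pud]] := primary_associate Nd.
have : edvd (u * d) x.
  have /edvdP [e ->] := dx.
  have : u * eis_conj u = 1 by rewrite mul_conj -nrmE Nu.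
  by move=> uu; apply/edvdP; exists (eis_conj u * e); rewrite mulrACA uu mul1r.
case/(xd _ pud) => Hud.
  right; have -> : b = u * s * b * x + u * t * (a * b).
    by rewrite -[LHS]mul1r -Hud E; ring.
  by rewrite edvdD // edvd_mull // edvdxx.
left; apply: edvd_trans da; rewrite -Hud.
have uu : u * eis_conj u = 1 by rewrite mul_conj -nrmE Nu.
by apply/edvdP; exists (eis_conj u); rewrite mulrAC uu mul1r.
Qed.
End EisensteinDivisibility.

(** * Arithmetic functions on primary Eisenstein integers *)

Section Enumeration.
Implicit Types (k : nat) (n d : eis int).

Definition box (x : nat) : seq (eis int) :=
  [seq Eis (i%:Z - x%:Z) (j%:Z - x%:Z) | i <- iota 0 (x + x).+1, j <- iota 0 (x + x).+1].
Definition ball (x : nat) := [seq n <- box x | (nrm n <= x)%N].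
Definition primaries k := [seq n <- ball k | primary n && (nrm n == k)].

Lemma box_uniq x : uniq (box x).
Proof.
apply: allpairs_uniq; rewrite ?iota_uniq // => -[i j] [i' j'] _ _ /= [].
by move=> /addIr [->] /addIr [->].
Qed.

Lemma nrm_box (x : nat) n : (nrm n <= x)%N -> n \in box x.
Proof.
move=> H; have := nrmE n; case: n H => a b H; rewrite /eis_norm /= => E.
(* Four times the norm is [3 * a ^ 2 + (2 * b - a) ^ 2], and likewise with [a] and [b] exchanged. *)
have Ha2 : 3 * a ^+ 2 <= 4 * x%:Z by have := sqr_ge0 (2 * b - a); lia.
have Hb2 : 3 * b ^+ 2 <= 4 * x%:Z by have := sqr_ge0 (2 * a - b); lia.
have Ha : - x%:Z <= a <= x%:Z by clear - Ha2; nia.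
have Hb : - x%:Z <= b <= x%:Z by clear - Hb2; nia.
apply/allpairsP; exists (`|(a + x%:Z)%R|%N, `|(b + x%:Z)%R|%N); rewrite !mem_iota /=.
by split; [lia|lia|apply: eis_eqP => /=; lia].
Qed.

Lemma mem_ball x n : (n \in ball x) = (nrm n <= x)%N.
Proof. by rewrite mem_filter; case: leqP => //= /nrm_box. Qed.
Lemma ball_uniq x : uniq (ball x).
Proof. by rewrite filter_uniq // box_uniq. Qed.
Lemma mem_primaries k n : (n \in primaries k) = primary n && (nrm n == k).
Proof. by rewrite mem_filter mem_ball; case: eqP => [->|]; rewrite ?leqnn ?andbT ?andbF. Qed.
Lemma primaries_uniq k : uniq (primaries k).
Proof. by rewrite filter_uniq // ball_uniq. Qed.

Definition divs n := [seq d <- ball (nrm n) | primary d && edvd d n].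
Lemma mem_divs n d : n != 0 -> (d \in divs n) = primary d && edvd d n.
Proof.
move=> n0; rewrite mem_filter mem_ball; case: (boolP (primary d && edvd d n)) => //= /andP [pd dn].
by apply: dvdn_leq; rewrite ?nrm_gt0 // edvd_nrm.
Qed.
Lemma divs_uniq n : uniq (divs n).
Proof. by rewrite filter_uniq // ball_uniq. Qed.
Lemma divs1 : divs 1 = [:: 1].
Proof.
by vm_compute.
Qed.

Definition eprimeb n := [&& primary n, n != 1 &
  all (fun d => primary d && edvd d n ==> (d == 1) || (d == n)) (ball (nrm n))].

Lemma eprimeP n : reflect (eprime n) (eprimeb n).
Proof.
apply: (iffP and3P) => [[pn n1 /allP H]|[pn [n1 H]]]; split => //.
- split; first exact/eqP.
  move=> d pd dn; have /H : d \in ball (nrm n).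
    by rewrite mem_ball dvdn_leq ?edvd_nrm // primary_nrm_gt0.
  by rewrite pd dn /= => /orP [] /eqP; [left|right].
- exact/eqP.
- by apply/allP => d _; apply/implyP => /andP [pd /(H _ pd)] [] ->; rewrite eqxx ?orbT.
Qed.

(** The Moebius function, read off from the prime divisors of norm at most [nrm d], so that no
    factorisation has to be constructed. *)
Definition mu d : int :=
  if has (fun x => eprimeb x && edvd (x * x) d) (ball (nrm d)) then 0
  else (-1) ^+ count (fun x => eprimeb x && edvd x d) (ball (nrm d)).

Lemma mu_norm d : `|mu d| <= 1.
Proof. by rewrite /mu; case: ifP; rewrite ?normr0 // normrX normrN1 expr1n. Qed.

Lemma mu1 : mu 1 = 1.
Proof.
by vm_compute.
Qed.

Lemma mu_sq x d : eprime x -> d != 0 -> edvd (x * x) d -> mu d = 0.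
Proof.
move=> px d0 xd; rewrite /mu; case: hasP => // -[]; exists x; last by rewrite xd andbT; apply/eprimeP.
rewrite mem_ball dvdn_leq ?nrm_gt0 //; apply: edvd_nrm; apply: edvd_trans xd.
exact: edvd_mulr (edvdxx _).
Qed.

Lemma eprime_dvd_eprime x y : eprime x -> eprime y -> edvd x y -> x = y.
Proof. by move=> [px [x1 _]] [_ [_ H]] /(H _ px) []. Qed.

(** A new prime factor adds one element to the set of prime divisors and creates no square
    divisor. *)
Lemma muM_eprime x d : eprime x -> primary d -> ~~ edvd x d -> mu (x * d) = - mu d.
Proof.
move=> px pd xd; have x0 : x != 0 by apply: primary_neq0; case: px.
have d0 := primary_neq0 pd; have xd0 : x * d != 0 by rewrite mulf_neq0.
have sqE y : eprime y -> edvd (y * y) (x * d) = edvd (y * y) d.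
  move=> py; apply/idP/idP; last exact: edvd_mull.
  have y0 : y != 0 by apply: primary_neq0; case: py.
  have [<-|yx] := eqVneq x y.
    by move=> /edvdP [e]; rewrite -mulrA => /(mulfI x0) E; rewrite E edvd_mulr ?edvdxx in xd.
  have nyx : ~ edvd y x by move=> /(eprime_dvd_eprime py px) E; rewrite E eqxx in yx.
  move=> H; have : edvd y (x * d) by apply: edvd_trans H; apply: edvd_mulr; apply: edvdxx.
  case/(eprime_dvdM py) => // /edvdP [e E].
  have /(eprime_dvdM py) [//|/edvdP [f Ef]] : edvd y (x * e).
    move/edvdP: H => [f]; rewrite E mulrCA -mulrA => /(mulfI y0) ->.
    by rewrite edvd_mulr ?edvdxx.
  by apply/edvdP; exists f; rewrite E Ef mulrA.
have dE y : eprime y -> edvd y (x * d) = (y == x) || edvd y d.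
  move=> py; apply/idP/orP => [/(eprime_dvdM py) [/(eprime_dvd_eprime py px) ->|]|[/eqP ->|]].
  - by rewrite eqxx; left.
  - by right.
  - exact: edvd_mulr (edvdxx _).
  - exact: edvd_mull.
have leb y z : z != 0 -> edvd y z -> (nrm y <= nrm z)%N.
  by move=> z0 /edvd_nrm; apply: dvdn_leq; rewrite nrm_gt0.
have hE : has (fun y => eprimeb y && edvd (y * y) (x * d)) (ball (nrm (x * d))) =
          has (fun y => eprimeb y && edvd (y * y) d) (ball (nrm d)).
  apply/hasP/hasP => -[y _ /andP [/eprimeP py H]]; exists y.
  - by rewrite mem_ball leb //; apply: (edvd_trans (edvd_mulr y (edvdxx y))); rewrite -sqE.
  - by rewrite -sqE // H andbT; apply/eprimeP.
  - by rewrite mem_ball leb //; apply: (edvd_trans (edvd_mulr y (edvdxx y))); rewrite sqE.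
  - by rewrite sqE // H andbT; apply/eprimeP.
rewrite /mu hE; case: ifP => _; first by rewrite oppr0.
rewrite -[RHS]mulN1r -exprS; congr (_ ^+ _).
rewrite -!size_filter; apply: (@perm_size _ _ (x :: filter _ _)).
apply: uniq_perm; rewrite /= ?(filter_uniq _ (ball_uniq _)) ?andbT //.
  by rewrite mem_filter (negPf xd) andbF.
move=> y; rewrite inE mem_filter [in RHS]mem_filter !mem_ball; case: (boolP (eprimeb y)) => [/eprimeP py|npy] /=.
  rewrite dE //; have [->|yx] /= := eqVneq y x.
    by rewrite leb // edvd_mulr // edvdxx.
  by case: (boolP (edvd y d)) => //= yd; rewrite !leb // edvd_mull.
by case: eqP => // E; move/negP: npy => []; rewrite E; apply/eprimeP.
Qed.

Lemma primary_divs n d : n != 0 -> d \in divs n -> primary d /\ edvd d n.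
Proof. by move=> n0; rewrite mem_divs // => /andP. Qed.

(* Pairing [d] with [x * d] cancels all terms with [d] prime to the prime divisor [x]. *)
Lemma sum_mu_eprime (V : comNzRingType) (h : eis int -> V) n x :
  primary n -> eprime x -> edvd x n ->
  \sum_(d <- divs n) (mu d)%:~R * h d =
  \sum_(d <- divs n | ~~ edvd x d) (mu d)%:~R * (h d - h (x * d)).
Proof.
move=> pn px xn; have n0 := primary_neq0 pn.
have ppx : primary x by case: px.
have x0 := primary_neq0 ppx.
rewrite (bigID (edvd x)) /= addrC.
rewrite [X in _ = X](eq_bigr (fun d => (mu d)%:~R * h d - (mu d)%:~R * h (x * d))); last first.
  by move=> d _; rewrite mulrBr.
rewrite sumrB; congr (_ + _).
rewrite (bigID (fun d => edvd (x * x) d)) /= big1_seq ?add0r; last first.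
  move=> d /andP [/andP [_ xxd]] /(primary_divs n0) [pd _].
  by rewrite (mu_sq px _ xxd) ?mul0r // primary_neq0.
rewrite -big_filter (perm_big (map (fun d => x * d) (filter (fun d => ~~ edvd x d) (divs n)))).
  rewrite big_map big_filter -sumrN big_seq_cond [RHS]big_seq_cond; apply: eq_bigr => d.
  by move=> /andP [/(primary_divs n0) [pd _] xd]; rewrite muM_eprime // rmorphN mulNr.
apply: uniq_perm.
- exact: filter_uniq (divs_uniq _).
- by rewrite map_inj_uniq ?(filter_uniq _ (divs_uniq _)) //; apply: mulfI.
move=> d; rewrite mem_filter mem_divs //; apply/idP/mapP.
  move=> /andP [/andP [/edvdP [e Ed] xxd] /andP [pd dn]]; exists e => //.
  have xe : ~~ edvd x e.
    by apply: contra xxd => /edvdP [f Ef]; apply/edvdP; exists f; rewrite Ed Ef mulrA.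
  rewrite mem_filter mem_divs // xe /= (primary_cofactor ppx) -?Ed //=.
  by apply: edvd_trans dn; rewrite Ed edvd_mull // edvdxx.
move=> [e]; rewrite mem_filter mem_divs // => /andP [xe /andP [pe en]] ->.
rewrite edvd_mulr ?edvdxx //= primaryM //=; apply/andP; split.
  by apply: contra xe => /edvdP [f]; rewrite -mulrA => /(mulfI x0) ->; rewrite edvd_mulr ?edvdxx.
move/edvdP: en xn => [f ->] /(eprime_dvdM px) [|/edvdP [g ->]]; first by rewrite (negPf xe).
by apply/edvdP; exists g; rewrite mulrCA mulrA.
Qed.

Lemma sum_mu n : primary n -> \sum_(d <- divs n) mu d = (n == 1)%:R.
Proof.
move=> pn; have [->|/eqP n1] := eqVneq n 1; first by rewrite divs1 big_seq1 mu1.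
have [x [px xn]] := exists_eprime pn n1.
have := sum_mu_eprime (fun _ => 1 : int) pn px xn.
under eq_bigr do rewrite mulr1 intz; move=> ->.
by rewrite big1 // => d _; rewrite subrr mulr0.
Qed.

Lemma eprime_decomp n x : primary n -> eprime x ->
  exists k e, [/\ n = x ^+ k * e, primary e & ~~ edvd x e].
Proof.
move=> + px; have ppx : primary x by case: px.
have nx := eprime_nrm_gt1 px.
have [m] := ubnP (nrm n); elim: m n => // m IH n Hm pn.
have [/edvdP [e En]|xn] := boolP (edvd x n); last by exists 0%N, n; rewrite expr0 mul1r.
have pe : primary e by apply: (primary_cofactor ppx); rewrite -En.
have [|k [f [E pf xf]]] := IH e _ pe.
  by have := primary_nrm_gt0 pe; move: Hm; rewrite En nrmM; nia.
by exists k.+1, f; rewrite En E exprS mulrA.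
Qed.

Lemma edvd_eprime_exp x k d e : eprime x -> ~~ edvd x d -> edvd d (x ^+ k * e) -> edvd d e.
Proof.
move=> px xd; have x0 : x != 0 by apply: primary_neq0; case: px.
elim: k => [|k IH]; first by rewrite mul1r.
rewrite exprS -mulrA => /edvdP [g Eg]; apply: IH.
have /(eprime_dvdM px) [|/edvdP [f Ef]] : edvd x (d * g) by rewrite -Eg edvd_mulr ?edvdxx.
  by rewrite (negPf xd).
by apply/edvdP; exists f; apply: (mulfI x0); rewrite Eg Ef mulrCA.
Qed.

Lemma sum_mu_coprime x k e : eprime x -> primary e -> ~~ edvd x e ->
  \sum_(d <- divs (x ^+ k * e) | ~~ edvd x d) mu d = (e == 1)%:R.
Proof.
move=> px pe xe; have ppx : primary x by case: px.
have n0 : x ^+ k * e != 0 by rewrite primary_neq0 // primaryM // primaryX.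
rewrite -(sum_mu pe) -big_filter; apply: perm_big; apply: uniq_perm.
- exact: filter_uniq (divs_uniq _).
- exact: divs_uniq.
move=> d; rewrite mem_filter !mem_divs ?n0 ?(primary_neq0 pe) //.
case: (primary d); rewrite ?andbF //=; apply/andP/idP => [[xd]|de].
  exact: edvd_eprime_exp.
split; last exact: edvd_mull.
by apply: contra xe => xd; apply: edvd_trans de.
Qed.

End Enumeration.

(** * The von Mangoldt function *)

Section VonMangoldt.
Variables (V : comNzRingType) (l : nat -> V).
Hypothesis lM : forall a b, (0 < a)%N -> (0 < b)%N -> l (a * b)%N = l a + l b.
Implicit Types n x e : eis int.

(** This is [\sum_d mu(d) * l(N(n) / N(d))], since the contribution of [l (nrm n)] vanishes. The
    completely additive [l] stays abstract so that the real logarithm and its complex embedding are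
    both instances. *)
Definition Lam n : V := - \sum_(d <- divs n) (mu d)%:~R * l (nrm d).

(** Pairing [d] with [x * d] replaces [l (nrm d)] by the constant [- l (nrm x)], which leaves the
    sum of [mu] over the divisors of [e]. *)
Lemma Lam_eprime x k e : eprime x -> primary e -> ~~ edvd x e ->
  Lam (x ^+ k.+1 * e) = l (nrm x) * (e == 1)%:R.
Proof.
move=> px pe xe; have ppx : primary x by case: px.
have pn : primary (x ^+ k.+1 * e) by rewrite primaryM // primaryX.
rewrite /Lam (sum_mu_eprime _ pn px); last by rewrite exprS -mulrA edvd_mulr // edvdxx.
have -> : (e == 1)%:R = (\sum_(d <- divs (x ^+ k.+1 * e) | ~~ edvd x d) mu d)%:~R :> V.
  by rewrite sum_mu_coprime //; case: eqP.
rewrite rmorph_sum /= mulr_sumr -sumrN big_seq_cond [RHS]big_seq_cond.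
apply: eq_bigr => d /andP [/(primary_divs (primary_neq0 pn)) [pd _] _].
rewrite nrmM lM ?primary_nrm_gt0 //; ring.
Qed.

Lemma LamP n : primary n ->
  Lam n = 0 \/ exists x k, [/\ eprime x, n = x ^+ k.+1 & Lam n = l (nrm x)].
Proof.
move=> pn; have [->|/eqP n1] := eqVneq n 1.
  left; rewrite /Lam divs1 big_seq1 mu1 nrm1.
  have := @lM 1 1 isT isT; rewrite muln1 -[LHS]addr0 => /addrI <-.
  by rewrite mulr0 oppr0.
have [x [px xn]] := exists_eprime pn n1.
have [[|k] [e [E pe xe]]] := eprime_decomp pn px.
  by move: xn; rewrite E mul1r (negPf xe).
rewrite E Lam_eprime //; have [->|_] := eqVneq e 1; last by left; rewrite mulr0.
by right; exists x, k; rewrite !mulr1.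
Qed.
End VonMangoldt.

Lemma sum_only1 (V : nmodType) (r : seq nat) (P : pred nat) (F : nat -> V) j :
  uniq r -> j \in r -> P j -> (forall i, P i -> i = j) -> \sum_(i <- r | P i) F i = F j.
Proof.
move=> ur jr Pj H; rewrite big_mkcond (bigD1_seq j) //= Pj big1 ?addr0 // => i ij.
by case: ifP => // /H E; rewrite E eqxx in ij.
Qed.

(** * Dirichlet convolution of sequences indexed by the norm *)

Section DirichletConvolution.
Variable V : comNzRingType.
Implicit Types u v w : nat -> V.

(** Summing over pairs in a square range, instead of over divisors, lets [conv_bound] enlarge the
    range to a common bound before sums are exchanged. *)
Definition conv u v k : V :=
  \sum_(1 <= i < k.+1) \sum_(1 <= j < k.+1 | (i * j == k)%N) u i * v j.

Lemma conv_bound u v k N : (0 < k <= N)%N -> conv u v k =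
  \sum_(1 <= i < N.+1) \sum_(1 <= j < N.+1 | (i * j == k)%N) u i * v j.
Proof.
move=> /andP [k0 kN].
have inner i : (0 < i)%N -> \sum_(1 <= j < k.+1 | (i * j == k)%N) u i * v j =
    \sum_(1 <= j < N.+1 | (i * j == k)%N) u i * v j.
  move=> i0; rewrite [RHS](@big_cat_nat _ _ _ k.+1) //=.
  rewrite [X in _ = _ + X]big_nat_cond [X in _ = _ + X]big_pred0 ?addr0 // => j.
  by apply/negbTE; apply/negP => /andP [/andP [H _] /eqP E]; move: H; rewrite -E; nia.
rewrite /conv [RHS](@big_cat_nat _ _ _ k.+1) //= [X in _ = _ + X]big1_seq ?addr0.
  by rewrite big_nat [RHS]big_nat; apply: eq_bigr => i /andP [i0 _]; apply: inner.
move=> i /andP [_]; rewrite mem_index_iota => /andP [ki _].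
rewrite big_nat_cond big_pred0 // => j.
by apply/negbTE; apply/negP => /andP [/andP [H _] /eqP E]; nia.
Qed.

Lemma convC u v k : conv u v k = conv v u k.
Proof.
rewrite /conv (exchange_big_dep xpredT) //=; apply: eq_bigr => i _.
by apply: eq_big => [j|j _]; rewrite 1?mulnC // mulrC.
Qed.

Lemma eq_conv u u' v v' k : (0 < k)%N -> (forall i, (0 < i)%N -> u i = u' i) ->
  (forall i, (0 < i)%N -> v i = v' i) -> conv u v k = conv u' v' k.
Proof.
move=> k0 Hu Hv; apply: eq_big_nat => i /andP [i0 _].
rewrite big_nat_cond [RHS]big_nat_cond; apply: eq_bigr => j /andP [/andP [j0 _] _].
by rewrite Hu ?Hv.
Qed.

(** A form symmetric in the three factors, from which associativity follows by permuting the
    sums. *)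
Lemma convA_triple u v w k : (0 < k)%N -> conv (conv u v) w k =
  \sum_(1 <= a < k.+1) \sum_(1 <= b < k.+1) \sum_(1 <= c < k.+1 | (a * b * c == k)%N)
    u a * v b * w c.
Proof.
move=> k0; rewrite {1}/conv.
transitivity (\sum_(1 <= i < k.+1) \sum_(1 <= a < k.+1) \sum_(1 <= b < k.+1)
   \sum_(1 <= c < k.+1 | (i * c == k)%N && (a * b == i)%N) u a * v b * w c).
  apply: eq_big_nat => i /andP [i0 ik].
  rewrite (@conv_bound _ _ _ k); last by rewrite i0 -ltnS.
  rewrite -mulr_sumr mulr_suml; apply: eq_bigr => a _.
  rewrite mulr_suml big_mkcond; apply: eq_bigr => b _.
  case: ifP => _; first by rewrite mulr_sumr; apply: eq_big => [c|//]; rewrite andbT.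
  by rewrite big_pred0 // => c; rewrite andbF.
rewrite exchange_big /=; apply: eq_big_nat => a /andP [a0 _].
rewrite exchange_big /=; apply: eq_big_nat => b /andP [b0 _].
rewrite (exchange_big_dep xpredT) //= [RHS]big_mkcond; apply: eq_big_nat => c /andP [c0 _].
case: eqP => [E|nE]; last first.
  by rewrite big_pred0 // => i; apply/negP => /andP [/eqP H /eqP E]; apply: nE; rewrite E.
have abk : (a * b \in index_iota 1 k.+1) by rewrite mem_index_iota; nia.
rewrite (@sum_only1 _ _ _ _ (a * b)%N) ?iota_uniq // ?E ?eqxx //.
by move=> i /andP [_ /eqP].
Qed.

Lemma convA u v w k : (0 < k)%N -> conv (conv u v) w k = conv u (conv v w) k.
Proof.
move=> k0; rewrite [RHS]convC !convA_triple //.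
transitivity (\sum_(1 <= a < k.+1) \sum_(1 <= b < k.+1) \sum_(1 <= c < k.+1)
    if (a * b * c == k)%N then u a * v b * w c else 0).
  by apply: eq_bigr => a _; apply: eq_bigr => b _; rewrite big_mkcond.
rewrite exchange_big /=; apply: eq_bigr => b _.
rewrite exchange_big /=; apply: eq_bigr => c _.
rewrite [RHS]big_mkcond; apply: eq_bigr => a _.
by rewrite -mulnA mulnC; case: ifP => // _; rewrite [RHS]mulrC mulrA.
Qed.

Definition delta1 (k : nat) : V := (k == 1)%N%:R.
Lemma conv1 u k : (0 < k)%N -> conv delta1 u k = u k.
Proof.
move=> k0; rewrite /conv big_ltn // [X in _ + X]big1_seq ?addr0.
  rewrite (@sum_only1 _ _ _ _ k) ?iota_uniq ?mem_index_iota ?mul1n ?k0 ?leqnn //=.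
    by rewrite /delta1 eqxx mul1r.
  by move=> i; rewrite mul1n => /eqP.
move=> i /andP [_]; rewrite mem_index_iota => /andP [i1 _].
by rewrite big1 // => j _; rewrite /delta1 gtn_eqF ?mul0r.
Qed.

Variable l : nat -> V.
Hypothesis lM : forall a b, (0 < a)%N -> (0 < b)%N -> l (a * b)%N = l a + l b.

Lemma conv_derivation u v k : (0 < k)%N ->
  l k * conv u v k = conv (fun i => l i * u i) v k + conv u (fun i => l i * v i) k.
Proof.
move=> k0; rewrite /conv -big_split /= mulr_sumr; apply: eq_big_nat => i /andP [i0 _].
rewrite -big_split /= mulr_sumr [LHS]big_nat_cond [RHS]big_nat_cond.
apply: eq_bigr => j /andP [/andP [j0 _] /eqP <-]; rewrite lM //; ring.
Qed.

(* With [m * a = 1] and [l] a derivation, [- (l m) * a = m * (l a)]. *)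
Lemma conv_log_derivative a b m :
  (forall k, (0 < k)%N -> conv m a k = delta1 k) ->
  (forall k, (0 < k)%N -> b k = - conv (fun i => l i * m i) a k) ->
  forall k, (0 < k)%N -> conv a b k = l k * a k.
Proof.
move=> Hm Hb k k0.
have l1 : l 1%N = 0.
  by have := @lM 1 1 isT isT; rewrite muln1 -[LHS]addr0 => /addrI <-.
have Hb' i : (0 < i)%N -> b i = conv m (fun i => l i * a i) i.
  move=> i0; rewrite Hb //; apply/eqP; rewrite eq_sym -addr_eq0; apply/eqP.
  rewrite addrC -conv_derivation // Hm // /delta1.
  by case: eqP => [->|]; rewrite ?l1 ?mul0r ?mulr0.
rewrite (eq_conv k0 (fun i _ => erefl (a i)) Hb') -convA //.
rewrite (@eq_conv _ delta1 _ (fun i => l i * a i)) ?conv1 // => i i0.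
by rewrite convC Hm.
Qed.
End DirichletConvolution.

Lemma sum_primaries (V : nmodType) (G : eis int -> V) N :
  \sum_(1 <= i < N.+1) \sum_(d <- primaries i) G d = \sum_(d <- ball N | primary d) G d.
Proof.
transitivity (\sum_(1 <= i < N.+1) \sum_(d <- ball N | primary d && (nrm d == i)) G d).
  apply: eq_big_nat => i /andP [i0 iN]; rewrite -[RHS]big_filter; apply: perm_big.
  apply: uniq_perm; rewrite ?primaries_uniq ?(filter_uniq _ (ball_uniq _)) // => d.
  rewrite mem_primaries mem_filter mem_ball; case: (primary d) => //=.
  by case: eqP => //= ->; rewrite -ltnS iN.
rewrite (exchange_big_dep primary) /=; last by move=> i d _ /andP [].
rewrite big_seq_cond [RHS]big_seq_cond; apply: eq_bigr => d /andP [].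
rewrite mem_ball => dN pd; rewrite pd /= (@sum_only1 _ _ _ _ (nrm d)) ?iota_uniq //=.
  by rewrite mem_index_iota ltnS dN primary_nrm_gt0.
by move=> i /eqP.
Qed.

Section PrimaryConvolution.
Variables (V : comNzRingType) (chi F : eis int -> V).
Hypothesis chiM : forall x y : eis int, chi (x * y) = chi x * chi y.

Lemma primary_multiples d j : primary d ->
  perm_eq [seq n <- primaries (nrm d * j) | edvd d n] [seq d * e | e <- primaries j].
Proof.
move=> pd; apply: uniq_perm.
- exact: filter_uniq (primaries_uniq _).
- by rewrite map_inj_uniq ?primaries_uniq //; apply: mulfI; apply: primary_neq0.
move=> n; rewrite mem_filter mem_primaries; apply/idP/mapP.
  move=> /andP [/edvdP [e ->] /andP [pn /eqP]]; rewrite nrmM => /eqP E.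
  exists e => //; rewrite mem_primaries (primary_cofactor pd pn) /=.
  by move: E; rewrite eqn_mul2l -[(_ == 0)%N]negbK -lt0n primary_nrm_gt0.
move=> [e]; rewrite mem_primaries => /andP [pe /eqP <-] ->.
by rewrite edvd_mulr ?edvdxx // primaryM // nrmM eqxx.
Qed.

(** Every multiple of a primary [d] among the primary elements is [d * e] with [e] primary. Grouping
    by norms turns divisor sums over Z[omega] into convolutions over the integers. *)
Lemma conv_primaries k : (0 < k)%N ->
  \sum_(n <- primaries k) chi n * (\sum_(d <- divs n) F d) =
  conv (fun i => \sum_(d <- primaries i) F d * chi d) (fun i => \sum_(e <- primaries i) chi e) k.
Proof.
move=> k0.
transitivity (\sum_(1 <= i < k.+1) \sum_(d <- primaries i)
    \sum_(n <- primaries k | edvd d n) F d * chi n).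
  rewrite sum_primaries.
  transitivity (\sum_(n <- primaries k) \sum_(d <- ball k | primary d && edvd d n) F d * chi n).
    rewrite big_seq [RHS]big_seq; apply: eq_bigr => n.
    rewrite mem_primaries => /andP [pn /eqP nk].
    by rewrite /divs nk big_filter mulr_sumr; apply: eq_bigr => d _; rewrite mulrC.
  by rewrite (exchange_big_dep primary) //= => [|i d _ /andP []//]; apply: eq_bigr => d ->.
apply: eq_big_nat => i /andP [i0 ik].
transitivity (\sum_(1 <= j < k.+1 | (i * j == k)%N) \sum_(d <- primaries i)
   \sum_(e <- primaries j) F d * chi (d * e)); last first.
  apply: eq_bigr => j _; rewrite mulr_suml; apply: eq_bigr => d _.
  by rewrite mulr_sumr; apply: eq_bigr => e _; rewrite chiM mulrA.
rewrite [RHS](exchange_big_dep xpredT) //= big_seq [RHS]big_seq; apply: eq_bigr => d.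
rewrite mem_primaries => /andP [pd /eqP di].
rewrite [RHS](eq_bigl (fun j => (i * j == k)%N)) => [|j]; last by rewrite andbT.
have [/dvdnP [j kE]|nik] := boolP (i %| k)%N; last first.
  rewrite big1_seq => [|n /andP [/edvd_nrm + ]].
    by rewrite big_pred0 // => j; apply/negP => /eqP E; rewrite -E dvdn_mulr in nik.
  by rewrite mem_primaries di => dn /andP [_ /eqP nk]; rewrite nk (negPf nik) in dn.
rewrite mulnC in kE.
rewrite (@sum_only1 _ _ _ _ j) ?iota_uniq ?kE ?eqxx //.
- by rewrite -big_filter -di (perm_big _ (primary_multiples j pd)) big_map.
- by rewrite mem_index_iota; nia.
by move=> j'; rewrite eqn_mul2l (gtn_eqF i0) => /eqP.
Qed.
End PrimaryConvolution.

(** * Lattice points in residue classes *)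

Section LatticeCount.
Import classical_sets.
Implicit Types (n d g h : eis int) (D x r t : nat).

Lemma Posz_sqr r : (r ^ 2)%N%:Z = r%:Z ^+ 2.
Proof. by rewrite expr2 -PoszM mulnn. Qed.

Lemma nrm_triangle n d r t : (nrm n <= r ^ 2)%N -> (nrm d <= t ^ 2)%N ->
  (nrm (n + d)%R <= (r + t) ^ 2)%N.
Proof.
rewrite -!lez_nat !nrmE !Posz_sqr; case: n d => a b [c e]; rewrite /eis_norm /= => H1 H2.
(* [T] is the polar form of the norm. The identity for [T ^+ 2] below is Cauchy-Schwarz with its
   defect [3 * (a * e - b * c) ^ 2]. *)
set T := 2 * a * c - a * e - b * c + 2 * b * e.
have HT : T ^+ 2 <= 4 * (r%:Z ^+ 2 * t%:Z ^+ 2).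
  have -> : T ^+ 2 = 4 * ((a ^+ 2 - a * b + b ^+ 2) * (c ^+ 2 - c * e + e ^+ 2)) - 3 * (a * e - b * c) ^+ 2.
    by rewrite /T; ring.
  have h1 := int_norm_ge0 (Eis a b); have h2 := int_norm_ge0 (Eis c e).
  rewrite /eis_norm /= in h1 h2.
  have := ler_pM h1 h2 H1 H2; have := sqr_ge0 (a * e - b * c); lia.
have {}HT : T <= 2 * r%:Z * t%:Z.
  have rt : 0 <= 2 * r%:Z * t%:Z by lia.
  rewrite leNgt; apply/negP => H.
  have : (2 * r%:Z * t%:Z) ^+ 2 < T ^+ 2 by rewrite ltr_sqr ?nnegrE //; lia.
  lia.
have -> : (a + c) ^+ 2 - (a + c) * (b + e) + (b + e) ^+ 2 =
  (a ^+ 2 - a * b + b ^+ 2) + (c ^+ 2 - c * e + e ^+ 2) + T by rewrite /T; ring.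
rewrite PoszD; lia.
Qed.

Lemma count_shift (P Q : pred (eis int)) d r t : (nrm d <= t ^ 2)%N ->
  (forall n, P n -> Q (n + d)) ->
  (count P (ball (r ^ 2)) <= count Q (ball ((r + t) ^ 2)))%N.
Proof.
move=> Nd PQ; rewrite -!size_filter -(size_map (fun n => n + d)); apply: uniq_leq_size.
  by rewrite map_inj_uniq ?(filter_uniq _ (ball_uniq _)) //; apply: addIr.
move=> _ /mapP [n + ->]; rewrite mem_filter mem_ball => /andP [/PQ Qn Nn].
by rewrite mem_filter Qn mem_ball nrm_triangle.
Qed.

Definition cong D g n := (D %| ere n - ere g)%Z && (D %| eim n - eim g)%Z.
Definition cls D g r := count (cong D g) (ball (r ^ 2)).
Definition w r := size (ball (r ^ 2)).

(** Translate by the representative of [h - g] with coordinates in [[0, D)]; its norm is at most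
    [D ^ 2], so radii grow by at most [D]. *)
Lemma cls_shift D g h r : (0 < D)%N -> (cls D g r <= cls D h (r + D))%N.
Proof.
move=> D0.
set a := ((ere h - ere g) %% D)%Z; set b := ((eim h - eim g) %% D)%Z.
have D0' : D%:Z != 0 by lia.
have Ha : 0 <= a < D by rewrite modz_ge0 //= ltz_pmod //; lia.
have Hb : 0 <= b < D by rewrite modz_ge0 //= ltz_pmod //; lia.
apply: (@count_shift _ _ (Eis a b)).
  rewrite -lez_nat nrmE Posz_sqr /eis_norm /=; clearbody a b; nia.
move=> n /andP [/dvdzP [s Hs] /dvdzP [t Ht]]; rewrite /cong !eisE /=.
have Ea := divz_eq (ere h - ere g) D; have Eb := divz_eq (eim h - eim g) D.
rewrite -/a in Ea; rewrite -/b in Eb.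
apply/andP; split; apply/dvdzP.
  by exists (s - ((ere h - ere g) %/ D)%Z); rewrite mulrBl; lia.
by exists (t - ((eim h - eim g) %/ D)%Z); rewrite mulrBl; lia.
Qed.

Lemma sum_cls D r : (0 < D)%N ->
  (\sum_(i < D) \sum_(j < D) cls D (Eis i%:Z j%:Z) r = w r)%N.
Proof.
move=> D0; rewrite pair_big /= /w -sum1_size.
transitivity (\sum_(p : 'I_D * 'I_D) \sum_(n <- ball (r ^ 2) | cong D (Eis p.1%:Z p.2%:Z) n) 1)%N.
  by apply: eq_bigr => p _; rewrite sum1_count.
rewrite (exchange_big_dep xpredT) //=; apply: eq_bigr => n _.
have D0' : D%:Z != 0 by lia.
have Ha : (`|(ere n %% D)%Z| < D)%N by have := modz_ge0 (ere n) D0'; have := ltz_pmod (ere n) (_ : 0 < D%:Z); lia.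
have Hb : (`|(eim n %% D)%Z| < D)%N by have := modz_ge0 (eim n) D0'; have := ltz_pmod (eim n) (_ : 0 < D%:Z); lia.
rewrite sum1_card (@eq_card1 _ (Ordinal Ha, Ordinal Hb)) // => -[i j].
rewrite !inE xpair_eqE -!val_eqE /= unfold_in /cong /=.
have E (k : int) (o : 'I_D) : (D %| k - o%:Z)%Z = (val o == `|(k %% D)%Z|%N).
  rewrite -eqz_mod_dvd (modz_small (_ : 0 <= o%:Z < D)); last by have := ltn_ord o; lia.
  by rewrite -{1}[(k %% D)%Z]gez0_abs ?modz_ge0 // eqz_nat eq_sym.
by rewrite !E.
Qed.

Lemma cls0 D r : (0 < D)%N -> cls D 0 (D * r) = w r.
Proof.
move=> D0; rewrite /cls /w -size_filter -(size_map (fun n => eisC D%:Z * n) (ball (r ^ 2))).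
have D0' : eisC D%:Z != 0 by apply/eqP => -[]; lia.
have ND : nrm (eisC D%:Z) = (D ^ 2)%N 
  by rewrite /nrm (_ : eis_norm _ = D%:Z ^+ 2) ?abszX // /eis_norm /=; ring.
apply: perm_size; apply: uniq_perm.
- exact: filter_uniq (ball_uniq _).
- by rewrite map_inj_uniq ?ball_uniq //; apply: mulfI.
move=> n; rewrite mem_filter mem_ball /cong !subr0; apply/idP/mapP.
  move=> /andP [/andP [/dvdzP [s Hs] /dvdzP [t Ht]] Hn].
  have En : n = eisC D%:Z * Eis s t by apply: eis_eqP; rewrite !eisE /=; lia.
  exists (Eis s t) => //; rewrite mem_ball.
  by move: Hn; rewrite En nrmM ND expnMn leq_pmul2l // expn_gt0 D0.
move=> [e]; rewrite mem_ball => He ->; rewrite nrmM ND expnMn leq_pmul2l ?expn_gt0 ?D0 // He andbT.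
rewrite !eisE /=; apply/andP; split; apply/dvdzP.
  by exists (ere e); ring.
by exists (eim e); ring.
Qed.

Lemma cls_upper D g r : (0 < D)%N -> (D ^ 2 * cls D g r <= w (r + D))%N.
Proof.
move=> D0; rewrite -(sum_cls _ D0) expnS expn1 -mulnA.
rewrite -{1}(card_ord D) -sum_nat_const; apply: leq_sum => i _.
rewrite -{1}(card_ord D) -sum_nat_const; apply: leq_sum => j _.
exact: cls_shift.
Qed.

Lemma cls_lower D g r : (0 < D)%N -> (w r <= D ^ 2 * cls D g (r + D))%N.
Proof.
move=> D0; rewrite -(sum_cls _ D0).
apply: (@leq_trans (\sum_(i < D) \sum_(j < D) cls D g (r + D))).
  by apply: leq_sum => i _; apply: leq_sum => j _; apply: cls_shift.
by rewrite !sum_nat_const !card_ord mulnA mulnn.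
Qed.

(* Scaling by [D] maps the ball onto the class of 0 modulo [D]: hence [w r / (r + 1)^2 <= w (t + 1) / t^2]. *)
Lemma w_ratio r t : (0 < t)%N -> (t ^ 2 * w r <= (r + 1) ^ 2 * w (t + 1))%N.
Proof.
move=> t0; rewrite -(cls0 r t0); apply: leq_trans (cls_upper 0 _ t0) _.
have r0 : (0 < r + 1)%N by rewrite addn1.
have -> : (t * r + t = (r + 1) * t)%N by lia.
apply: leq_trans (cls_lower 0 _ r0) _.
have -> : ((r + 1) * t + (r + 1) = (r + 1) * (t + 1))%N by lia.
by rewrite cls0.
Qed.

Variable R : realType.

(** The constant [c] with [w r ~ c * r ^ 2], taken as a supremum rather than computed as an area.
    [w_ratio] supplies the matching lower bound in [wsup_bounds]. *)
Definition wsup : R := sup [set (w r)%:R / (r + 1)%:R ^+ 2 | r in [set: nat]]%classic.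

Lemma wsup_bounds t : (0 < t)%N -> wsup * t%:R ^+ 2 <= (w (t + 1))%:R.
Proof.
move=> t0; have t0' : 0 < t%:R ^+ 2 :> R by rewrite exprn_gt0 // ltr0n.
rewrite -ler_pdivlMr //; apply: ge_sup.
  by exists ((w 0)%:R / (0 + 1)%:R ^+ 2); exists 0%N.
move=> _ [r _ <-]; rewrite ler_pdivrMr; last by rewrite exprn_gt0 // ltr0n addn1.
rewrite mulrAC ler_pdivlMr // -!natrX -!natrM ler_nat.
by rewrite mulnC [X in (_ <= X)%N]mulnC w_ratio.
Qed.

Lemma wsup_ub r : (w r)%:R <= wsup * (r + 1)%:R ^+ 2.
Proof.
rewrite -ler_pdivrMr; last by rewrite exprn_gt0 // ltr0n addn1.
apply: ub_le_sup; last by exists r.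
exists (w 2)%:R => _ [s _ <-]; rewrite ler_pdivrMr; last by rewrite exprn_gt0 // ltr0n addn1.
by rewrite -natrX -natrM ler_nat mulnC; have := w_ratio s (isT : 0 < 1)%N; rewrite mul1n.
Qed.

Lemma wsup_gt0 : 0 < wsup.
Proof.
have := wsup_ub 0; rewrite expr1n mulr1; apply: lt_le_trans.
by rewrite ltr0n.
Qed.

Lemma exists_isqrt x : exists r, (r ^ 2 <= x < (r + 1) ^ 2)%N.
Proof.
elim: x => [|x [r /andP [H1 H2]]]; first by exists 0%N.
have [H|H] := leqP ((r + 1) ^ 2) x.+1; last by exists r; rewrite H (leq_trans H1).
by exists (r + 1)%N; rewrite H /=; nia.
Qed.

(** With [r] the integer square root of [x], the ball lies between the discs of radii [r] and
    [r + 1]. Hence [D ^ 2] times the class count lies between [w (r - D)] and [w (r + 1 + D)]; one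
    [K] serves all classes [g]. *)
Lemma lattice_count D : (0 < D)%N -> exists K : R, forall g x, (0 < x)%N ->
  `|(count (cong D g) (ball x))%:R - wsup / D%:R ^+ 2 * x%:R| <= K * Num.sqrt x%:R.
Proof.
move=> D0; set c := wsup; have c0 : 0 < c := wsup_gt0.
have D0' : 0 < D%:R ^+ 2 :> R by rewrite exprn_gt0 // ltr0n.
exists (2 * c * (D%:R + 2) ^+ 2) => g x x0.
have [r /andP [Hr1 Hr2]] := exists_isqrt x.
have sub a b : (a <= b)%N -> (count (cong D g) (ball a) <= count (cong D g) (ball b))%N.
  move=> ab; rewrite -!size_filter; apply: uniq_leq_size; first exact: filter_uniq (ball_uniq _).
  by move=> n; rewrite mem_filter mem_ball => /andP [cn na]; rewrite mem_filter mem_ball cn (leq_trans na).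
set X := Num.sqrt x%:R; have XX : x%:R = X ^+ 2 :> R by rewrite sqr_sqrtr.
have X0 : 0 <= X := sqrtr_ge0 _.
have X1 : 1 <= X by rewrite -(ler_sqr (_ : 1 \is Num.nneg)) ?nnegrE // -XX expr1n ler1n.
have rX : r%:R <= X by rewrite -(ler_sqr (_ : r%:R \is Num.nneg)) ?nnegrE // -XX -natrX ler_nat.
have Xr : X < r%:R + 1.
  rewrite -(ltr_sqr (_ : X \is Num.nneg)) ?nnegrE ?addr_ge0 // -XX.
  by rewrite natr1 -natrX ltr_nat; move: Hr2; rewrite addn1.
set N := count _ _.
have up : D%:R ^+ 2 * N%:R <= c * (X + D%:R + 2) ^+ 2.
  have : (D ^ 2 * N <= w (r + 1 + D))%N.
    apply: leq_trans (cls_upper g _ D0); rewrite leq_mul2l; apply/orP; right.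
    by apply: sub; apply: ltnW.
  rewrite -(ler_nat R) natrM natrX => /le_trans; apply.
  apply: le_trans (wsup_ub _) _; rewrite ler_wpM2l ?(ltW c0) //.
  rewrite ler_sqr ?nnegrE ?addr_ge0 // !natrD; lra.
have lo : c * (X ^+ 2 - 2 * (D%:R + 2) * X) <= D%:R ^+ 2 * N%:R.
  (* Here [r - D - 1] may fail to be positive, but [X < D + 2] makes the claimed lower bound
     nonpositive. *)
  have [rD|Dr] := leqP r (D + 1).
    apply: le_trans (_ : 0 <= _); last by rewrite mulr_ge0 ?(ltW D0').
    rewrite pmulr_rle0 // expr2 -mulrBl; apply: mulr_le0_ge0 => //.
    have : r%:R <= D%:R + 1 :> R by rewrite natr1 -addn1 ler_nat.
    by have : 0 <= D%:R :> R by []; lra.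
  have : (w (r - D) <= D ^ 2 * N)%N.
    apply: leq_trans (cls_lower g _ D0) _; rewrite leq_mul2l; apply/orP; right.
    by apply: sub; rewrite subnK //; lia.
  rewrite -(ler_nat R) natrM natrX; apply: le_trans.
  have [t [Et t0]] : exists t, (r - D = t + 1 /\ 0 < t)%N by exists (r - D - 1)%N; lia.
  rewrite Et; apply: le_trans (wsup_bounds t0); rewrite ler_wpM2l ?(ltW c0) //.
  have -> : t%:R = r%:R - D%:R - 1 :> R.
    have -> : r = (t + 1 + D)%N by lia.
    by rewrite !natrD; ring.
  have : X - D%:R - 2 <= r%:R - D%:R - 1 by lra.
  have [h|h] := leP 0 (X - D%:R - 2).
    move=> h2; have : (X - D%:R - 2) ^+ 2 <= (r%:R - D%:R - 1) ^+ 2.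
      by rewrite ler_sqr ?nnegrE // (le_trans h h2).
    by have := sqr_ge0 (D%:R + 2 : R); nra.
  move=> _; apply: le_trans (sqr_ge0 _); rewrite expr2 -mulrBl.
  by apply: mulr_le0_ge0 => //; lra.
have -> : N%:R - c / D%:R ^+ 2 * x%:R = (D%:R ^+ 2 * N%:R - c * X ^+ 2) / D%:R ^+ 2.
  by rewrite XX; field; rewrite gt_eqF // ltr0n.
rewrite normrM [X in _ * X]gtr0_norm ?invr_gt0 // ler_pdivrMr //.
have D1 : 1 <= D%:R :> R by rewrite ler1n.
have D2 : 1 <= D%:R ^+ 2 :> R by rewrite exprn_ege1.
apply: le_trans (_ : 2 * c * (D%:R + 2) ^+ 2 * X <= _); last first.
  by rewrite ler_peMr // !mulr_ge0 ?(ltW c0) ?exprn_ge0 ?addr_ge0.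
rewrite ler_norml; apply/andP; split.
  suff : c * (2 * (D%:R + 2) * X) <= 2 * c * (D%:R + 2) ^+ 2 * X by lra.
  have -> : 2 * c * (D%:R + 2) ^+ 2 * X = c * (2 * (D%:R + 2) ^+ 2 * X) by ring.
  rewrite ler_wpM2l ?(ltW c0) // ler_wpM2r // ler_wpM2l // expr2 ler_peMr //; lra.
suff : c * ((X + D%:R + 2) ^+ 2 - X ^+ 2) <= 2 * c * (D%:R + 2) ^+ 2 * X by lra.
have -> : 2 * c * (D%:R + 2) ^+ 2 * X = c * (2 * (D%:R + 2) ^+ 2 * X) by ring.
rewrite ler_wpM2l ?(ltW c0) //.
have -> : (X + D%:R + 2) ^+ 2 - X ^+ 2 = 2 * (D%:R + 2) * X + (D%:R + 2) ^+ 2 by ring.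
have h1 : 2 * (D%:R + 2) * X <= (D%:R + 2) ^+ 2 * X.
  by rewrite ler_wpM2r // expr2 ler_wpM2r //; lra.
have h2 : (D%:R + 2) ^+ 2 <= (D%:R + 2) ^+ 2 * X by rewrite ler_peMr // sqr_ge0.
lra.
Qed.
End LatticeCount.

(** * Logarithmic averages *)

Section PartialSums.
Definition psum (V : nmodType) (f : nat -> V) (x : nat) : V := \sum_(1 <= k < x.+1) f k.

Lemma psum0 (V : nmodType) (f : nat -> V) : psum f 0 = 0.
Proof. by rewrite /psum big_geq. Qed.
Lemma psumS (V : nmodType) (f : nat -> V) x : psum f x.+1 = psum f x + f x.+1.
Proof. by rewrite /psum big_nat_recr. Qed.
Lemma eq_psum (V : nmodType) (f g : nat -> V) x :
  (forall k, (0 < k <= x)%N -> f k = g k) -> psum f x = psum g x.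
Proof. by move=> H; apply: eq_big_nat => k Hk; apply: H; rewrite -ltnS. Qed.
Lemma psumD (V : nmodType) (f g : nat -> V) x :
  psum (fun k => f k + g k) x = psum f x + psum g x.
Proof. exact: big_split. Qed.
Lemma psumB (V : zmodType) (f g : nat -> V) x :
  psum (fun k => f k - g k) x = psum f x - psum g x.
Proof. exact: sumrB. Qed.
Lemma psumMl (V : pzRingType) (c : V) (f : nat -> V) x :
  psum (fun k => c * f k) x = c * psum f x.
Proof. by rewrite /psum mulr_sumr. Qed.
Lemma psumMr (V : pzRingType) (c : V) (f : nat -> V) x :
  psum (fun k => f k * c) x = psum f x * c.
Proof. by rewrite /psum mulr_suml. Qed.

Lemma psum_split (V : nmodType) (f : nat -> V) x y : (x <= y)%N ->
  psum f y = psum f x + \sum_(x.+1 <= k < y.+1) f k.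
Proof. by move=> xy; rewrite /psum (@big_cat_nat _ _ _ x.+1). Qed.

Lemma psum_swap (V : nmodType) (F : nat -> nat -> V) X :
  psum (fun x => psum (fun d => F x d) x) X = psum (fun d => \sum_(d <= x < X.+1) F x d) X.
Proof.
elim: X => [|X IH]; first by rewrite !psum0.
rewrite psumS IH !psumS addrA big_nat1; congr (_ + _).
rewrite -psumD; apply: eq_psum => d /andP [_ dX].
by rewrite [RHS]big_nat_recr //=; lia.
Qed.

(** Abel summation against a weight [L], applied with [L] the logarithm. *)
Lemma psum_weight (V : comPzRingType) (f L : nat -> V) x :
  psum (fun d => f d * L d) x.+1 =
  psum f x.+1 * L x.+1 - psum (fun j => (L j.+1 - L j) * psum f j) x.
Proof.
elim: x => [|x IH]; first by rewrite !psumS !psum0 subr0 !add0r.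
by rewrite psumS IH [psum f x.+2]psumS [psum (fun j => _ * _) x.+1]psumS; ring.
Qed.

Lemma psum_abel (V : fieldType) (f : nat -> V) x y : (x <= y)%N ->
  psum (fun k => f k / k%:R) y - psum (fun k => f k / k%:R) x =
  psum f y / y.+1%:R - psum f x / x.+1%:R +
  \sum_(x.+1 <= k < y.+1) psum f k * (k%:R^-1 - k.+1%:R^-1).
Proof.
move=> xy; rewrite -(subnKC xy); elim: (y - x)%N => [|n IH].
  by rewrite addn0 !subrr big_geq ?addr0.
rewrite addnS !psumS addrAC IH [in RHS]big_nat_recr ?ltnS ?leq_addr //= psumS.
by ring.
Qed.

(** The pairs [(d, j)] with [d * j <= x] are summed with [j] innermost. *)
Lemma psum_conv (V : fieldType) (u v : nat -> V) x :
  psum (fun k => conv u v k / k%:R) x =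
  psum (fun d => u d / d%:R * psum (fun j => v j / j%:R) (x %/ d)) x.
Proof.
transitivity (psum (fun k => psum (fun i => \sum_(1 <= j < x.+1 | (i * j == k)%N)
   (u i / i%:R) * (v j / j%:R)) x) x).
  apply: eq_psum => k /andP [k0 kx].
  rewrite (@conv_bound _ _ _ _ x) ?k0 // mulr_suml; apply: eq_bigr => i _.
  rewrite mulr_suml; apply: eq_bigr => j /eqP <-.
  by rewrite natrM invfM mulrACA.
rewrite /psum exchange_big /=; apply: eq_big_nat => i /andP [i0 ix].
rewrite (exchange_big_dep xpredT) //= mulr_sumr.
have le : (x %/ i <= x)%N by apply: leq_div.
rewrite [LHS](@big_cat_nat _ _ _ (x %/ i).+1) //= [X in _ + X]big1_seq ?addr0.
  apply: eq_big_nat => j /andP [j0 jx].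
  rewrite (@sum_only1 _ _ _ _ (i * j)%N) ?iota_uniq ?eqxx // => [|k /eqP //].
  by rewrite mem_index_iota ltnS mulnC -leq_divRL // muln_gt0 i0 j0.
move=> j /andP [_]; rewrite mem_index_iota => /andP [j1 _].
rewrite big_nat_cond big_pred0 // => k; apply/negP => /andP [/andP [_ kx] /eqP E].
have : (j <= x %/ i)%N by rewrite leq_divRL // mulnC E.
lia.
Qed.
End PartialSums.

(** * Estimates for logarithms, fourth roots and their sums *)

Section RealEstimates.
Variable R : realType.
Implicit Types (x y d j k : nat).

Definition lg k : R := ln k%:R.
(** A discrete [dt / t]: sums weighted by [dlg] are logarithmic averages. *)
Definition dlg k : R := lg k.+1 - lg k.

Lemma natr_pos k : (0 < k)%N -> (k%:R : R) \is Num.pos.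
Proof. by move=> k0; rewrite posrE ltr0n. Qed.
Lemma lgM j k : (0 < j)%N -> (0 < k)%N -> lg (j * k) = lg j + lg k.
Proof. by move=> j0 k0; rewrite /lg natrM lnM ?natr_pos. Qed.
Lemma lg1 : lg 1 = 0. Proof. exact: ln1. Qed.
Lemma lg_le j k : (0 < j <= k)%N -> lg j <= lg k.
Proof. by move=> /andP [j0 jk]; rewrite ler_ln ?ler_nat ?natr_pos // (leq_trans j0). Qed.
Lemma lg_ge0 k : 0 <= lg k.
Proof.
by case: k => [|k]; [rewrite /lg ln0|rewrite -lg1 lg_le].
Qed.
Lemma dlg_ge0 k : (0 < k)%N -> 0 <= dlg k.
Proof. by move=> k0; rewrite subr_ge0 lg_le // k0 leqnSn. Qed.
Lemma dlg_le k : (0 < k)%N -> dlg k <= k%:R^-1.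
Proof.
move=> k0; have k0' : 0 < k%:R :> R by rewrite ltr0n.
rewrite /dlg /lg -ln_div ?natr_pos // -natr1 mulrDl divff ?gt_eqF // mul1r.
by apply: le_ln1Dx; apply: lt_trans (_ : 0 < _); rewrite ?invr_gt0 // ltrN10.
Qed.
Lemma dlg_ge k : (0 < k)%N -> k.+1%:R^-1 <= dlg k.
Proof.
move=> k0; have k0' : 0 < k.+1%:R :> R by rewrite ltr0n.
rewrite -lerN2 /dlg opprB /lg -ln_div ?natr_pos //.
have -> : k%:R / k.+1%:R = 1 + - k.+1%:R^-1 :> R.
  by rewrite -[X in X / _](addrK 1) natr1 mulrBl divff ?gt_eqF // mul1r.
apply: le_ln1Dx; rewrite ltrN2 invf_lt1 // ltr1n; lia.
Qed.
Lemma dlg_le1 k : (0 < k)%N -> dlg k <= 1.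
Proof. by move=> k0; rewrite (le_trans (dlg_le k0)) // invf_le1 ?ltr0n // ler1n. Qed.
Lemma psum_dlg x : psum dlg x = lg x.+1.
Proof. by elim: x => [|x IH]; rewrite ?psum0 ?lg1 // psumS IH /dlg addrC subrK. Qed.

Lemma lg_unbounded (K : R) : exists x, (0 < x)%N /\ K < lg x.
Proof.
have l2 : 0 < lg 2 by rewrite ln_gt0 // ltr1n.
have [n Hn] : exists n : nat, K / lg 2 < n%:R.
  exists (Num.bound `|K / lg 2|); apply: le_lt_trans (ler_norm _) _.
  exact: archi_boundP.
exists (2 ^ n)%N; rewrite expn_gt0; split=> //.
rewrite /lg natrX lnXn ?ltr0n // -[ln _ *+ n]mulr_natl.
by move: Hn; rewrite ltr_pdivrMr.
Qed.

(** The fourth root. An error [(d / x) ^ (1/2)] is the square of [rho d / rho x]: one factor can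
    absorb [log (x / d)] by [lg_diff_le], and the other still gives a convergent sum by
    [rho_sum]. *)
Definition rho k : R := Num.sqrt (Num.sqrt k%:R).
Lemma rho4 k : rho k ^+ 4 = k%:R.
Proof. by rewrite /rho (exprM _ 2 2) !sqr_sqrtr ?sqrtr_ge0. Qed.
Lemma rho2 k : rho k ^+ 2 = Num.sqrt k%:R.
Proof. by rewrite sqr_sqrtr ?sqrtr_ge0. Qed.
Lemma rho_gt0 k : (0 < k)%N -> 0 < rho k.
Proof. by move=> k0; rewrite !sqrtr_gt0 ltr0n. Qed.
Lemma rho_ge1 k : (0 < k)%N -> 1 <= rho k.
Proof.
have h (y : R) : 1 <= y -> 1 <= Num.sqrt y.
  by move=> y1; rewrite -[leLHS]sqrtr1 ler_wsqrtr.
by move=> k0; rewrite !h // ler1n.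
Qed.
Lemma rho_le j k : (j <= k)%N -> rho j <= rho k.
Proof. by move=> jk; apply: ler_wsqrtr; apply: ler_wsqrtr; rewrite ler_nat. Qed.

(** Discrete comparison of [x ^ (-5/4)] with the increments of its primitive [-4 * x ^ (-1/4)], with
    [s] and [t] the fourth roots of consecutive integers. *)
Lemma quartic_telescope (s t : R) : 0 < s -> 0 < t -> s <= t -> t ^+ 4 = s ^+ 4 + 1 ->
  (t ^+ 4 * t)^-1 <= 4 * (s^-1 - t^-1).
Proof.
move=> s0 t0 st E.
have H : 1 <= 4 * (t - s) * t ^+ 3.
  have E1 : t ^+ 4 - s ^+ 4 = (t - s) * ((t + s) * (t ^+ 2 + s ^+ 2)) by ring.
  have E2 : t ^+ 4 - s ^+ 4 = 1 by rewrite E; ring.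
  rewrite -[leLHS]E2 E1 (_ : 4 * (t - s) * t ^+ 3 = (t - s) * (4 * t ^+ 3)); last by ring.
  rewrite ler_wpM2l ?subr_ge0 //.
  have s2 : s ^+ 2 <= t ^+ 2 by rewrite ler_sqr // nnegrE ltW.
  have : (t + s) * (t ^+ 2 + s ^+ 2) <= (2 * t) * (2 * t ^+ 2).
    by apply: ler_pM; [lra|rewrite addr_ge0 ?sqr_ge0|lra|lra].
  by move/le_trans; apply; rewrite le_eqVlt; apply/orP; left; apply/eqP; ring.
have -> : 4 * (s^-1 - t^-1) = 4 * (t - s) * t ^+ 3 / (s * t ^+ 4).
  by field; rewrite !gt_eqF.
rewrite ler_pdivlMr ?mulr_gt0 ?exprn_gt0 //.
apply: le_trans H; rewrite mulrC (_ : _ / _ = s / t); last by field; rewrite gt_eqF.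
by rewrite ler_pdivrMr // mul1r.
Qed.

Lemma rho_telescope k : (0 < k)%N ->
  (k.+1%:R * rho k.+1)^-1 <= 4 * ((rho k)^-1 - (rho k.+1)^-1).
Proof.
move=> k0; rewrite -[k.+1%:R]rho4; apply: quartic_telescope.
- exact: rho_gt0.
- exact: rho_gt0.
- exact: rho_le.
by rewrite !rho4 natr1.
Qed.

(** The constant 5 is 4 from telescoping plus 1 for the first term [x = d]. *)
Lemma rho_sum d X : (0 < d)%N -> \sum_(d <= x < X.+1) (x%:R * rho x)^-1 <= 5 / rho d.
Proof.
move=> d0; have rd := rho_gt0 d0.
suff H : (d <= X)%N -> \sum_(d <= x < X.+1) (x%:R * rho x)^-1 <= 5 / rho d - 4 / rho X.
  have [dX|Xd] := leqP d X; last by rewrite big_geq // divr_ge0 // ltW.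
  by apply: le_trans (H dX) _; rewrite gerBl divr_ge0 // ltW // rho_gt0 //; lia.
move=> dX; rewrite -(subnKC dX); elim: (X - d)%N => [|n IH].
  rewrite addn0 big_nat1 -mulrBl (_ : 5 - 4 = 1 :> R); last by lra.
  by rewrite mul1r invfM ler_piMl ?invr_ge0 ?(ltW rd) // invf_le1 ?ltr0n // ler1n.
rewrite addnS big_nat_recr ?leqW ?leq_addr //=.
have := @rho_telescope (d + n) ltac:(lia); move: IH.
move: (\sum_(_ <= _ < _) _) (_ * _)^-1 (rho d)^-1 (rho (d + n))^-1 (rho (d + n).+1)^-1.
by move=> T u v w z IH tele; lra.
Qed.

Lemma sqrt_telescope k : (0 < k)%N ->
  Num.sqrt k%:R * (k%:R^-1 - k.+1%:R^-1) <= 2 * ((Num.sqrt k%:R)^-1 - (Num.sqrt k.+1%:R)^-1) :> R.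
Proof.
move=> k0; set s := Num.sqrt _; set t := Num.sqrt k.+1%:R.
have s0 : 0 < s by rewrite sqrtr_gt0 ltr0n. have t0 : 0 < t by rewrite sqrtr_gt0 ltr0n.
have st : s <= t by rewrite ler_sqrt // ler_nat.
have Es : k%:R = s ^+ 2 :> R by rewrite sqr_sqrtr. 
have Et : k.+1%:R = t ^+ 2 :> R by rewrite sqr_sqrtr.
have E : t ^+ 2 = s ^+ 2 + 1 by rewrite -Es -Et natr1.
have H : 1 = (t - s) * (t + s) by transitivity (t ^+ 2 - s ^+ 2); [rewrite E; ring|ring].
rewrite Es Et.
have -> : s * ((s ^+ 2)^-1 - (t ^+ 2)^-1) = (t - s) * (t + s) / (s * t ^+ 2).
  by field; rewrite !gt_eqF.
have -> : 2 * (s^-1 - t^-1) = (t - s) * (2 * t) / (s * t ^+ 2).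
  by field; rewrite !gt_eqF.
rewrite ler_pM2r ?invr_gt0 ?mulr_gt0 ?exprn_gt0 // ler_wpM2l ?subr_ge0 //; lra.
Qed.

Lemma sqrt_sum x y : (0 < x <= y)%N ->
  \sum_(x.+1 <= k < y.+1) Num.sqrt k%:R * (k%:R^-1 - k.+1%:R^-1) <= 2 / Num.sqrt x%:R :> R.
Proof.
move=> /andP [x0 xy].
have sq k : (0 < k)%N -> 0 < Num.sqrt k%:R :> R by move=> ?; rewrite sqrtr_gt0 ltr0n.
apply: (@le_trans _ _ (2 / Num.sqrt x.+1%:R - 2 / Num.sqrt y.+1%:R)); last first.
  rewrite lerBlDr (le_trans (_ : _ <= 2 / Num.sqrt x%:R)) ?lerDl ?divr_ge0 ?sqrtr_ge0 //.
  by rewrite ler_wpM2l // lef_pV2 ?posrE ?sq // ler_sqrt // ler_nat.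
rewrite -(subnKC xy); elim: (y - x)%N => [|n IH].
  by rewrite addn0 big_geq // subrr.
rewrite addnS big_nat_recr ?ltnS ?leq_addr //=.
have := @sqrt_telescope (x + n).+1 isT; move: IH.
move: (\sum_(_ <= _ < _) _) (Num.sqrt _ * _) (Num.sqrt x.+1%:R)^-1.
move: (Num.sqrt (x + n).+1%:R)^-1 (Num.sqrt (x + n).+2%:R)^-1.
by move=> w z T u v IH tele; lra.
Qed.

Lemma divn_lower d x : (0 < d <= x)%N -> x%:R / (2 * d%:R) <= (x %/ d)%:R :> R.
Proof.
move=> /andP [d0 dx]; rewrite ler_pdivrMr ?mulr_gt0 ?ltr0n // -natrM -natrM ler_nat.
have := divn_eq x d; have := ltn_pmod x d0.
have : (0 < x %/ d)%N by rewrite divn_gt0.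
nia.
Qed.

Lemma inv_sqrt_divn d x : (0 < d <= x)%N ->
  (Num.sqrt (x %/ d)%:R)^-1 <= 2 * (rho d / rho x) ^+ 2 :> R.
Proof.
move=> /andP [d0 dx]; have x0 : (0 < x)%N by lia.
have q0 : (0 < x %/ d)%N by rewrite divn_gt0.
have rd := rho_gt0 d0; have rx := rho_gt0 x0.
rewrite -[leLHS]mul1r ler_pdivrMr ?sqrtr_gt0 ?ltr0n //.
rewrite -ler_sqr ?nnegrE ?mulr_ge0 ?sqr_ge0 ?sqrtr_ge0 ?invr_ge0 ?(ltW rx) ?(ltW rd) //.
rewrite [leRHS]exprMn sqr_sqrtr // expr1n.
have := @divn_lower d x; rewrite d0 dx => /(_ isT) H.
apply: le_trans (_ : (2 * (rho d / rho x) ^+ 2) ^+ 2 * (x%:R / (2 * d%:R)) <= _).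
  rewrite -[x%:R]rho4 -[d%:R]rho4 [leRHS](_ : _ = 2) ?ler1n //.
  by field; rewrite !gt_eqF.
by rewrite ler_wpM2l // sqr_ge0.
Qed.

Lemma lg_diff_le d x : (0 < d <= x)%N -> lg x - lg d <= 4 * (rho x / rho d).
Proof.
move=> /andP [d0 dx]; have x0 : (0 < x)%N by lia.
have rd := rho_gt0 d0; have rx := rho_gt0 x0.
rewrite /lg -ln_div ?natr_pos // -[x%:R]rho4 -[d%:R]rho4 -expr_div_n lnXn ?divr_gt0 //.
rewrite -[ln _ *+ 4]mulr_natl ler_wpM2l //; apply: ltW; apply: ln_sublinear.
by rewrite divr_gt0.
Qed.

Lemma lg_divn d x : (0 < d <= x)%N ->
  lg x - lg d - lg 2 <= lg (x %/ d) <= lg x - lg d.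
Proof.
move=> /andP [d0 dx]; have x0 : (0 < x)%N by lia.
have q0 : (0 < x %/ d)%N by rewrite divn_gt0.
apply/andP; split.
  rewrite !lerBlDr -!lgM ?muln_gt0 ?q0 ?d0 //; apply: lg_le; rewrite x0 /=.
  have := divn_eq x d; have := ltn_pmod x d0; nia.
rewrite lerBrDr -lgM //; apply: lg_le; rewrite muln_gt0 q0 d0 /=.
exact: leq_trunc_div.
Qed.

(* The weighted average of [lg], asymptotically [lg ^+ 2 / 2]. *)
Definition Q x : R := psum (fun j => dlg j * lg j) x.

Lemma lg_sqr x : `|lg x.+1 ^+ 2 - 2 * Q x| <= lg x.+1.
Proof.
(* Telescoping: [lg j.+1 ^ 2 - lg j ^ 2 = 2 * dlg j * lg j + dlg j ^ 2]. *)
have -> : lg x.+1 ^+ 2 - 2 * Q x = psum (fun j => dlg j ^+ 2) x.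
  rewrite /Q; elim: x => [|x IH]; first by rewrite !psum0 lg1 expr0n mulr0 subr0.
  by rewrite !psumS -IH /dlg; ring.
rewrite -psum_dlg ger0_norm.
  by rewrite /psum big_nat [leRHS]big_nat; apply: ler_sum => j /andP [j0 _];
     rewrite expr2 ler_piMl ?dlg_ge0 ?dlg_le1.
by rewrite /psum big_nat; apply: sumr_ge0 => j _; rewrite sqr_ge0.
Qed.

Lemma Q_ge x : 2 * Q x >= lg x.+1 * (lg x.+1 - 1).
Proof. have := lg_sqr x; rewrite ler_norml => /andP [_]; lra. Qed.
End RealEstimates.

(** * Mertens-type estimates for the principal character *)

Section PrincipalAverage.
Variable R : realType.
Variables (alpha beta : nat -> R) (c K : R).
Hypothesis alpha_ge0 : forall k, 0 <= alpha k.
Hypothesis beta_ge0 : forall k, 0 <= beta k.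
Hypothesis alpha1 : alpha 1 = 1.
Hypothesis alpha_beta : forall k, (0 < k)%N -> conv alpha beta k = lg R k * alpha k.
Hypothesis alpha_sum : forall x, (0 < x)%N -> `|psum alpha x - c * x%:R| <= K * Num.sqrt x%:R.
Hypothesis c_gt0 : 0 < c.

Local Notation S0 := (psum (fun k => alpha k / k%:R)).
Local Notation B0 := (psum (fun k => beta k / k%:R)).
Local Notation U0 := (psum (fun k => alpha k / k%:R * lg R k)).

Let K_ge0 : 0 <= K.
Proof. by have := alpha_sum (ltn0Sn 0); rewrite sqrtr1 !mulr1 => /(le_trans (normr_ge0 _)). Qed.

Let inv_diff_ge0 k : (0 < k)%N -> 0 <= k%:R^-1 - k.+1%:R^-1 :> R.
Proof. by move=> k0; rewrite subr_ge0 lef_pV2 ?posrE ?ltr0n // ler_nat. Qed.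

(** Abel summation with [psum alpha k = c * k + O(sqrt k)]. The main term becomes the sum of
    [c / k.+1], which differs from [c * lg y.+1] by at most [c]. *)
Lemma S0_lgS y : (0 < y)%N -> `|S0 y - c * lg R y.+1| <= 2 * c + 4 * K.
Proof.
move=> y0; have := @psum_abel R alpha 0 y (leq0n y); rewrite !psum0 subr0 mul0r subr0 => ->.
have Ey : `|psum alpha y / y.+1%:R| <= c + K.
  rewrite normrM [X in _ * X]ger0_norm ?invr_ge0 // ler_pdivrMr ?ltr0n //.
  have -> : psum alpha y = (psum alpha y - c * y%:R) + c * y%:R by ring.
  rewrite (le_trans (ler_normD _ _)) // [X in _ + X]ger0_norm ?mulr_ge0 ?(ltW c_gt0) //.
  have := alpha_sum y0; have : Num.sqrt y%:R <= y%:R :> R.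
    by rewrite -[leRHS]sqr_sqrtr // expr2 ler_peMr ?sqrtr_ge0 // -[X in X <= _]sqrtr1 ler_wsqrtr // ler1n.
  move=> h1 h2; apply: (@le_trans _ _ (K * y%:R + c * y%:R)).
    by rewrite lerD2r (le_trans h2) // ler_wpM2l.
  by rewrite addrC -mulrDl ler_wpM2l ?addr_ge0 ?(ltW c_gt0) // ler_nat.
have Es : `|\sum_(1 <= k < y.+1) psum alpha k * (k%:R^-1 - k.+1%:R^-1) - c * lg R y.+1| <= c + 3 * K.
  have -> : \sum_(1 <= k < y.+1) psum alpha k * (k%:R^-1 - k.+1%:R^-1) - c * lg R y.+1 =
    \sum_(1 <= k < y.+1) (psum alpha k - c * k%:R) * (k%:R^-1 - k.+1%:R^-1) -
    c * \sum_(1 <= k < y.+1) (dlg R k - k.+1%:R^-1).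
    rewrite -psum_dlg /psum !mulr_sumr -!sumrB; apply: eq_big_nat => k /andP [k0 _].
    by rewrite -natr1; field; rewrite !gt_eqF ?addr_gt0 ?ltr0n.
  rewrite (le_trans (ler_normB _ _)) // addrC; apply: lerD.
    rewrite normrM gtr0_norm // ger_pMr //.
    rewrite ger0_norm; last first.
      by rewrite big_nat; apply: sumr_ge0 => k /andP [k0 _]; rewrite subr_ge0 dlg_ge.
    apply: (@le_trans _ _ (\sum_(1 <= k < y.+1) (k%:R^-1 - k.+1%:R^-1))).
      rewrite big_nat [leRHS]big_nat; apply: ler_sum => k /andP [k0 _].
      by rewrite lerD2r dlg_le.
    have -> : \sum_(1 <= k < y.+1) (k%:R^-1 - k.+1%:R^-1) = 1 - y.+1%:R^-1 :> R.
      by rewrite -[LHS]opprK -sumrN; under eq_bigr do rewrite opprB;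
         rewrite (telescope_sumr (fun k => k%:R^-1)) // invr1 opprB.
    by rewrite gerBl invr_ge0.
  apply: le_trans (ler_norm_sum _ _ _) _.
  apply: (@le_trans _ _ (\sum_(1 <= k < y.+1) K * (Num.sqrt k%:R * (k%:R^-1 - k.+1%:R^-1)))).
    rewrite big_nat [leRHS]big_nat; apply: ler_sum => k /andP [k0 _].
    rewrite normrM [X in _ * X]ger0_norm ?inv_diff_ge0 // mulrA.
    by rewrite ler_wpM2r ?inv_diff_ge0 // alpha_sum.
  rewrite -mulr_sumr mulrC ler_wpM2r // big_ltn // sqrtr1 mul1r invr1.
  have := @sqrt_sum R 1 y; rewrite y0 => /(_ isT); rewrite sqrtr1 divr1.
  have : 0 <= 2%:R^-1 :> R by rewrite invr_ge0.
  move: (\sum_(_ <= _ < _) _) (2%:R^-1) => T u; lra.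
rewrite -addrA (le_trans (ler_normD _ _)) //; lra.
Qed.

Let K3 := 3 * c + 4 * K.
Let K3_ge0 : 0 <= K3. Proof. by rewrite /K3 addr_ge0 ?mulr_ge0 ?(ltW c_gt0). Qed.

Lemma S0_lg y : (0 < y)%N -> `|S0 y - c * lg R y| <= K3.
Proof.
move=> y0; have := S0_lgS y0; have := dlg_ge0 R y0; have := dlg_le1 R y0; rewrite /dlg.
move=> h1 h2; have h3 := ltW c_gt0.
have e1 : 0 <= c * (lg R y.+1 - lg R y) by rewrite mulr_ge0.
have e2 : c * (lg R y.+1 - lg R y) <= c by rewrite ger_pMr.
rewrite !ler_norml /K3 => /andP [h4 h5]; apply/andP; split; lra.
Qed.

Lemma S0_ge1 y : (0 < y)%N -> 1 <= S0 y.
Proof.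
move=> y0; rewrite (psum_split _ y0) /psum big_nat1 alpha1 divr1 lerDl.
by apply: sumr_ge0 => k _; rewrite divr_ge0.
Qed.

Lemma psum_le (f : nat -> R) x y : (forall k, 0 <= f k) -> (x <= y)%N -> psum f x <= psum f y.
Proof. by move=> f0 xy; rewrite (psum_split _ xy) lerDl sumr_ge0. Qed.

Lemma U0_conv x : U0 x = psum (fun d => beta d / d%:R * S0 (x %/ d)) x.
Proof.
rewrite -psum_conv; apply: eq_psum => k /andP [k0 _].
by rewrite convC alpha_beta // [lg R k * _]mulrC mulrAC.
Qed.

(** A Chebyshev bound obtained by passing to [x ^ 2]: every [d <= x] has [x ^ 2 / d >= x], so
    [B0 x * S0 x] is at most [U0 (x ^ 2) <= S0 (x ^ 2) * 2 * lg x]. Finally [S0 (x ^ 2) = O(S0 x)],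
    and [S0 x] cancels. *)
Lemma B0_bound x : (0 < x)%N -> B0 x <= 2 * (2 + 3 * K3) * lg R x.
Proof.
move=> x0; have s1 := S0_ge1 x0; have l0 := lg_ge0 R x.
have xx0 : (0 < x * x)%N by rewrite muln_gt0 x0.
have H1 : B0 x * S0 x <= U0 (x * x).
  rewrite U0_conv -psumMr; apply: (@le_trans _ _ (psum (fun d => beta d / d%:R * S0 ((x * x) %/ d)) x)).
    rewrite /psum big_nat [leRHS]big_nat; apply: ler_sum => d /andP [d0 dx].
    rewrite ler_wpM2l ?divr_ge0 //; apply: psum_le; first by move=> k; rewrite divr_ge0.
    by rewrite leq_divRL // leq_mul2l -ltnS dx orbT.
  apply: psum_le; last by rewrite leq_pmulr.
  by move=> k; rewrite mulr_ge0 ?divr_ge0 // sumr_ge0 // => j _; rewrite divr_ge0.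
have H2 : U0 (x * x) <= S0 (x * x) * lg R (x * x).
  rewrite -psumMr /psum big_nat [leRHS]big_nat; apply: ler_sum => k /andP [k0 kx].
  by rewrite ler_wpM2l ?divr_ge0 // lg_le // k0 -ltnS.
rewrite lgM // in H2.
have H3 : S0 (x * x) <= (2 + 3 * K3) * S0 x.
  have := S0_lg xx0; have := S0_lg x0; rewrite lgM // !ler_norml => /andP [h1 h2] /andP [h3 h4].
  have : K3 <= K3 * S0 x by rewrite ler_peMr.
  lra.
have H4 : S0 (x * x) * (lg R x + lg R x) <= (2 + 3 * K3) * S0 x * (lg R x + lg R x).
  by rewrite ler_wpM2r ?addr_ge0.
rewrite -(ler_pM2r (lt_le_trans ltr01 s1)).
apply: le_trans H1 (le_trans H2 (le_trans H4 _)).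
by rewrite le_eqVlt; apply/orP; left; apply/eqP; ring.
Qed.

Lemma U0_asymp x : `|U0 x.+1 - c * Q R x| <= (2 * K3 + c) * lg R x.+1.
Proof.
rewrite (psum_weight (fun k => alpha k / k%:R) (lg R)).
have h1 : `|(S0 x.+1 - c * lg R x.+1) * lg R x.+1| <= K3 * lg R x.+1.
  by rewrite normrM [X in _ * X]ger0_norm ?lg_ge0 // ler_wpM2r ?lg_ge0 // S0_lg.
have h2 : `|psum (fun j => dlg R j * (S0 j - c * lg R j)) x| <= K3 * lg R x.+1.
  apply: le_trans (ler_norm_sum _ _ _) _.
  rewrite -psum_dlg -psumMl /psum big_nat [leRHS]big_nat; apply: ler_sum => k /andP [k0 _].
  by rewrite normrM mulrC [X in _ * X]ger0_norm ?dlg_ge0 // ler_wpM2r ?dlg_ge0 // S0_lg.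
have h3 : `|c * (lg R x.+1 ^+ 2 - 2 * Q R x)| <= c * lg R x.+1.
  by rewrite normrM gtr0_norm // ler_wpM2l ?(ltW c_gt0) // lg_sqr.
have -> : S0 x.+1 * lg R x.+1 - psum (fun j => (lg R j.+1 - lg R j) * S0 j) x - c * Q R x =
  (S0 x.+1 - c * lg R x.+1) * lg R x.+1 - psum (fun j => dlg R j * (S0 j - c * lg R j)) x
  + c * (lg R x.+1 ^+ 2 - 2 * Q R x).
  have -> : psum (fun j => dlg R j * (S0 j - c * lg R j)) x =
    psum (fun j => (lg R j.+1 - lg R j) * S0 j) x - c * Q R x.
    by rewrite /Q -psumMl -psumB; apply: eq_psum => k _; rewrite /dlg; ring.
  by ring.
rewrite (le_trans (ler_normD _ _)) // [leRHS]mulrDl lerD // (le_trans (ler_normB _ _)) //.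
by rewrite (_ : 2 * K3 * _ = K3 * lg R x.+1 + K3 * lg R x.+1) ?lerD //; ring.
Qed.

Lemma lg2_le1 : lg R 2 <= 1.
Proof. by have := dlg_le1 R (ltn0Sn 0); rewrite /dlg lg1 subr0. Qed.

(** The average of [B0] resums to [\sum_d beta d / d * log (x.+1 / d)], while [U0] is the same sum
    with [S0 (x.+1 %/ d) = c * log (x.+1 / d) + O(1)]. The rounding in the quotient costs at most
    [lg 2]. *)
Lemma U0_weight x : `|U0 x.+1 - c * psum (fun j => dlg R j * B0 j) x| <= (K3 + c) * B0 x.+1.
Proof.
have -> : psum (fun j => dlg R j * B0 j) x = psum (fun d => beta d / d%:R * (lg R x.+1 - lg R d)) x.+1.
  have := psum_weight (fun k => beta k / k%:R) (lg R) x; rewrite /dlg.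
  under [X in _ -> _ = X]eq_psum do rewrite mulrBr.
  by rewrite psumB psumMr => ->; ring.
rewrite U0_conv -psumMl -psumB -psumMl; apply: le_trans (ler_norm_sum _ _ _) _.
rewrite /psum big_nat [leRHS]big_nat; apply: ler_sum => d /andP [d0 dx].
have b0 : 0 <= beta d / d%:R by rewrite divr_ge0.
rewrite (mulrCA c) -mulrBr normrM (ger0_norm b0) [leRHS]mulrC ler_wpM2l //.
have dx' : (0 < d <= x.+1)%N by rewrite d0.
have q0 : (0 < x.+1 %/ d)%N by rewrite divn_gt0.
have /andP [l1 l2] := lg_divn R dx'; have := S0_lg q0; have l3 := lg2_le1.
have e1 : c * (lg R x.+1 - lg R d - lg R 2) <= c * lg R (x.+1 %/ d) by rewrite ler_wpM2l ?(ltW c_gt0).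
have e2 : c * lg R (x.+1 %/ d) <= c * (lg R x.+1 - lg R d) by rewrite ler_wpM2l ?(ltW c_gt0).
have e3 : c * lg R 2 <= c by rewrite ger_pMr.
rewrite -/(psum (fun k => alpha k / k%:R) (x.+1 %/ d)).
rewrite !ler_norml => /andP [h1 h2]; apply/andP; split; lra.
Qed.

(** [U0] is evaluated twice, as [c * Q] and as [c] times the average of [B0], both up to a
    logarithm; dividing by [c] compares the two. The error is negligible because [Q] grows like
    [lg ^ 2 / 2]. *)
Theorem avg_principal : exists K0, forall X,
  [/\ S0 X <= K0 * (1 + lg R X.+1), B0 X <= K0 * (1 + lg R X.+1) &
   `|psum (fun j => dlg R j * B0 j) X - Q R X| <= K0 * (1 + lg R X.+1)].
Proof.
set Bc := 2 * (2 + 3 * K3); set D := (2 * K3 + c) + (K3 + c) * Bc.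
have c0 := ltW c_gt0; have Bc0 : 0 <= Bc by rewrite mulr_ge0 ?addr_ge0 ?mulr_ge0.
have D0 : 0 <= D by rewrite addr_ge0 ?mulr_ge0 ?addr_ge0 // mulr_ge0.
exists (c + K3 + Bc + D / c) => X.
have L0 := lg_ge0 R X.+1; set E := 1 + lg R X.+1.
have E0 : 0 <= E by rewrite addr_ge0.
have Dc : 0 <= D / c by rewrite divr_ge0.
have scale u v : v <= u * E -> 0 <= u -> u <= c + K3 + Bc + D / c -> v <= (c + K3 + Bc + D / c) * E.
  by move=> vu u0 uK; apply: le_trans vu _; rewrite ler_wpM2r.
split.
- apply: (@scale (c + K3)); [|exact: addr_ge0|by rewrite -addrA lerDl addr_ge0].
  case: X @E L0 E0 {scale} => [|X] E L0 E0; first by rewrite psum0 mulr_ge0 // addr_ge0.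
  have := S0_lg (ltn0Sn X); rewrite ler_norml => /andP [_ h].
  have l : lg R X.+1 <= lg R X.+2 by apply: lg_le; rewrite /= leqnSn.
  have : c * lg R X.+1 <= c * lg R X.+2 by rewrite ler_wpM2l.
  have : 0 <= K3 * lg R X.+2 by rewrite mulr_ge0.
  rewrite /E; move: (S0 X.+1) h => S h h1 h2; nra.
- apply: (@scale Bc) => //; last by have := K3_ge0; lra.
  case: X @E L0 E0 {scale} => [|X] E L0 E0; first by rewrite psum0 mulr_ge0.
  apply: le_trans (B0_bound _) _ => //; rewrite ler_wpM2l //.
  by apply: (@le_trans _ _ (lg R X.+2)); [apply: lg_le; rewrite /= leqnSn|rewrite /E lerDr].
apply: (@scale (D / c)) => //; last by rewrite lerDr addr_ge0 // addr_ge0.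
rewrite mulrAC ler_pdivlMr // mulrC -[X in X * _](gtr0_norm c_gt0) -normrM mulrBr.
rewrite distrC; set T := psum _ X.
have -> : c * Q R X - c * T = (U0 X.+1 - c * T) - (U0 X.+1 - c * Q R X) by ring.
apply: le_trans (ler_normB _ _) _.
have h1 := U0_weight X; have h2 := U0_asymp X; have h3 := B0_bound (ltn0Sn X).
have h4 : (K3 + c) * B0 X.+1 <= (K3 + c) * (Bc * lg R X.+1) by rewrite ler_wpM2l // addr_ge0.
apply: (@le_trans _ _ (D * lg R X.+1)); last by rewrite ler_wpM2l // /E lerDr.
rewrite (_ : D * _ = (K3 + c) * (Bc * lg R X.+1) + (2 * K3 + c) * lg R X.+1); last first.
  by rewrite /D; ring.
exact: lerD (le_trans h1 h4) h2.
Qed.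
End PrincipalAverage.

(** * Averages for nonprincipal characters, with L(1, chi) nonzero or zero *)

Section CharacterAverage.
Variable R : realType.
Local Notation C := (R[i]).
Local Notation nc := (@Normc.normc R).
Local Notation toC := (real_complex R).

Lemma nc_real (r : R) : nc (toC r) = `|r|.
Proof. by rewrite /Normc.normc /= expr0n addr0 sqrtr_sqr. Qed.
Lemma nc_ge0 (z : C) : 0 <= nc z.
Proof. by case: z => a b; rewrite sqrtr_ge0. Qed.
Lemma nc_sum (I : Type) (r : seq I) (P : pred I) (F : I -> C) :
  nc (\sum_(i <- r | P i) F i) <= \sum_(i <- r | P i) nc (F i).
Proof.
elim/big_rec2: _ => [|i y x _ H]; first by rewrite Normc.normc0.
by rewrite (le_trans (le_normcD _ _)) // lerD2l.
Qed.
Lemma nc_natV k : nc (k%:R^-1) = k%:R^-1.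
Proof.
have -> : k%:R^-1 = toC (k%:R^-1) :> C by rewrite fmorphV rmorph_nat.
by rewrite nc_real ger0_norm ?invr_ge0.
Qed.
Lemma nc_div (z : C) k : nc (z / k%:R) = nc z / k%:R.
Proof. by rewrite Normc.normcM nc_natV. Qed.
Lemma ncB (z t : C) : nc (z - t) <= nc z + nc t.
Proof. by rewrite (le_trans (le_normcD _ _)) // normcN. Qed.

Lemma nc_psum (f : nat -> C) (g : nat -> R) x :
  (forall k, (0 < k <= x)%N -> nc (f k) <= g k) -> nc (psum f x) <= psum g x.
Proof.
move=> H; apply: le_trans (nc_sum _ _ _) _; rewrite /psum big_nat [leRHS]big_nat.
by apply: ler_sum => k; rewrite ltnS; apply: H.
Qed.

(** After exchanging sums, the tail of [dlg x / rho x] over [x >= d] is at most [5 / rho d], which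
    cancels [rho d]. *)
Lemma smooth_average (f : nat -> R) X : (forall d, 0 <= f d) ->
  psum (fun x => dlg R x * psum (fun d => f d * (rho R d / rho R x)) x) X <= 5 * psum f X.
Proof.
move=> f0.
have -> : psum (fun x => dlg R x * psum (fun d => f d * (rho R d / rho R x)) x) X =
  psum (fun d => f d * rho R d * \sum_(d <= x < X.+1) dlg R x / rho R x) X.
  transitivity (psum (fun x => psum (fun d => f d * rho R d * (dlg R x / rho R x)) x) X).
    by apply: eq_psum => x _; rewrite -psumMl; apply: eq_psum => d _; ring.
  by rewrite psum_swap; apply: eq_psum => d _; rewrite mulr_sumr.
rewrite -psumMl /psum big_nat [leRHS]big_nat; apply: ler_sum => d /andP [d0 dX].
have rd := rho_gt0 R d0.
apply: (@le_trans _ _ (f d * rho R d * (5 / rho R d))).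
  rewrite ler_wpM2l ?mulr_ge0 ?(ltW rd) //; apply: le_trans (rho_sum R X d0).
  rewrite big_nat [leRHS]big_nat; apply: ler_sum => x /andP [dx _].
  have x0 : (0 < x)%N by lia.
  by rewrite invfM ler_wpM2r ?invr_ge0 ?(ltW (rho_gt0 R x0)) // dlg_le.
by rewrite le_eqVlt; apply/orP; left; apply/eqP; field; rewrite gt_eqF.
Qed.

Variables (a b m : nat -> C) (alpha beta : nat -> R) (K K0 : R).
Local Notation S := (psum (fun k => a k / k%:R)).
Local Notation B := (psum (fun k => b k / k%:R)).
Local Notation S0 := (psum (fun k => alpha k / k%:R)).
Local Notation B0 := (psum (fun k => beta k / k%:R)).
Hypothesis b_beta : forall k, nc (b k) <= beta k.
Hypothesis m_alpha : forall k, nc (m k) <= alpha k.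
Hypothesis B0_le : forall X, B0 X <= K0 * (1 + lg R X.+1).
Hypothesis S0_le : forall X, S0 X <= K0 * (1 + lg R X.+1).

(** This encodes [L(1, chi) = 0] without a limit: [S_diff] shows that the partial sums [S] converge
    with error [O(1 / sqrt y)], so the bound says exactly that their limit vanishes. *)
Definition exceptional := exists K1, forall y, (0 < y)%N -> nc (S y) <= K1 / Num.sqrt y%:R.

Let beta0 k : 0 <= beta k. Proof. exact: le_trans (nc_ge0 _) (b_beta k). Qed.
Let alpha0 k : 0 <= alpha k. Proof. exact: le_trans (nc_ge0 _) (m_alpha k). Qed.
Let fb k : 0 <= beta k / k%:R. Proof. by rewrite divr_ge0. Qed.
Let fa k : 0 <= alpha k / k%:R. Proof. by rewrite divr_ge0. Qed.
Let K0_ge0 : 0 <= K0.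
Proof. by have := B0_le 0; rewrite psum0 lg1 addr0 mulr1. Qed.

Section NonPrincipal.
Hypothesis a_b : forall k, (0 < k)%N -> conv a b k = toC (lg R k) * a k.
Hypothesis a_sum : forall x, nc (psum a x) <= K * Num.sqrt x%:R.

Let K_ge0 : 0 <= K.
Proof. by have := a_sum 1; rewrite sqrtr1 mulr1 => /(le_trans (nc_ge0 _)). Qed.

Lemma S_diff x y : (0 < x <= y)%N -> nc (S y - S x) <= 4 * K / Num.sqrt x%:R.
Proof.
move=> /andP [x0 xy]; have y0 : (0 < y)%N by lia.
have sq k : (0 < k)%N -> 0 < Num.sqrt k%:R :> R by move=> ?; rewrite sqrtr_gt0 ltr0n.
have end_bound k : (x <= k)%N -> nc (psum a k / k.+1%:R) <= K / Num.sqrt x%:R.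
  move=> xk; have k0 : (0 < k)%N by lia.
  rewrite nc_div; apply: (@le_trans _ _ (K * Num.sqrt k%:R / k%:R)).
    apply: ler_pM; rewrite ?nc_ge0 ?invr_ge0 // lef_pV2 ?posrE ?ltr0n //.
    by rewrite ler_nat.
  rewrite -mulrA ler_wpM2l // -[X in _ / X](sqr_sqrtr (ler0n R k)).
  have -> : Num.sqrt k%:R / Num.sqrt k%:R ^+ 2 = (Num.sqrt k%:R)^-1 :> R.
    by field; rewrite gt_eqF ?sq.
  by rewrite lef_pV2 ?posrE ?sq // ler_wsqrtr // ler_nat.
rewrite psum_abel //.
have -> : 4 * K / Num.sqrt x%:R = K / Num.sqrt x%:R + K / Num.sqrt x%:R + K * (2 / Num.sqrt x%:R).
  by field; rewrite gt_eqF ?sq.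
apply: le_trans (le_normcD _ _) _; apply: lerD.
  by apply: le_trans (ncB _ _) _; apply: lerD; apply: end_bound.
apply: le_trans (nc_sum _ _ _) _.
apply: (@le_trans _ _ (\sum_(x.+1 <= k < y.+1) K * (Num.sqrt k%:R * (k%:R^-1 - k.+1%:R^-1)))).
  rewrite big_nat [leRHS]big_nat; apply: ler_sum => k /andP [k0 _].
  have -> : k%:R^-1 - k.+1%:R^-1 = toC (k%:R^-1 - k.+1%:R^-1) :> C.
    by rewrite rmorphB !fmorphV !rmorph_nat.
  rewrite Normc.normcM nc_real ger0_norm; last first.
    by rewrite subr_ge0 lef_pV2 ?posrE ?ltr0n // ?ler_nat //; lia.
  rewrite mulrA ler_wpM2r // subr_ge0 lef_pV2 ?posrE ?ltr0n // ?ler_nat //; lia.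
by rewrite -mulr_sumr ler_wpM2l // sqrt_sum // x0.
Qed.

Lemma U_bound x : nc (psum (fun k => a k / k%:R * toC (lg R k)) x) <= 20 * K.
Proof.
case: x => [|x]; first by rewrite psum0 Normc.normc0 mulr_ge0.
rewrite (psum_weight (fun k => a k / k%:R) (fun k => toC (lg R k))).
have -> : toC (lg R x.+1) = psum (fun j => toC (dlg R j)) x.
  by rewrite -psum_dlg /psum rmorph_sum.
(* Writing the logarithm as a sum of [dlg] gathers everything into [\sum_j dlg j * (S x.+1 - S j)],
   whose terms are [O(j ^ (-3/2))]. *)
rewrite -psumMl -psumB.
apply: le_trans (_ : psum (fun j => 4 * K * (j%:R * rho R j)^-1) x <= _).
  apply: nc_psum => j /andP [j0 jx].
  have -> : S x.+1 * toC (dlg R j) - (toC (lg R j.+1) - toC (lg R j)) * S j =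
     (S x.+1 - S j) * toC (dlg R j).
    by rewrite /dlg rmorphB /=; ring.
  rewrite Normc.normcM nc_real ger0_norm ?dlg_ge0 //.
  apply: (@le_trans _ _ (4 * K / Num.sqrt j%:R * j%:R^-1)).
    apply: ler_pM; rewrite ?nc_ge0 ?dlg_ge0 ?dlg_le // S_diff // j0; lia.
  rewrite invfM -mulrA ler_wpM2l ?mulr_ge0 // mulrC ler_wpM2l ?invr_ge0 //.
  rewrite lef_pV2 ?posrE ?rho_gt0 ?sqrtr_gt0 ?ltr0n // -rho2 expr2.
  by rewrite ler_peMl ?rho_ge1 // ltW // rho_gt0.
rewrite psumMl; have := @rho_sum R 1 x isT.
have -> : rho R 1 = 1 by rewrite /rho !sqrtr1.
rewrite divr1 -/(psum (fun j => (j%:R * rho R j)^-1) x) => h.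
by rewrite (_ : 20 * K = 4 * K * 5) ?ler_wpM2l ?mulr_ge0 //; ring.
Qed.

(** The logarithmic sum [\sum a k / k * lg k] equals [\sum b d / d * S (x %/ d)] and stays bounded.
    Replacing [S (x %/ d)] by [S x] costs [O(sqrt (d / x))], of which only the fourth root is
    kept. *)
Lemma SB_bound x : (0 < x)%N ->
  nc (S x) * nc (B x) <= 20 * K + 8 * K * psum (fun d => beta d / d%:R * (rho R d / rho R x)) x.
Proof.
move=> x0; rewrite -Normc.normcM.
have E : psum (fun k => a k / k%:R * toC (lg R k)) x = psum (fun d => b d / d%:R * S (x %/ d)) x.
  rewrite -psum_conv; apply: eq_psum => k /andP [k0 _].
  by rewrite convC a_b // [_ * a k]mulrC mulrAC.
have -> : S x * B x = psum (fun k => a k / k%:R * toC (lg R k)) x +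
    psum (fun d => b d / d%:R * (S x - S (x %/ d))) x.
  by rewrite E -psumD mulrC -psumMr; apply: eq_psum => d _; ring.
apply: le_trans (le_normcD _ _) _; apply: lerD; first exact: U_bound.
rewrite -psumMl; apply: nc_psum => d /andP [d0 dx].
have q0 : (0 < x %/ d)%N by rewrite divn_gt0.
have rd := rho_gt0 R d0; have rx := rho_gt0 R x0.
rewrite Normc.normcM nc_div; apply: (@le_trans _ _ (beta d / d%:R * (8 * K * (rho R d / rho R x)))).
  apply: ler_pM; rewrite ?divr_ge0 ?nc_ge0 // ?ler_wpM2r ?invr_ge0 //.
  apply: le_trans (S_diff _) _; first by rewrite q0 leq_div.
  have dx' : (0 < d <= x)%N by rewrite d0.
  rewrite (_ : 8 * K * _ = 4 * K * (2 * (rho R d / rho R x))); last by ring.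
  rewrite ler_wpM2l ?mulr_ge0 //; apply: le_trans (inv_sqrt_divn R dx') _.
  rewrite ler_wpM2l // expr2 ler_piMl ?divr_ge0 ?(ltW rd) ?(ltW rx) //.
  by rewrite ler_pdivrMr // mul1r rho_le.
by rewrite le_eqVlt; apply/orP; left; apply/eqP; ring.
Qed.

(** Negating [exceptional] at the constant [4 * K] gives an [x0] where [S] exceeds its maximal later
    variation, so [S] stays at distance [delta] from 0 beyond [x0] and can be divided out of
    [SB_bound]. Below [x0], [B] is bounded by [B0 x0]. *)
Theorem avg_nonexceptional : ~ exceptional -> exists K1, forall X,
  nc (psum (fun x => toC (dlg R x) * B x) X) <= K1 * (1 + lg R X.+1).
Proof.
move=> nexc.
have [x0 [x00 Hx0]] : exists x0, (0 < x0)%N /\ 4 * K / Num.sqrt x0%:R < nc (S x0).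
  apply: contrapT => H; apply: nexc; exists (4 * K) => y y0.
  by rewrite leNgt; apply/negP => h; apply: H; exists y.
set delta := nc (S x0) - 4 * K / Num.sqrt x0%:R.
have delta0 : 0 < delta by rewrite subr_gt0.
have lowS x : (x0 <= x)%N -> delta <= nc (S x).
  move=> xx; have := @S_diff x0 x; rewrite x00 xx => /(_ isT) h.
  have : nc (S x0) <= nc (S x) + nc (S x - S x0).
    have := ncB (S x) (S x - S x0); rewrite (_ : S x - (S x - S x0) = S x0) //; ring.
  by rewrite /delta; lra.
have B_le x : nc (B x) <= B0 x.
  by apply: nc_psum => k _; rewrite nc_div ler_wpM2r ?invr_ge0.
set M := B0 x0 + 20 * K / delta; set N := 8 * K / delta.
have M0 : 0 <= M by rewrite addr_ge0 ?divr_ge0 ?mulr_ge0 ?(ltW delta0) // sumr_ge0.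
have N0 : 0 <= N by rewrite divr_ge0 ?mulr_ge0 ?(ltW delta0).
have bound x : (0 < x)%N ->
    nc (B x) <= M + N * psum (fun d => beta d / d%:R * (rho R d / rho R x)) x.
  move=> xpos; set P := psum (fun d => _ * (_ / _)) x.
  have P0 : 0 <= P by rewrite sumr_ge0 // => d _; rewrite mulr_ge0 // divr_ge0 ?sqrtr_ge0.
  have [xx|xx] := leqP x0 x; last first.
    apply: le_trans (B_le x) _; rewrite -[leLHS]addr0; apply: lerD; last exact: mulr_ge0.
    apply: (@le_trans _ _ (B0 x0)); first by apply: psum_le => //; apply: ltnW.
    by rewrite lerDl divr_ge0 ?mulr_ge0 ?(ltW delta0).
  have h1 := SB_bound xpos; have h2 := lowS x xx.
  have : nc (B x) <= (20 * K + 8 * K * P) / delta.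
    rewrite ler_pdivlMr // mulrC; apply: le_trans h1.
    by rewrite ler_wpM2r ?nc_ge0.
  move=> /le_trans; apply; rewrite mulrDl [8 * K * P / _]mulrAC lerD2r /M.
  by rewrite lerDr sumr_ge0.
exists (M + N * (5 * K0)) => X.
apply: le_trans (_ : psum (fun x => M * dlg R x +
   N * (dlg R x * psum (fun d => beta d / d%:R * (rho R d / rho R x)) x)) X <= _).
  apply: nc_psum => x /andP [xpos _].
  rewrite Normc.normcM nc_real ger0_norm ?dlg_ge0 //.
  apply: le_trans (ler_wpM2l (dlg_ge0 R xpos) (bound x xpos)) _.
  by rewrite le_eqVlt; apply/orP; left; apply/eqP; ring.
rewrite psumD !psumMl psum_dlg [leRHS]mulrDl; apply: lerD.
  by rewrite ler_wpM2l // lerDr.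
rewrite -mulrA ler_wpM2l //; apply: le_trans (smooth_average _ _) _ => //.
by rewrite -mulrA ler_wpM2l.
Qed.
End NonPrincipal.

Section Exceptional.
Hypothesis m_a : forall k, (0 < k)%N -> conv m a k = delta1 C k.
Hypothesis b_m : forall k, (0 < k)%N -> b k = - conv (fun i => toC (lg R i) * m i) a k.

(** Moebius inversion writes the left side as [\sum_d log (x / d) * m d / d * S (x %/ d)]. Since [S]
    decays like an inverse square root, the logarithm is absorbed at the cost of one factor
    [rho x / rho d]. *)
Lemma lgB_bound K1 x : (0 < x)%N -> 0 <= K1 ->
  (forall y, (0 < y)%N -> nc (S y) <= K1 / Num.sqrt y%:R) ->
  nc (toC (lg R x) + B x) <= 8 * K1 * psum (fun d => alpha d / d%:R * (rho R d / rho R x)) x.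
Proof.
move=> x0 K1_ge0 HS.
have -> : toC (lg R x) + B x =
    psum (fun d => (toC (lg R x - lg R d) * m d) / d%:R * S (x %/ d)) x.
  rewrite -(psum_conv (fun d => toC (lg R x - lg R d) * m d) a).
  transitivity (psum (fun k => (toC (lg R x) * delta1 C k + b k) / k%:R) x).
    have lgE : toC (lg R x) = psum (fun k => toC (lg R x) * delta1 C k / k%:R) x.
      case: x x0 => // x _; rewrite /psum big_ltn // big1_seq ?addr0.
        by rewrite /delta1 eqxx mulr1 divr1.
      move=> k /andP [_]; rewrite mem_index_iota => /andP [k1 _].
      by rewrite /delta1 gtn_eqF // mulr0 mul0r.
    by rewrite [in LHS]lgE -psumD; apply: eq_psum => k _; rewrite mulrDl.
  apply: eq_psum => k /andP [k0 _]; congr (_ / _).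
  rewrite b_m // -m_a //.
  have -> : conv (fun d => toC (lg R x - lg R d) * m d) a k =
     conv (fun d => toC (lg R x) * m d) a k - conv (fun d => toC (lg R d) * m d) a k.
    rewrite /conv -sumrB; apply: eq_bigr => i _; rewrite -sumrB; apply: eq_bigr => j _.
    by rewrite rmorphB /=; ring.
  congr (_ - _); rewrite /conv mulr_sumr; apply: eq_bigr => i _.
  by rewrite mulr_sumr; apply: eq_bigr => j _; rewrite mulrA.
rewrite -psumMl; apply: nc_psum => d /andP [d0 dx].
have q0 : (0 < x %/ d)%N by rewrite divn_gt0.
have dx' : (0 < d <= x)%N by rewrite d0.
have rd := rho_gt0 R d0; have rx := rho_gt0 R x0.
rewrite Normc.normcM nc_div Normc.normcM nc_real ger0_norm; last first.
  by rewrite subr_ge0 lg_le.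
apply: (@le_trans _ _ ((4 * (rho R x / rho R d)) * alpha d / d%:R * (K1 * (2 * (rho R d / rho R x) ^+ 2)))).
  apply: ler_pM; rewrite ?nc_ge0 ?divr_ge0 ?mulr_ge0 ?nc_ge0 ?subr_ge0 ?lg_le //.
    rewrite ler_wpM2r ?invr_ge0 //; apply: ler_pM; rewrite ?nc_ge0 ?subr_ge0 ?lg_le //.
    exact: lg_diff_le.
  apply: le_trans (HS _ q0) _; rewrite ler_wpM2l //; exact: inv_sqrt_divn.
by rewrite le_eqVlt; apply/orP; left; apply/eqP; field; rewrite !gt_eqF // ltr0n.
Qed.

Theorem avg_exceptional : exceptional -> exists K1, forall X,
  nc (psum (fun x => toC (dlg R x) * B x) X + toC (Q R X)) <= K1 * (1 + lg R X.+1).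
Proof.
move=> [K1 HS]; have K1_ge0 : 0 <= K1.
  by have := HS 1%N isT; rewrite sqrtr1 divr1; apply: le_trans (nc_ge0 _).
exists (8 * K1 * (5 * K0)) => X.
have -> : psum (fun x => toC (dlg R x) * B x) X + toC (Q R X) =
   psum (fun x => toC (dlg R x) * (toC (lg R x) + B x)) X.
  by rewrite /Q /psum rmorph_sum /= -big_split /=; apply: eq_bigr => x _; rewrite rmorphM /=; ring.
apply: le_trans (_ : psum (fun x => 8 * K1 *
   (dlg R x * psum (fun d => alpha d / d%:R * (rho R d / rho R x)) x)) X <= _).
  apply: nc_psum => x /andP [xpos _].
  rewrite Normc.normcM nc_real ger0_norm ?dlg_ge0 // mulrCA ler_wpM2l ?dlg_ge0 //.
  exact: lgB_bound.
rewrite psumMl -[leRHS]mulrA ler_wpM2l ?mulr_ge0 //; apply: le_trans (smooth_average _ _) _ => //.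
by rewrite -[leRHS]mulrA ler_wpM2l.
Qed.
End Exceptional.
End CharacterAverage.

(** * Characters of finite abelian groups *)

Section FiniteCharacters.
Variable gT : finGroupType.

(* Additive encoding of characters: [f] stands for [g |-> z ^+ f g] with [z] a primitive
   root of unity of order [chr_order]; the factor 2 keeps ['Z_chr_order] honest when [gT] is trivial. *)
Definition chr_order := (2 * #|gT|)%N.
Definition is_chr (f : {ffun gT -> 'Z_chr_order}) :=
  [forall x, forall y, f (x * y)%g == f x + f y].

Lemma chr_order_gt1 : (1 < chr_order)%N.
Proof.
by have : (0 < #|gT|)%N by [apply/card_gt0P; exists 1%g]; rewrite /chr_order; lia.
Qed.

Lemma is_chrP (f : {ffun gT -> 'Z_chr_order}) : reflect (forall x y, f (x * y)%g = f x + f y) (is_chr f).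
Proof. by apply: (iffP forallP) => [H x y|H x]; [apply/eqP/(forallP (H x))|apply/forallP => y; rewrite H]. Qed.

Lemma is_chr0 : is_chr 0.
Proof. by apply/is_chrP => x y; rewrite !ffunE addr0. Qed.
Lemma is_chrD (f f' : {ffun gT -> 'Z_chr_order}) : is_chr f -> is_chr f' -> is_chr (f + f').
Proof. by move=> /is_chrP H /is_chrP H'; apply/is_chrP => x y; rewrite !ffunE H H' addrACA. Qed.
Lemma is_chrN (f : {ffun gT -> 'Z_chr_order}) : is_chr f -> is_chr (- f).
Proof. by move=> /is_chrP H; apply/is_chrP => x y; rewrite !ffunE H opprD. Qed.
Lemma chr1 (f : {ffun gT -> 'Z_chr_order}) : is_chr f -> f 1%g = 0.
Proof. by move=> /is_chrP H; have := H 1%g 1%g; rewrite mulg1 -[LHS]addr0 => /addrI. Qed.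

Section Values.
Variables (F : fieldType) (z : F).
Hypothesis prim_z : chr_order.-primitive_root z.
Implicit Types f : {ffun gT -> 'Z_chr_order}.

Definition chi f g : F := z ^+ (f g : nat).

Lemma exprZ_D (a b : 'Z_chr_order) : z ^+ (a + b : 'Z_chr_order)%R = z ^+ a * z ^+ b.
Proof.
rewrite -exprD -[RHS](prim_expr_mod prim_z); congr (_ ^+ _) => /=.
by congr (_ %% _)%N; rewrite Zp_cast ?chr_order_gt1.
Qed.

Lemma chiM f x y : is_chr f -> chi f (x * y)%g = chi f x * chi f y.
Proof. by move=> /is_chrP H; rewrite /chi H exprZ_D. Qed.
Lemma chiD f f' x : chi (f + f') x = chi f x * chi f' x.
Proof. by rewrite /chi ffunE exprZ_D. Qed.
Lemma chi0 x : chi 0 x = 1.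
Proof. by rewrite /chi ffunE expr0. Qed.
Lemma chi1 f : is_chr f -> chi f 1%g = 1.
Proof. by move=> /chr1; rewrite /chi => ->. Qed.
Lemma chi_neq0 f x : chi f x != 0.
Proof.
rewrite /chi expf_neq0 //; apply/eqP => z0; have := prim_expr_order prim_z.
by rewrite z0 expr0n gtn_eqF ?(ltnW chr_order_gt1) // => /esym/eqP; rewrite oner_eq0.
Qed.
Lemma chiN f x : chi (- f) x = (chi f x)^-1.
Proof. by apply: (mulIf (chi_neq0 f x)); rewrite -chiD addNr chi0 mulVf ?chi_neq0. Qed.
Lemma chiX f x : chi f x ^+ chr_order = 1.
Proof. by rewrite /chi exprAC (prim_expr_order prim_z) expr1n. Qed.

Lemma chi_eq1 f x : (chi f x == 1) = (f x == 0).
Proof.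
rewrite /chi -(expr0 z) (eq_prim_root_expr prim_z) mod0n modn_small //.
by have := ltn_ord (f x); rewrite [X in (_ < X)%N]Zp_cast ?chr_order_gt1.
Qed.

Lemma sum_chi_group f : is_chr f -> f != 0 -> \sum_x chi f x = 0.
Proof.
move=> hf f0; have [y fy] : exists y, f y != 0.
  apply/existsP; apply: contraNT f0 => /existsPn H; apply/eqP/ffunP => y.
  by rewrite ffunE; apply/eqP; have := H y; rewrite negbK.
apply/eqP; have : chi f y * \sum_x chi f x = \sum_x chi f x.
  rewrite mulr_sumr [RHS](reindex_inj (mulgI y)) /=.
  by apply: eq_bigr => x _; rewrite chiM.
move/eqP; rewrite -subr_eq0 -{2}[\sum_x _]mul1r -mulrBl mulf_eq0 subr_eq0 chi_eq1.
by rewrite (negPf fy).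
Qed.

Hypothesis gT_abelian : abelian [set: gT].

(** The kernels of the irreducible characters meet trivially. Only the exponents of their algebraic
    values with respect to a primitive root [w] are kept, so that the result can be used with a root
    of unity in any field. *)
Lemma exists_chr g : g != 1%g -> exists2 f, is_chr f & f g != 0.
Proof.
move=> g1; have e0 : (0 < chr_order)%N by apply: ltnW; apply: chr_order_gt1.
have [i chig] : exists i : Iirr [set: gT], 'chi_i g != 'chi_i 1%g.
  apply/existsP; apply: contraNT g1 => /existsPn H; apply/eqP/set1gP.
  rewrite -(TI_cfker_irr [set: gT]); apply/bigcapP => i _.
  by rewrite cfkerEirr !inE; have := H i; rewrite negbK.
have lin_i : 'chi_i \is a linear_char by apply/char_abelianP.
have [w prim_w] := C_prim_root_exists e0.
have w1 x : 'chi_i x ^+ chr_order = 1.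
  have xg : (x ^+ #|gT|)%g = 1%g.
    by have := @expg_cardG gT [set: gT]%G x; rewrite cardsT inE; apply.
  have h : 'chi_i x ^+ #|gT| = 1 by rewrite -lin_charX ?inE // xg lin_char1.
  by rewrite /chr_order mulnC exprM h expr1n.
pose k x := sval (prim_rootP prim_w (w1 x)).
have kE x : 'chi_i x = w ^+ k x by rewrite /k; case: (prim_rootP _ _).
have modE a : ((inZp a : 'Z_chr_order) : nat) = (a %% chr_order)%N.
  by rewrite /= Zp_cast ?chr_order_gt1.
exists [ffun x => inZp (k x)].
  apply/is_chrP => x y; rewrite !ffunE; apply: val_inj => /=.
  rewrite [in LHS]Zp_cast ?chr_order_gt1 // !Zp_cast ?chr_order_gt1 // modnDm.
  by apply/eqP; rewrite -(eq_prim_root_expr prim_w) exprD -!kE lin_charM ?inE.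
apply: contraNneq chig; rewrite ffunE => /(congr1 val) /=.
rewrite Zp_cast ?chr_order_gt1 // => kg.
by rewrite lin_char1 // kE -(prim_expr_mod prim_w) kg expr0.
Qed.

Lemma sum_chi_dual g : g != 1%g -> \sum_(f | is_chr f) chi f g = 0.
Proof.
move=> /exists_chr [f0 hf0 f0g].
apply/eqP; have : chi f0 g * (\sum_(f | is_chr f) chi f g) = \sum_(f | is_chr f) chi f g.
  rewrite mulr_sumr [RHS](reindex_inj (addrI f0)) /=; apply: eq_big => [f|f _].
    by apply/idP/idP => [|H]; [apply: is_chrD|rewrite -[f](addKr f0) is_chrD // is_chrN].
  by rewrite chiD.
move/eqP; rewrite -subr_eq0 -{2}[\sum_(f | _) _]mul1r -mulrBl mulf_eq0 subr_eq0 chi_eq1.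
by rewrite (negPf f0g).
Qed.
End Values.
End FiniteCharacters.

Lemma closed_prim_root (F : closedFieldType) (n : nat) :
  (0 < n)%N -> n%:R != 0 :> F -> exists z : F, n.-primitive_root z.
Proof.
pose p : {poly F} := 'X^n - 1; have [r Dp] := closed_field_poly_normal p.
move=> n_gt0 n0; rewrite (monicP _) ?monicXnsubC // scale1r in Dp.
have rn1 : all n.-unity_root r by apply/allP => z; rewrite -root_prod_XsubC -Dp.
have sz_r : (n < (size r).+1)%N by rewrite -(size_prod_XsubC r id) -Dp size_XnsubC.
have [|z] := hasP (has_prim_root n_gt0 rn1 _ sz_r); last by exists z.
by rewrite -separable_prod_XsubC -Dp separable_Xn_sub_1.
Qed.

(** * Eisenstein primes in residue classes *)

Section Reduction.
Variable m : nat.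
Hypothesis m_gt1 : (1 < m)%N.
Implicit Types n h : eis int.

Definition ered n : eis 'Z_m := Eis (ere n)%:~R (eim n)%:~R.

Lemma ered1 : ered 1 = 1. Proof. by []. Qed.
Lemma eredM n h : ered (n * h) = ered n * ered h.
Proof. by apply: eis_eqP; rewrite !eisE /= !rmorphB ?rmorphD !rmorphM. Qed.
Lemma eredX n k : ered (n ^+ k) = ered n ^+ k.
Proof. by elim: k => // k IH; rewrite !exprS eredM IH. Qed.
Lemma eis_norm_ered n : eis_norm (ered n) = (eis_norm n)%:~R.
Proof. by rewrite /eis_norm /= rmorphD rmorphB !rmorphXn rmorphM. Qed.

Lemma intr_Zp_eq0 (k : int) : (k%:~R == 0 :> 'Z_m) = (m %| k)%Z.
Proof.
have nat_eq0 (j : nat) : (j%:R == 0 :> 'Z_m) = (m %| j)%N.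
  by rewrite -val_eqE /= val_Zp_nat.
case: k => j; first by rewrite -pmulrn nat_eq0 dvdzE.
by rewrite NegzE rmorphN oppr_eq0 dvdzE abszN /= -pmulrn nat_eq0.
Qed.

Lemma intr_Zp_eq (j k : int) : (j%:~R == k%:~R :> 'Z_m) = (m %| j - k)%Z.
Proof. by rewrite -subr_eq0 -rmorphB intr_Zp_eq0. Qed.

Lemma ered_eq n h : (ered n == ered h) = cong m h n.
Proof.
rewrite /cong -!intr_Zp_eq; apply/eqP/andP => [[-> ->] //|[/eqP e1 /eqP e2]].
by rewrite /ered e1 e2.
Qed.

Lemma unit_nat_Zp (j : nat) : ((j%:R : 'Z_m) \is a GRing.unit) = coprime m j.
Proof. by rewrite unitZpE. Qed.

Lemma ered_unit n : (ered n \is a GRing.unit) = coprime m (nrm n).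
Proof. by rewrite eis_unitE eis_norm_ered -nrmE -pmulrn unit_nat_Zp. Qed.

(** Nonunits are sent to the class 1 by default; [ecop] is always tested alongside. *)
Definition eclass n : {unit eis 'Z_m} := insubd (1%g : {unit eis 'Z_m}) (ered n).
Lemma val_eclass n : ered n \is a GRing.unit -> val (eclass n) = ered n.
Proof. by move=> un; rewrite val_insubd un. Qed.
Lemma eclassM n h : ered n \is a GRing.unit -> ered h \is a GRing.unit ->
  eclass (n * h) = (eclass n * eclass h)%g.
Proof.
move=> un uh; apply: val_inj; rewrite FinRing.val_unitM !val_eclass // ?eredM //.
by rewrite unitrMl.
Qed.
Lemma eclass1 : eclass 1 = 1%g.
Proof. by apply: val_inj; rewrite val_eclass ered1 ?unitr1. Qed.
Lemma exists_primary_rep (x : eis 'Z_m) : coprime m 3 ->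
  exists h, primary h /\ ered h = x.
Proof.
move=> cm3; case: x => a b.
have lift (c : 'Z_m) (s : nat) : exists k : nat, (k%:Z%:~R = c :> 'Z_m) /\ (k = s %[mod 3]).
  exists (chinese m 3 c s); split; last by rewrite chinese_modr.
  rewrite -pmulrn; apply: val_inj; rewrite /= val_Zp_nat // chinese_modl //.
  by rewrite modn_small //; have := ltn_ord c; rewrite [X in (_ < X)%N]Zp_cast.
have [k [k1 k2]] := lift a 1%N; have [j [j1 j2]] := lift b 0%N.
exists (Eis k%:Z j%:Z); split; last by rewrite /ered /= k1 j1.
by rewrite /primary /=; lia.
Qed.

(** Being primary and lying in a class modulo [m] is one congruence modulo [3 * m], to which
    [lattice_count] applies. *)
Lemma primary_cong h n : coprime m 3 -> primary h ->
  primary n && (ered n == ered h) = cong (3 * m) h n.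
Proof.
move=> cm3 /primaryP [s [t Eh]]; rewrite ered_eq /cong.
have key (k : int) : (3 * m %| k)%Z = (3 %| k)%Z && (m %| k)%Z.
  by rewrite !dvdzE absz_nat Gauss_dvd // coprime_sym.
have -> : primary n = (3 %| ere n - ere h)%Z && (3 %| eim n - eim h)%Z.
  rewrite /primary Eh /=; congr (_ && _); apply/dvdzP/dvdzP => -[u Hu].
  - by exists (u - s); lia.
  - by exists (u + s); lia.
  - by exists (u - t); lia.
  - by exists (u + t); lia.
by rewrite !key; case: (3 %| _)%Z; case: (3 %| _)%Z; case: (m %| _)%Z; rewrite ?andbF.
Qed.
End Reduction.

Section Dirichlet.
Variable R : realType.
Variable m : nat.
Hypothesis m_gt1 : (1 < m)%N.
Hypothesis m_cop3 : coprime m 3.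
Local Notation G := {unit eis 'Z_m}.
Local Notation C := (R[i]).
Local Notation nc := (@Normc.normc R).
Local Notation toC := (real_complex R).
Implicit Types (n d : eis int) (g : G).

Definition ecop n := ered m n \is a GRing.unit.
Definition class_count g x := count (fun n => [&& primary n, ecop n & eclass m n == g]) (ball x).

Lemma class_count_asymp : exists c K : R, 0 < c /\ forall g x, (0 < x)%N ->
  `|(class_count g x)%:R - c * x%:R| <= K * Num.sqrt x%:R.
Proof.
have D0 : (0 < 3 * m)%N by lia.
have [K HK] := @lattice_count R _ D0.
exists (wsup R / (3 * m)%:R ^+ 2), K; split.
  by rewrite divr_gt0 ?wsup_gt0 // exprn_gt0 // ltr0n.
move=> g x x0; have [h [ph hg]] := exists_primary_rep m_gt1 (val g) m_cop3.
have -> : class_count g x = count (cong (3 * m) h) (ball x).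
  apply: eq_count => n; rewrite -(primary_cong m_gt1 n m_cop3 ph); congr (_ && _).
  rewrite /ecop hg; apply/andP/eqP => [[un /eqP <-]|E]; first by rewrite val_eclass.
  have un : ered m n \is a GRing.unit by rewrite E; apply: (valP g).
  by split => //; apply/eqP/val_inj; rewrite val_eclass.
exact: HK.
Qed.

Section ClassSums.
Variables (V : comNzRingType) (c : G -> V).
Definition ext n : V := if ecop n then c (eclass m n) else 0.

Hypothesis cM : forall x y, c (x * y)%g = c x * c y.
Lemma extM (x y : eis int) : ext (x * y) = ext x * ext y.
Proof.
rewrite /ext /ecop eredM unitrM.
by have [ux|_] := boolP (_ \is a _); have [uy|_] := boolP (_ \is a _);
   rewrite /= ?mulr0 ?mul0r // eclassM.
Qed.

Lemma ext_sum x : psum (fun k => \sum_(n <- primaries k) ext n) x = \sum_g c g * (class_count g x)%:R.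
Proof.
rewrite /psum sum_primaries.
transitivity (\sum_(n <- ball x) \sum_(g | [&& primary n, ecop n & eclass m n == g]) c g).
  rewrite big_mkcond; apply: eq_bigr => n _; case: (primary n) => /=; last by rewrite big_pred0.
  rewrite /ext; case: (ecop n) => /=; last by rewrite big_pred0.
  by rewrite (big_pred1 (eclass m n)) // => g; rewrite /= eq_sym.
rewrite (exchange_big_dep xpredT) //=; apply: eq_bigr => g _.
by rewrite -big_filter big_const_seq count_predT size_filter iter_addr_0 mulr_natr.
Qed.

Variable l : nat -> V.
Hypothesis lM : forall a b, (0 < a)%N -> (0 < b)%N -> l (a * b)%N = l a + l b.

Lemma ext_moebius k : (0 < k)%N ->
  conv (fun i => \sum_(d <- primaries i) (mu d)%:~R * ext d)
       (fun i => \sum_(d <- primaries i) ext d) k = delta1 V k * ext 1.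
Proof.
move=> k0; rewrite -conv_primaries //; last exact: extM.
transitivity (\sum_(n <- primaries k) if n == 1 then ext 1 else 0).
  rewrite big_seq [RHS]big_seq; apply: eq_bigr => n; rewrite mem_primaries => /andP [pn _].
  by rewrite -rmorph_sum /= sum_mu //; case: eqP => [->|_]; rewrite ?mulr1 ?mulr0.
have [->|k1] := eqVneq k 1%N.
  have -> : primaries 1 = [:: 1] by vm_compute.
  by rewrite big_seq1 eqxx /delta1 mul1r.
rewrite /delta1 (negPf k1) mul0r big1_seq // => n /andP [_]; rewrite mem_primaries.
by move=> /andP [_ /eqP nk]; case: eqP => // n1; rewrite -nk n1 nrm1 eqxx in k1.
Qed.

Lemma ext_log k : (0 < k)%N ->
  \sum_(n <- primaries k) Lam l n * ext n =
  - conv (fun i => l i * \sum_(d <- primaries i) (mu d)%:~R * ext d)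
       (fun i => \sum_(d <- primaries i) ext d) k.
Proof.
move=> k0.
transitivity (- \sum_(n <- primaries k) ext n * \sum_(d <- divs n) (mu d)%:~R * l (nrm d)).
  by rewrite -sumrN; apply: eq_bigr => n _; rewrite /Lam mulrC mulrN.
rewrite (conv_primaries _ extM k0); congr (- _).
apply: eq_conv => // i i0; rewrite mulr_sumr big_seq [RHS]big_seq.
apply: eq_bigr => d; rewrite mem_primaries => /andP [_ /eqP ->]; ring.
Qed.

Lemma ext_conv k : ext 1 = 1 -> (0 < k)%N ->
  conv (fun i => \sum_(d <- primaries i) ext d) (fun i => \sum_(n <- primaries i) Lam l n * ext n) k =
  l k * \sum_(d <- primaries k) ext d.
Proof.
move=> e1; apply: (conv_log_derivative lM _ ext_log) => j j0.
by rewrite ext_moebius // e1 mulr1.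
Qed.
End ClassSums.
End Dirichlet.

Section PrimePowers.
Variable R : realType.

Lemma ball_size (x : nat) : (0 < x)%N -> (size (ball x))%:R <= 9 * wsup R * x%:R.
Proof.
move=> x0; have [r /andP [r1 r2]] := exists_isqrt x.
have r0 : (0 < r)%N by case: r r1 r2 => // _; lia.
apply: (@le_trans _ _ (w (r + 1))%:R).
  rewrite ler_nat; apply: uniq_leq_size; first exact: ball_uniq.
  by move=> n; rewrite !mem_ball => /leq_trans; apply; apply: ltnW.
(* The constant 9 comes from [(r + 2) ^ 2 <= 9 * r ^ 2] for [r >= 1]. *)
apply: le_trans (wsup_ub R _) _; rewrite [9 * _]mulrC -mulrA ler_wpM2l ?(ltW (wsup_gt0 R)) //.
by rewrite -natrX -natrM ler_nat; nia.
Qed.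

Lemma lg_le_rho j : (0 < j)%N -> lg R j <= 4 * rho R j.
Proof.
move=> j0; have := @lg_diff_le R 1 j; rewrite j0 => /(_ isT).
by rewrite lg1 subr0 (_ : rho R 1 = 1) ?divr1 // /rho !sqrtr1.
Qed.

Lemma geometric_tail (y : R) (N : nat) : 0 <= y <= 2^-1 ->
  \sum_(3 <= i < N) y ^+ i <= 2 * y ^+ 3.
Proof.
move=> /andP [y0 y1]; have y3 : 0 <= y ^+ 3 by rewrite exprn_ge0.
suff H : (3 <= N)%N -> \sum_(3 <= i < N) y ^+ i <= 2 * y ^+ 3 - 2 * y ^+ N.
  have [N3|N3] := leqP 3 N; last by rewrite big_geq ?mulr_ge0 // ltnW.
  by apply: le_trans (H N3) _; rewrite gerBl mulr_ge0 // exprn_ge0.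
move=> N3; rewrite -(subnKC N3); elim: (N - 3)%N => [|n IH].
  by rewrite addn0 big_geq // subrr.
rewrite addnS big_nat_recr ?leq_addr //=; have yn : 0 <= y ^+ (3 + n) by rewrite exprn_ge0.
have : y ^+ (3 + n).+1 <= 2^-1 * y ^+ (3 + n) by rewrite exprS ler_wpM2r.
move: IH; move: (\sum_(_ <= _ < _) _) (y ^+ (3 + n).+1) (y ^+ (3 + n)) => S u v; lra.
Qed.

(* The prime powers [x ^+ i] with [i >= 3]; squares are excluded by congruence conditions later on. *)
Lemma higher_prime_powers_bounded : exists K : R, forall x,
  \sum_(y <- ball x | primary y && (1 < nrm y)%N) \sum_(3 <= i < x.+1) lg R (nrm y) / (nrm y)%:R ^+ i <= K.
Proof.
have c0 := ltW (wsup_gt0 R).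
exists (72 * wsup R * 5) => x.
apply: (@le_trans _ _ (\sum_(y <- ball x | primary y) 2 * lg R (nrm y) / (nrm y)%:R ^+ 3)).
  rewrite big_mkcondr; apply: ler_sum => y py; have y0 := primary_nrm_gt0 py.
  have l0 := lg_ge0 R (nrm y).
  case: ifP => [y1|_]; last by rewrite divr_ge0 ?mulr_ge0 // exprn_ge0.
  rewrite -mulr_sumr [2 * _]mulrC -mulrA ler_wpM2l //.
  under eq_bigr do rewrite -exprVn.
  rewrite -[_ ^+ 3]/(_ ^+ 3) -exprVn; apply: geometric_tail.
  by rewrite invr_ge0 ler0n /= lef_pV2 ?posrE ?ltr0n // ler_nat.
rewrite -(sum_primaries (fun y => 2 * lg R (nrm y) / (nrm y)%:R ^+ 3)).
apply: (@le_trans _ _ (\sum_(1 <= j < x.+1) 72 * wsup R * (j%:R * rho R j)^-1)).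
  rewrite big_nat [leRHS]big_nat; apply: ler_sum => j /andP [j0 _].
  have j0' : 0 < j%:R :> R by rewrite ltr0n.
  have rj := rho_gt0 R j0.
  apply: (@le_trans _ _ ((size (ball j))%:R * (2 * lg R j / j%:R ^+ 3))).
    have h : 0 <= 2 * lg R j / j%:R ^+ 3 by rewrite divr_ge0 ?mulr_ge0 ?lg_ge0 // exprn_ge0.
    have -> : \sum_(d <- primaries j) 2 * lg R (nrm d) / (nrm d)%:R ^+ 3 =
        (size (primaries j))%:R * (2 * lg R j / j%:R ^+ 3).
      rewrite big_seq (eq_bigr (fun _ => 2 * lg R j / j%:R ^+ 3)) => [|d].
        by rewrite -big_seq big_const_seq count_predT iter_addr_0 [RHS]mulr_natl.
      by rewrite mem_primaries => /andP [_ /eqP ->].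
    by rewrite ler_wpM2r // ler_nat size_filter count_size.
  apply: (@le_trans _ _ ((9 * wsup R * j%:R) * (2 * (4 * rho R j) / j%:R ^+ 3))).
    apply: ler_pM => //; first by rewrite divr_ge0 ?mulr_ge0 ?lg_ge0 // exprn_ge0.
      exact: ball_size.
    by rewrite ler_wpM2r ?invr_ge0 ?exprn_ge0 // ler_wpM2l // lg_le_rho.
  have -> : 9 * wsup R * j%:R * (2 * (4 * rho R j) / j%:R ^+ 3) =
     72 * wsup R * (rho R j / j%:R ^+ 2) by field; rewrite gt_eqF.
  rewrite ler_wpM2l ?mulr_ge0 // ler_pdivrMr ?exprn_gt0 //.
  rewrite (_ : (j%:R * rho R j)^-1 * j%:R ^+ 2 = j%:R / rho R j); last first.
    by field; rewrite !gt_eqF.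
  rewrite ler_pdivlMr // -expr2 -[leRHS](rho4 R).
  by rewrite ler_weXn2l ?rho_ge1.
rewrite -mulr_sumr ler_wpM2l ?mulr_ge0 //.
have := @rho_sum R 1 x isT; rewrite (_ : rho R 1 = 1) ?divr1 //; by rewrite /rho !sqrtr1.
Qed.
End PrimePowers.

(** * Dirichlet's theorem for classes missed by squares *)

Section DirichletMain.
Variable R : realType.
Variable m : nat.
Hypothesis m_gt1 : (1 < m)%N.
Hypothesis m_cop3 : coprime m 3.
Local Notation G := {unit eis 'Z_m}.
Local Notation C := (R[i]).
Local Notation nc := (@Normc.normc R).
Local Notation toC := (real_complex R).
Local Notation chr := {ffun G -> 'Z_(chr_order G)}.
Implicit Types (n d : eis int) (g : G) (f : chr).

Variable z : C.
Hypothesis prim_z : (chr_order G).-primitive_root z.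

Let lgM' a b : (0 < a)%N -> (0 < b)%N -> lg R (a * b) = lg R a + lg R b := @lgM R a b.
Let lgCM a b : (0 < a)%N -> (0 < b)%N -> toC (lg R (a * b)) = toC (lg R a) + toC (lg R b).
Proof. by move=> a0 b0; rewrite lgM // rmorphD. Qed.

Local Notation L := (Lam (lg R)).

Lemma Lam_ge0 n : primary n -> 0 <= L n.
Proof. by move=> /(LamP lgM') [->|[x [k [_ _ ->]]]] //; apply: lg_ge0. Qed.

Lemma Lam_toC n : Lam (fun k => toC (lg R k)) n = toC (L n).
Proof.
rewrite /Lam rmorphN rmorph_sum /=; congr (- _); apply: eq_bigr => d _.
by rewrite rmorphM /= rmorph_int.
Qed.

Lemma nc_chi f g : is_chr f -> nc (chi z f g) = 1.
Proof.
move=> hf; apply/eqP; rewrite -(@pexpr_eq1 _ _ (chr_order G)) ?nc_ge0 //; last first.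
  exact: ltnW (chr_order_gt1 _).
have -> : nc (chi z f g) ^+ chr_order G = nc (chi z f g ^+ chr_order G).
  elim: (chr_order G) => [|k IH]; first by rewrite !expr0 Normc.normc1.
  by rewrite !exprS Normc.normcM IH.
by rewrite chiX // Normc.normc1.
Qed.

Let one1 : ext (fun _ : G => 1 : R) 1 = 1.
Proof. by rewrite /ext /ecop ered1 unitr1. Qed.
Let e0 n : R := ext (fun _ : G => 1 : R) n.
Let ef f n : C := ext (chi z f) n.
Let ef1 f : is_chr f -> ef f 1 = 1.
Proof. by move=> hf; rewrite /ef /ext /ecop ered1 unitr1 eclass1 chi1. Qed.
Let nc_ef f n : is_chr f -> nc (ef f n) = e0 n.
Proof. by move=> hf; rewrite /ef /e0 /ext; case: ifP => _; rewrite ?nc_chi ?Normc.normc0. Qed.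
Let e0_ge0 n : 0 <= e0 n.
Proof. by rewrite /e0 /ext; case: ifP. Qed.

Definition alpha k : R := \sum_(n <- primaries k) e0 n.
Definition beta k : R := \sum_(n <- primaries k) L n * e0 n.
Definition acoef f k : C := \sum_(n <- primaries k) ef f n.
Definition bcoef f k : C := \sum_(n <- primaries k) Lam (fun k => toC (lg R k)) n * ef f n.
Definition mcoef f k : C := \sum_(n <- primaries k) (mu n)%:~R * ef f n.

Lemma bcoef_beta f k : is_chr f -> nc (bcoef f k) <= beta k.
Proof.
move=> hf; apply: le_trans (nc_sum _ _ _) _; rewrite /beta big_seq [leRHS]big_seq.
apply: ler_sum => n; rewrite mem_primaries => /andP [pn _].
by rewrite Normc.normcM nc_ef // Lam_toC nc_real ger0_norm // Lam_ge0.
Qed.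
Lemma mcoef_alpha f k : is_chr f -> nc (mcoef f k) <= alpha k.
Proof.
move=> hf; apply: le_trans (nc_sum _ _ _) _; apply: ler_sum => n _.
rewrite Normc.normcM nc_ef // ler_piMl //.
have -> : (mu n)%:~R = toC (mu n)%:~R :> C by rewrite rmorph_int.
by rewrite nc_real -intr_norm -[1]/(1%:~R) ler_int mu_norm.
Qed.
Lemma alpha_ge0 k : 0 <= alpha k.
Proof. by apply: sumr_ge0 => n _. Qed.
Lemma beta_ge0 k : 0 <= beta k.
Proof.
rewrite /beta big_seq; apply: sumr_ge0 => n; rewrite mem_primaries => /andP [pn _].
by rewrite mulr_ge0 // Lam_ge0.
Qed.

Let chiM' f : is_chr f -> forall x y, chi z f (x * y)%g = chi z f x * chi z f y.
Proof. by move=> hf x y; apply: chiM. Qed.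

Lemma psum_alpha : exists c K : R, 0 < c /\ forall x, (0 < x)%N ->
  `|psum alpha x - c * x%:R| <= K * Num.sqrt x%:R.
Proof.
have [c [K [c0 H]]] := class_count_asymp R m_gt1 m_cop3.
exists (c * #|{: G}|%:R), (K * #|{: G}|%:R); split.
  by rewrite mulr_gt0 // ltr0n; apply/card_gt0P; exists 1%g.
move=> x x0; rewrite /alpha ext_sum.
have -> : \sum_(g : G) 1 * (class_count g x)%:R - c * #|{: G}|%:R * x%:R =
    \sum_(g : G) ((class_count g x)%:R - c * x%:R).
  rewrite sumrB sumr_const; congr (_ - _); first by apply: eq_bigr => g _; rewrite mul1r.
  by rewrite -[RHS]mulr_natr mulrAC.
apply: le_trans (ler_norm_sum _ _ _) _.
apply: (@le_trans _ _ (\sum_(g : G) K * Num.sqrt x%:R)); first by apply: ler_sum => g _; apply: H.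
by rewrite sumr_const -[leLHS]mulr_natr mulrAC.
Qed.

Lemma psum_acoef : exists K : R, forall f x, is_chr f -> f != 0 ->
  nc (psum (acoef f) x) <= K * Num.sqrt x%:R.
Proof.
have [c [K [c0 H]]] := class_count_asymp R m_gt1 m_cop3.
exists (K * #|{: G}|%:R) => f [|x] hf f0; first by rewrite psum0 Normc.normc0 sqrtr0 mulr0.
rewrite /acoef ext_sum.
have -> : \sum_(g : G) chi z f g * (class_count g x.+1)%:R =
    \sum_(g : G) chi z f g * toC ((class_count g x.+1)%:R - c * x.+1%:R).
  under [RHS]eq_bigr do rewrite rmorphB /= mulrBr rmorph_nat.
  by rewrite sumrB -[X in _ = _ - X]mulr_suml sum_chi_group // mul0r subr0.
apply: le_trans (nc_sum _ _ _) _.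
apply: (@le_trans _ _ (\sum_(g : G) K * Num.sqrt x.+1%:R)).
  by apply: ler_sum => g _; rewrite Normc.normcM nc_chi // mul1r nc_real H.
by rewrite sumr_const -[leLHS]mulr_natr mulrAC.
Qed.

Let one_mor : forall x y : G, (1 : R) = 1 * 1. Proof. by move=> *; rewrite mulr1. Qed.

Lemma principal_average : exists K0, forall X,
  [/\ psum (fun k => alpha k / k%:R) X <= K0 * (1 + lg R X.+1),
      psum (fun k => beta k / k%:R) X <= K0 * (1 + lg R X.+1) &
   `|psum (fun j => dlg R j * psum (fun k => beta k / k%:R) j) X - Q R X| <= K0 * (1 + lg R X.+1)].
Proof.
have [c [K [c0 H]]] := psum_alpha.
apply: (avg_principal alpha_ge0 beta_ge0 _ _ H c0).
  by rewrite /alpha (_ : primaries 1 = [:: 1]) ?big_seq1 ?one1 //; vm_compute.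
by move=> k k0; apply: ext_conv.
Qed.

Definition exc f := exceptional (acoef f).
Definition avg f X : C := psum (fun x => toC (dlg R x) * psum (fun k => bcoef f k / k%:R) x) X.
(** The residue of [- L' / L] at 1 as the averages see it: 1 for the pole of the principal function,
    -1 for a zero at 1, and 0 otherwise. *)
Definition dlt f : R := if f == 0 then 1 else if `[< exc f >] then -1 else 0.

Lemma average f : is_chr f -> exists K, forall X,
  nc (avg f X - toC (Q R X * dlt f)) <= K * (1 + lg R X.+1).
Proof.
move=> hf; have [K0 H0] := principal_average; rewrite /dlt.
have HS X : psum (fun k => alpha k / k%:R) X <= K0 * (1 + lg R X.+1) by case: (H0 X).
have HB X : psum (fun k => beta k / k%:R) X <= K0 * (1 + lg R X.+1) by case: (H0 X).
have [f0|f0] := eqVneq f 0.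
  exists K0 => X; case: (H0 X) => _ _; apply: le_trans.
  have -> : avg f X = toC (psum (fun j => dlg R j * psum (fun k => beta k / k%:R) j) X).
    rewrite /avg /psum rmorph_sum; apply: eq_bigr => x _; rewrite rmorphM /=; congr (_ * _).
    rewrite rmorph_sum; apply: eq_bigr => k _; rewrite rmorphM fmorphV rmorph_nat /=; congr (_ / _).
    rewrite /bcoef /beta rmorph_sum; apply: eq_bigr => n _; rewrite rmorphM /= Lam_toC; congr (_ * _).
    by rewrite /ef /e0 /ext f0; case: ifP => _; rewrite ?chi0 ?rmorph1 ?rmorph0.
  by rewrite mulr1 -rmorphB nc_real.
have hb k := bcoef_beta k hf; have hm k := mcoef_alpha k hf.
have [/asboolP ex|/asboolPn nex] := ifP.
  have [] := @avg_exceptional _ _ (bcoef f) _ _ _ hm HS _ _ ex.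
  - move=> k k0; have := ext_moebius (chiM' hf) k0; rewrite -/(ef f 1) ef1 // mulr1; apply.
  - move=> k k0; exact: (ext_log (chiM' hf)).
  by move=> K HK; exists K => X; rewrite mulrN1 rmorphN opprK; apply: HK.
have [K HK] := psum_acoef.
have [] := @avg_nonexceptional R (acoef f) _ _ K _ hb HB _ _ nex.
- move=> k k0; apply: (ext_conv (chiM' hf) lgCM) => //; exact: ef1.
- by move=> x; apply: HK.
by move=> K1 HK1; exists K1 => X; rewrite mulr0 rmorph0 subr0; apply: HK1.
Qed.

Lemma average_uniform : exists K, 0 <= K /\ forall f X, is_chr f ->
  nc (avg f X - toC (Q R X * dlt f)) <= K * (1 + lg R X.+1).
Proof.
have /choice [Kf HKf] : forall f, exists K, is_chr f -> forall X,
    nc (avg f X - toC (Q R X * dlt f)) <= K * (1 + lg R X.+1).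
  move=> f; have [/average [K HK]|nf] := boolP (is_chr f); first by exists K.
  by exists 0.
exists (\sum_f `|Kf f|); split; first by apply: sumr_ge0.
move=> f X hf; apply: le_trans (HKf f hf X) _; rewrite ler_wpM2r ?addr_ge0 ?lg_ge0 //.
by rewrite (bigD1 f) //=; apply: le_trans (ler_norm _) _; rewrite lerDl sumr_ge0.
Qed.

Definition class_weight g X : R := psum (fun x => dlg R x *
  psum (fun k => (\sum_(n <- primaries k | ecop m n && (eclass m n == g)) L n) / k%:R) x) X.

Lemma class_weight_ge0 g X : 0 <= class_weight g X.
Proof.
rewrite /class_weight /psum big_nat; apply: sumr_ge0 => x /andP [x0 _].
rewrite mulr_ge0 ?dlg_ge0 //; apply: sumr_ge0 => k _; rewrite divr_ge0 //.
rewrite big_seq_cond; apply: sumr_ge0 => n; rewrite mem_primaries => /andP [/andP [pn _] _].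
exact: Lam_ge0.
Qed.

Definition nchr : nat := #|[pred f : chr | is_chr f]|.

Let G_abelian : abelian [set: G].
Proof. by apply/centsP => x _ y _; apply: val_inj; rewrite !FinRing.val_unitM mulrC. Qed.

(** Orthogonality of characters isolates the class [g]; the inverse of [g] plays the part of complex
    conjugation. *)
Lemma sum_avg g X :
  \sum_(f | is_chr f) chi z f g^-1%g * avg f X = toC (nchr%:R * class_weight g X).
Proof.
rewrite /avg /class_weight /psum mulr_sumr rmorph_sum /=.
under eq_bigr do rewrite mulr_sumr; rewrite exchange_big /=; apply: eq_bigr => x _.
rewrite mulrCA rmorphM /=; under eq_bigr do rewrite mulrCA; rewrite -mulr_sumr; congr (_ * _).
rewrite mulr_sumr rmorph_sum /=; under eq_bigr do rewrite mulr_sumr.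
rewrite exchange_big /=; apply: eq_bigr => k _.
under eq_bigr do rewrite mulrA; rewrite -mulr_suml mulrA rmorphM /= fmorphV rmorph_nat; congr (_ / _).
rewrite /bcoef; under eq_bigr do rewrite mulr_sumr.
rewrite exchange_big /= mulr_sumr rmorph_sum /= [RHS]big_mkcond; apply: eq_bigr => n _.
rewrite /ef /ext; case: (ecop m n) => /=; last by rewrite big1 // => f _; rewrite !mulr0.
under eq_bigr do rewrite mulrCA; rewrite -mulr_sumr.
have E : \sum_(f | is_chr f) chi z f g^-1%g * chi z f (eclass m n) = if eclass m n == g then nchr%:R else 0.
  rewrite (eq_bigr (fun f => chi z f (g^-1 * eclass m n)%g)) => [|f hf]; last by rewrite chiM.
  case: eqP => [->|/eqP ng].
    rewrite mulVg (eq_bigr (fun _ => 1)) => [|f hf]; last by rewrite chi1.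
    by rewrite sumr_const.
  by apply: sum_chi_dual => //; rewrite -eq_mulVg1 eq_sym.
rewrite E Lam_toC; case: ifP => _; last by rewrite mulr0.
by rewrite rmorphM /= rmorph_nat mulrC.
Qed.

Lemma class_weight_asymp : exists K, forall g X,
  nc (toC (nchr%:R * class_weight g X) - toC (Q R X) * \sum_(f | is_chr f) chi z f g^-1%g * toC (dlt f))
   <= K * (1 + lg R X.+1).
Proof.
have [K [K0 HK]] := average_uniform.
exists (\sum_(f : chr | is_chr f) K) => g X.
rewrite -sum_avg mulr_sumr -sumrB mulr_suml; apply: le_trans (nc_sum _ _ _) _.
apply: ler_sum => f hf; rewrite mulrCA -mulrBr -rmorphM Normc.normcM nc_chi // mul1r.
exact: HK.
Qed.

Lemma Q_unbounded K : exists X, K * (1 + lg R X.+1) < Q R X.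
Proof.
have [x [x0 Hx]] := lg_unbounded (4 * `|K| + 3).
case: x x0 Hx => // X _ HL; exists X; have := Q_ge R X.
have hK := ler_norm K; have hK0 := normr_ge0 K.
move: (lg R X.+1) HL => l HL HQ.
have h1 : K * (1 + l) <= `|K| * (1 + l) by rewrite ler_wpM2r //; lra.
have h2 : (4 * `|K| + 3) * (l - 1) <= l * (l - 1) by rewrite ler_wpM2r //; lra.
nra.
Qed.

Definition excb f := [&& is_chr f, f != 0 & `[< exc f >]].

(** In the identity class all characters are 1, so two exceptional ones bring the coefficient of [Q]
    down to [1 - 1 - 1 = -1] or less. The weight of a class is nonnegative and [Q] outgrows the
    error. *)
Lemma exc_unique f f' : excb f -> excb f' -> f = f'.
Proof.
move=> exc1 exc2; apply: contrapT => ff'.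
have [K HK] := class_weight_asymp; have [X HX] := Q_unbounded K.
have := HK 1%g X; set D := \sum_(_ | _) _ => HD.
have [V [DV V1]] : exists V : R, D = toC V /\ V <= -1.
  have -> : D = toC (\sum_(h | is_chr h) dlt h).
    rewrite /D rmorph_sum /=; apply: eq_bigr => h hh.
    by rewrite invg1 chi1 // mul1r.
  exists (\sum_(h | is_chr h) dlt h); split => //.
  have neg h : h != 0 -> dlt h <= 0.
    by rewrite /dlt => /negPf ->; case: ifP => // _; rewrite lerN10.
  have m1 h : excb h -> dlt h = -1.
    by rewrite /dlt => /and3P [_ /negPf -> ->].
  rewrite (bigD1 (0 : chr)) ?is_chr0 //= (bigD1 f) /=; last by case/and3P: exc1 => -> ->.
  rewrite (bigD1 f') /=; last first.
    by case/and3P: exc2 => -> -> _ /=; apply/eqP => E; apply: ff'.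
  rewrite (m1 f) // (m1 f') // (_ : dlt 0 = 1); last by rewrite /dlt eqxx.
  have : \sum_(i | is_chr i && (i != 0) && (i != f) && (i != f')) dlt i <= 0.
    by apply: sumr_le0 => h /andP [/andP [/andP [_ h0] _] _]; apply: neg.
  lra.
move: HD; rewrite DV -rmorphM -rmorphB nc_real => HD.
have W0 : 0 <= nchr%:R * class_weight 1%g X by rewrite mulr_ge0 // class_weight_ge0.
have Q0 : 0 <= Q R X.
  by rewrite /Q /psum big_nat; apply: sumr_ge0 => j /andP [j0 _]; rewrite mulr_ge0 ?dlg_ge0 ?lg_ge0.
have h : Q R X * V <= - Q R X by rewrite -mulrN1 ler_wpM2l.
have := le_trans (ler_norm _) HD; lra.
Qed.

Lemma conj_chi f g : is_chr f -> conjc (chi z f g) = chi z (- f) g.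
Proof.
move=> hf; rewrite chiN //; have := sqr_normc (chi z f g).
have -> : `|chi z f g| = 1 by rewrite normc_def -/(Normc.normc _); have := nc_chi g hf;
  rewrite /Normc.normc; case: (chi z f g) => a b /= ->.
by rewrite expr1n => /esym H; apply: (mulfI (chi_neq0 prim_z f g)); rewrite H mulfV // chi_neq0.
Qed.

(** The partial sums for [- f] are the complex conjugates of those for [f]. *)
Lemma excbN f : excb f -> excb (- f).
Proof.
move=> /and3P [hf f0 /asboolP [K HK]]; apply/and3P; split; rewrite ?oppr_eq0 //.
  exact: is_chrN.
apply/asboolP; exists K => y y0.
have -> : psum (fun k => acoef (- f) k / k%:R) y = conjc (psum (fun k => acoef f k / k%:R) y).
  rewrite /psum rmorph_sum /=; apply: eq_bigr => k _; rewrite rmorphM /= fmorphV rmorph_nat; congr (_ / _).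
  rewrite /acoef rmorph_sum /=; apply: eq_bigr => n _; rewrite /ef /ext.
  by case: ifP => _; rewrite ?rmorph0 // conj_chi.
have -> (u : C) : nc (conjc u) = nc u by case: u => a b; rewrite /Normc.normc /= sqrrN.
exact: HK.
Qed.

Lemma exc_real f : excb f -> f + f = 0.
Proof. by move=> exc1; rewrite {2}(exc_unique exc1 (excbN exc1)) subrr. Qed.

Variable S : {pred G}.
Hypothesis S_nonempty : exists g, g \in S.
Hypothesis S_nosquare : forall g h, g \in S -> g <> (h * h)%g.
Hypothesis S_real : forall f, is_chr f -> f != 0 -> f + f = 0 -> exists2 g, g \in S & f g != 0.

(** If an exceptional [f1] exists, it is real, and [S_real] gives a class where it takes the value
    -1; the coefficient of [Q] is then [1 + (-1) * (-1) = 2]. Otherwise it is 1 in every class. *)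
Lemma class_weight_lower : exists g K, g \in S /\
  forall X, Q R X <= nchr%:R * class_weight g X + K * (1 + lg R X.+1).
Proof.
have [K HK] := class_weight_asymp.
suff [g [V [gS DV V1]]] : exists g, exists V : R, [/\ g \in S,
    \sum_(f | is_chr f) chi z f g^-1%g * toC (dlt f) = toC V & 1 <= V].
  exists g, K; split=> // X; have := HK g X; rewrite DV -rmorphM -rmorphB nc_real => HD.
  have Q0 : 0 <= Q R X.
    by rewrite /Q /psum big_nat; apply: sumr_ge0 => j /andP [j0 _]; rewrite mulr_ge0 ?dlg_ge0 ?lg_ge0.
  have h : Q R X <= Q R X * V by rewrite ler_peMr.
  by have := ler_norml (nchr%:R * class_weight g X - Q R X * V) (K * (1 + lg R X.+1));
     rewrite HD => /esym/andP [h1 h2]; lra.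
have [[f1 exc1]|noexc] := EM (exists f, excb f).
  have /and3P [hf1 f10 ex1] := exc1.
  have [g gS fg] := S_real hf1 f10 (exc_real exc1).
  exists g, 2; split => //; last by rewrite ler1n.
  rewrite (bigD1 (0 : chr)) ?is_chr0 //= (bigD1 f1) /= ?hf1 // big1 => [|h /andP [/andP [hh h0] hf]]; last first.
    rewrite /dlt (negPf h0); case: asboolP => [ex|_]; last by rewrite rmorph0 mulr0.
    by case/eqP: hf; apply: exc_unique => //; rewrite /excb hh h0; apply/asboolP.
  rewrite chi0 /dlt eqxx (negPf f10) ex1 addr0 rmorph1 mulr1 rmorphN rmorph1 mulrN1.
  have -> : chi z f1 g^-1%g = -1.
    have : chi z f1 g^-1%g ^+ 2 == 1.
      by rewrite expr2 -chiD // (exc_real exc1) chi0.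
    rewrite sqrf_eq1 => /orP [|/eqP //]; rewrite chi_eq1 // => /eqP h.
    have := chr1 hf1; rewrite -(mulgV g); move/is_chrP: hf1 => ->; rewrite h addr0 => /eqP.
    by rewrite (negPf fg).
  by rewrite opprK -[LHS]/(2%:R : C) rmorph_nat.
have [g gS] := S_nonempty; exists g, 1; split => //.
rewrite (bigD1 (0 : chr)) ?is_chr0 //= big1 => [|h /andP [hh h0]]; last first.
  rewrite /dlt (negPf h0); case: asboolP => [ex|_]; last by rewrite rmorph0 mulr0.
  by case: noexc; exists h; rewrite /excb hh h0; apply/asboolP.
by rewrite chi0 /dlt eqxx addr0 rmorph1 mulr1.
Qed.

(** The primes of the class contribute the bounded sum [psum h N0], squares are excluded by
    [S_nosquare], and higher powers are bounded over all classes. The average of a bounded sum is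
    only [O(lg X)]. *)
Lemma class_weight_upper g N0 : g \in S ->
  (forall x, eprime x -> ecop m x -> eclass m x = g -> (nrm x <= N0)%N) ->
  exists K, forall X, class_weight g X <= K * (1 + lg R X.+1).
Proof.
move=> gS HN; have [K HK] := higher_prime_powers_bounded R.
pose h k : R := if (k <= N0)%N then \sum_(n <- primaries k) lg R k / k%:R else 0.
pose t (y : eis int) i : R := lg R (nrm y) / (nrm y)%:R ^+ i.
have t0 y i : 0 <= t y i by rewrite divr_ge0 ?lg_ge0 // exprn_ge0.
have h0 k : 0 <= h k.
  by rewrite /h; case: ifP => // _; apply: sumr_ge0 => n _; rewrite divr_ge0 ?lg_ge0.
pose big x n := \sum_(y <- ball x | primary y && (1 < nrm y)%N) \sum_(3 <= i < x.+1 | n == y ^+ i) t y i.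
have big0 x n : 0 <= big x n by apply: sumr_ge0 => y _; apply: sumr_ge0.
have K0 : 0 <= K.
  by apply: le_trans (HK 0%N); apply: sumr_ge0 => y _; apply: sumr_ge0 => i _; apply: t0.
have term x n k : (k <= x)%N -> n \in primaries k -> ecop m n -> eclass m n = g ->
    L n / k%:R <= (if (k <= N0)%N then lg R k / k%:R else 0) + big x n.
  rewrite mem_primaries => kx /andP [pn /eqP nk] cn ng.
  have b0 : 0 <= (if (k <= N0)%N then lg R k / k%:R else 0).
    by case: ifP => // _; rewrite divr_ge0 ?lg_ge0.
  have [->|[y [j [py En Ln]]]] := LamP lgM' pn; first by rewrite mul0r addr_ge0.
  case: j En => [|[|j]] En.
  - rewrite expr1 in En; rewrite -En in py Ln; rewrite Ln nk -nk HN // nk lerDl.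
    exact: big0.
  - case: (@S_nosquare g (eclass m y) gS); rewrite -ng En expr2 eclassM //.
      by move: cn; rewrite /ecop En expr2 eredM unitrM => /andP [].
    by move: cn; rewrite /ecop En expr2 eredM unitrM => /andP [].
  have ppy : primary y by case: py.
  have ny := eprime_nrm_gt1 py.
  have nyk : (nrm y ^ j.+3)%N = k by rewrite -nk En nrmX.
  have jx : (j.+3 < x.+1)%N by rewrite ltnS; apply: leq_trans kx; rewrite -nyk; apply: ltnW; apply: ltn_expl.
  have yx : y \in ball x.
    by rewrite mem_ball; apply: leq_trans kx; rewrite -nyk; rewrite -[leqLHS]expn1; apply: leq_pexp2l => //; exact: ltnW.
  have le : L n / k%:R <= big x n.
    rewrite /big big_mkcond (bigD1_seq y) ?ball_uniq //= ppy ny /=.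
    rewrite big_mkcond (bigD1_seq j.+3) ?iota_uniq ?mem_index_iota //= En eqxx.
    have -> : t y j.+3 = L (y ^+ j.+3) / k%:R by rewrite /t -natrX nyk -En Ln.
    rewrite -addrA lerDl addr_ge0 //.
      by apply: sumr_ge0 => i _; case: ifP.
    by apply: sumr_ge0 => i _; case: ifP => // _; apply: sumr_ge0.
  by apply: le_trans le _; rewrite lerDr.
have bound x : psum (fun k => (\sum_(n <- primaries k | ecop m n && (eclass m n == g)) L n) / k%:R) x
    <= psum h N0 + K.
  apply: (@le_trans _ _ (psum (fun k => h k + \sum_(n <- primaries k) big x n) x)).
    rewrite /psum big_nat [leRHS]big_nat; apply: ler_sum => k /andP [k0 kx].
    rewrite mulr_suml big_seq_cond.
    apply: (@le_trans _ _ (\sum_(n <- primaries k) ((if (k <= N0)%N then lg R k / k%:R else 0) + big x n))).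
      rewrite [leRHS]big_seq_cond [leRHS]big_mkcond [leLHS]big_mkcond /=; apply: ler_sum => n _.
      have b0 : 0 <= (if (k <= N0)%N then lg R k / k%:R else 0).
        by case: ifP => // _; rewrite divr_ge0 ?lg_ge0.
      case: (boolP (n \in primaries k)) => //= nk; case: ifP => [/andP [cn /eqP ng]|_].
        by apply: term.
      by rewrite addr_ge0.
    rewrite big_split /= lerD2r /h; case: ifP => // _.
    by rewrite big1.
  rewrite psumD; apply: lerD.
    have [xN|Nx] := leqP x N0; first exact: psum_le.
    rewrite (psum_split h (ltnW Nx)) big1_seq ?addr0 // => k /andP [_].
    by rewrite mem_index_iota /h => /andP [Nk _]; rewrite leqNgt Nk.
  apply: le_trans (HK x); rewrite /psum sum_primaries /big.
  rewrite (exchange_big_dep (fun y => primary y && (1 < nrm y)%N)) //=; apply: ler_sum => y _.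
  rewrite (exchange_big_dep xpredT) //=; apply: ler_sum => i _.
  rewrite -big_filter big_const_seq count_predT iter_addr_0 -[X in _ <= X]mulr1n.
  apply: ler_wpMn2l; first exact: t0.
  rewrite size_filter; apply: leq_trans (_ : count (pred1 (y ^+ i)) (ball x) <= _)%N.
    by apply: sub_count => n /andP [].
  by rewrite count_uniq_mem ?ball_uniq // leq_b1.
exists (psum h N0 + K) => X.
have M0 : 0 <= psum h N0 + K by rewrite addr_ge0 // sumr_ge0.
apply: (@le_trans _ _ ((psum h N0 + K) * lg R X.+1)); last by rewrite ler_wpM2l // lerDr.
rewrite -psum_dlg -psumMl /class_weight {1 3}/psum big_nat [leRHS]big_nat.
apply: ler_sum => x /andP [x0 _]; rewrite mulrC ler_wpM2r ?dlg_ge0 //; exact: bound.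
Qed.

Lemma dirichlet_class N0 : exists x, [/\ eprime x, ecop m x, eclass m x \in S & (N0 < nrm x)%N].
Proof.
apply: contrapT => H.
have [g [K [gS HK]]] := class_weight_lower.
have [x ex cx xg|K1 HK1] := @class_weight_upper g N0 gS.
  by rewrite leqNgt; apply/negP => h; apply: H; exists x; rewrite xg.
have [X HX] := Q_unbounded (nchr%:R * K1 + K).
have := HK X; have := ler_wpM2l (ler0n R nchr) (HK1 X).
lra.
Qed.
End DirichletMain.

Theorem dirichlet_eis (R : realType) (m : nat) (S : {pred {unit eis 'Z_m}}) :
  (1 < m)%N -> coprime m 3 ->
  (exists g, g \in S) ->
  (forall g h, g \in S -> g <> (h * h)%g) ->
  (forall f : {unit eis 'Z_m} -> bool, (forall x y, f (x * y)%g = f x (+) f y) ->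
     (exists g, f g) -> exists2 g, g \in S & f g) ->
  forall N, exists x, [/\ eprime x, ered m x \is a GRing.unit, eclass m x \in S & (N < nrm x)%N].
Proof.
move=> m1 m3 S0 Ssq Sreal N.
have [z pz] : exists z : R[i], (chr_order {unit eis 'Z_m}).-primitive_root z.
  apply: closed_prim_root; first exact: ltnW (chr_order_gt1 _).
  by rewrite pnatr_eq0 -lt0n ltnW // chr_order_gt1.
apply: (dirichlet_class m1 m3 pz S0 Ssq) => f hf f0 ff0.
(* The only element of order 2 in the cyclic group of order [2 * #|G|] is [#|G|], so [f] has a
   single nonzero value. This is what lets it be read as a boolean character. *)
have two a b : f a != 0 -> f b != 0 -> f a + f b = 0.
  have dbl x : f x + f x = 0 by have /ffunP/(_ x) := ff0; rewrite !ffunE.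
  move=> fa fb; suff E c : f c != 0 -> (f c : nat) = #|{: {unit eis 'Z_m}}| :> nat.
    have -> : f b = f a by apply: val_inj; rewrite /= !E.
    exact: dbl.
  move=> fc; have := congr1 val (dbl c); rewrite /= => /eqP.
  have lt : (f c < 2 * #|{: {unit eis 'Z_m}}|)%N by have := ltn_ord (f c); rewrite [X in (_ < X)%N]Zp_cast ?chr_order_gt1.
  rewrite [X in (_ %% X)%N]Zp_cast ?chr_order_gt1 // /chr_order => /dvdnP [k Hk].
  have fc0 : f c != 0%N :> nat by apply: contra fc => /eqP h; apply/eqP/val_inj.
  have key (u v j : nat) : (u < 2 * v)%N -> (u + u = j * (2 * v))%N -> u != 0%N -> u = v.
    by case: j => [|[|j]]; [lia|lia|rewrite !mulSn; lia].
  exact: key lt Hk fc0.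
have [||g gS fg] := Sreal (fun x => f x != 0).
- move=> x y; move/is_chrP: hf => ->.
  case: (eqVneq (f x) 0) => [->|fx]; first by rewrite add0r.
  case: (eqVneq (f y) 0) => [->|fy]; first by rewrite addr0 fx.
  by rewrite two // eqxx.
- apply/existsP; apply: contraNT f0 => /existsPn H; apply/eqP/ffunP => y.
  by rewrite ffunE; apply/eqP; have := H y; rewrite negbK.
by exists g.
Qed.

(** * Sextic Jacobi sums and cyclotomic numbers *)

Section SexticCharacter.
Local Notation E := (eis int).
Variables (F : finFieldType) (g : F).
Local Notation N := #|F|.-1.
Hypothesis g_prim : N.-primitive_root g.
Variable f : nat.
Hypothesis N_eq : N = (6 * (2 * f + 1))%N.

Definition zeta : E := 1 + omega _.
Lemma zeta3 : zeta ^+ 3 = -1. Proof. by []. Qed.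
Lemma zeta6 : zeta ^+ 6 = 1. Proof. by []. Qed.
Lemma zeta_mod k : zeta ^+ (k %% 6) = zeta ^+ k.
Proof. by rewrite {2}(divn_eq k 6) exprD mulnC exprM zeta6 expr1n mul1r. Qed.

Lemma zeta_eq1 k : (zeta ^+ k == 1) = (6 %| k)%N.
Proof.
rewrite -zeta_mod /dvdn; have := ltn_pmod k (isT : (0 < 6)%N).
by move: (k %% 6)%N; do 6?[case=> //].
Qed.

Lemma F_unity (x : F) : x != 0 -> x ^+ N = 1.
Proof.
move=> x0; have := expf_card x; rewrite -(ltn_predK (finNzRing_gt1 F)) exprS.
by move=> /(congr1 (fun y => y / x)); rewrite mulrAC divff // mul1r.
Qed.

Definition ind (x : F) : nat :=
  if boolP (x != 0) is AltTrue x0 then sval (prim_rootP g_prim (F_unity x0)) else 0%N.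

Lemma indP x : x != 0 -> x = g ^+ ind x.
Proof.
by move=> x0; rewrite /ind; case: {-}_ / boolP => [x0'|]; [case: (prim_rootP _ _)|rewrite x0].
Qed.

Lemma g_neq0 : g != 0.
Proof.
apply/eqP => g0; have := prim_expr_order g_prim; rewrite g0 expr0n.
by rewrite N_eq muln_eq0 addn1 /= => /esym/eqP; rewrite oner_eq0.
Qed.

Lemma ind_expr k : zeta ^+ ind (g ^+ k) = zeta ^+ k.
Proof.
have gk : g ^+ k != 0 by rewrite expf_neq0 // g_neq0.
have /eqP := indP gk; rewrite (eq_prim_root_expr g_prim) => /eqP H.
rewrite -[LHS]zeta_mod -[RHS]zeta_mod.
have d6 : (6 %| N)%N by rewrite N_eq dvdn_mulr.
by rewrite -(modn_dvdm _ d6) -H modn_dvdm.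
Qed.

(** The [m]-th power of a character of order 6. All powers vanish at 0, including the trivial one,
    which keeps [psiD] valid everywhere. *)
Definition psi (m : nat) (x : F) : E := if x == 0 then 0 else zeta ^+ (m * ind x).

Lemma psi_expr m k : psi m (g ^+ k) = zeta ^+ (m * k).
Proof. by rewrite /psi expf_eq0 (negPf g_neq0) andbF mulnC exprM ind_expr -exprM mulnC. Qed.
Lemma psi0 m : psi m 0 = 0. Proof. by rewrite /psi eqxx. Qed.
Lemma psi_1 m : psi m 1 = 1. Proof. by rewrite -(expr0 g) psi_expr muln0. Qed.
Lemma psiM m x y : psi m (x * y) = psi m x * psi m y.
Proof.
have [->|x0] := eqVneq x 0; first by rewrite mul0r !psi0 mul0r.
have [->|y0] := eqVneq y 0; first by rewrite mulr0 !psi0 mulr0.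
by rewrite (indP x0) (indP y0) -exprD !psi_expr mulnDr exprD.
Qed.
Lemma psi_neq0 m x : x != 0 -> psi m x != 0.
Proof.
move=> x0; rewrite (indP x0) psi_expr; apply/eqP => H.
have := zeta6; rewrite -(expr1n _ (m * ind x)) -zeta6 -!exprM mulnC exprM H expr0n.
by [].
Qed.
Lemma psiD m k x : psi (m + k) x = psi m x * psi k x.
Proof. by rewrite /psi; case: eqP; rewrite ?mulr0 // mulnDl exprD. Qed.
Lemma psi_eq m k x : (m = k %[mod 6])%N -> psi m x = psi k x.
Proof.
move=> H; rewrite /psi; case: eqP => // _; rewrite -[LHS]zeta_mod -[RHS]zeta_mod.
by rewrite -modnMml H modnMml.
Qed.

Lemma psiV m x : psi m x^-1 = psi (5 * m) x.
Proof.
have [->|x0] := eqVneq x 0; first by rewrite invr0 !psi0.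
apply: (mulIf (psi_neq0 m x0)); rewrite -psiM mulVf // psi_1 -psiD.
by rewrite (@psi_eq _ 0) ?psi_0 /psi ?(negPf x0) ?mul0n //; lia.
Qed.

Lemma g_half : g ^+ (N %/ 2) = -1.
Proof.
have h : (N = N %/ 2 * 2)%N by rewrite N_eq; lia.
have : (g ^+ (N %/ 2)) ^+ 2 == 1 by rewrite -exprM -h (prim_expr_order g_prim).
rewrite sqrf_eq1 => /orP [|/eqP //]; rewrite -(prim_order_dvd g_prim) => /dvdnP [k Hk].
have : (0 < N)%N by rewrite N_eq; lia.
nia.
Qed.

Lemma psiN1 m : psi m (-1) = (-1) ^+ m.
Proof.
rewrite -g_half psi_expr N_eq (_ : (6 * (2 * f + 1) %/ 2 = 3 * (2 * f + 1))%N); last by lia.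
rewrite mulnCA exprM zeta3 mulnC exprM; congr (_ ^+ _).
by rewrite exprD exprM sqrrN !expr1n mul1r.
Qed.

Lemma psiN m x : psi m (- x) = (-1) ^+ m * psi m x.
Proof. by rewrite -[- x]mulN1r psiM psiN1. Qed.

Lemma sum_psi m : ~~ (6 %| m)%N -> \sum_x psi m x = 0.
Proof.
move=> m6; have g0 := g_neq0.
have : psi m g * \sum_x psi m x = \sum_x psi m x.
  rewrite mulr_sumr [RHS](reindex_inj (mulfI g0)) /=.
  by apply: eq_bigr => x _; rewrite psiM.
move/eqP; rewrite -subr_eq0 -{2}[\sum_x _]mul1r -mulrBl mulf_eq0 subr_eq0.
by rewrite -[g]expr1 psi_expr muln1 zeta_eq1 (negPf m6) => /eqP.
Qed.

Lemma sum_psi0 : \sum_x psi 0 x = N%:R.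
Proof.
rewrite (bigD1 0) //= psi0 add0r (eq_bigr (fun _ => 1)) => [|x /negPf x0]; last by rewrite /psi x0.
by rewrite sumr_const cardC1.
Qed.

(** A Jacobi sum over [x + y + 1 = 0]. It differs by the sign [(-1) ^ (m + k)] from the usual sum
    over [x + y = 1], and this form treats the three characters of exponents [m], [k], [- (m + k)]
    alike. *)
Definition T m k : E := \sum_x psi m x * psi k (-1 - x).

Lemma TC m k : T m k = T k m.
Proof.
have inj : injective (fun x : F => -1 - x) by move=> x y /addrI /oppr_inj.
rewrite /T (reindex_inj inj); apply: eq_bigr => x _ /=.
by rewrite opprB addrCA subrr addr0 mulrC.
Qed.

Lemma T_eq m k m' k' : (m = m' %[mod 6])%N -> (k = k' %[mod 6])%N -> T m k = T m' k'.
Proof. by move=> H H'; apply: eq_bigr => x _; rewrite (psi_eq _ H) (psi_eq _ H'). Qed.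

(* The substitution [x |-> x / (-1 - x)] permutes the three terms of [x + y + 1 = 0]. *)
Lemma T_triple m k j : (6 %| m + k + j)%N -> T m k = T m j.
Proof.
move=> H6; pose D := [pred x : F | (x != 0) && (x != -1)].
have domain a b : T a b = \sum_(x | D x) psi a x * psi b (-1 - x).
  rewrite /T [RHS]big_mkcond; apply: eq_bigr => x _ /=.
  have [->|x0] := eqVneq x 0; first by rewrite psi0 mul0r.
  by have [->|x1] := eqVneq x (-1); first rewrite subrr psi0 mulr0.
pose h (x : F) := x / (-1 - x).
have y0 x : D x -> -1 - x != 0 by case/andP => _; apply: contra; rewrite subr_eq0 eq_sym.
have hD x : D x -> D (h x).
  move=> Dx; have /andP [x0 x1] := Dx; have yx := y0 x Dx.
  rewrite /h /= mulf_neq0 ?invr_eq0 //=; apply/eqP => H.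
  have : x = - (-1 - x) by have := congr1 (fun u => u * (-1 - x)) H; rewrite divfK // mulN1r.
  by rewrite opprB opprK -[LHS]addr0 => /addrI /eqP; rewrite eq_sym oner_eq0.
have hK x : D x -> h (h x) = x.
  move=> Dx; have yx := y0 x Dx; have hx := y0 _ (hD x Dx).
  rewrite /h; have -> : -1 - x / (-1 - x) = (-1 - x)^-1.
    by field.
  by rewrite invrK divfK.
rewrite !domain (reindex_onto h h) /=; last exact: hK.
apply: eq_big => [x|x].
  apply/andP/idP => [[Dhx /eqP <-]|Dx]; first exact: hD.
  by split; [exact: hD|rewrite hK].
move=> /andP [Dhx /eqP hhx]; have Dx : D x by rewrite -hhx hD.
have yx := y0 x Dx; rewrite /h.
have -> : -1 - x / (-1 - x) = (-1 - x)^-1 by field.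
rewrite psiM !psiV -mulrA -psiD; congr (_ * _); apply: psi_eq; lia.
Qed.

Lemma T00 : T 0 0 = N%:R - 1.
Proof.
rewrite /T (bigD1 (-1)) //= subrr psi0 mulr0 add0r.
have -> : N%:R - 1 = \sum_x psi 0 x - psi 0 (-1) by rewrite sum_psi0 psiN1.
rewrite [in RHS](bigD1 (-1)) //= [RHS]addrC addKr; apply: eq_bigr => x x1.
by rewrite [X in _ * X = _]/psi subr_eq0 eq_sym (negPf x1) mulr1.
Qed.

Lemma T0 k : ~~ (6 %| k)%N -> T 0 k = - (-1) ^+ k.
Proof.
move=> k6; have inj : injective (fun x : F => -1 - x) by move=> x y /addrI /oppr_inj.
have E : \sum_x psi k (-1 - x) = 0 by have := sum_psi k6; rewrite (reindex_inj inj).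
have -> : - (-1) ^+ k = \sum_x psi k (-1 - x) - psi k (-1 - 0) by rewrite E subr0 psiN1 sub0r.
rewrite /T (bigD1 0) //= psi0 mul0r add0r [in RHS](bigD1 0) //= [RHS]addrC addKr.
by apply: eq_bigr => x /negPf x0; rewrite [psi 0 x]/psi x0 mul1r.
Qed.

Lemma F_two_neq0 : 2 != 0 :> F.
Proof.
apply/eqP => h2; have : (-1 : F) = 1 by apply/eqP; rewrite -subr_eq0 -opprD oppr_eq0 -h2.
by move/(congr1 (psi 1)); rewrite psiN1 psi_1.
Qed.

Lemma psi3_cases c : c != 0 -> psi 3 c = 1 \/ psi 3 c = -1.
Proof.
move=> c0; rewrite /psi (negPf c0) exprM zeta3 -signr_odd.
by case: (odd _); [right|left].
Qed.

Lemma card_sqrt c : \sum_(y : F | y ^+ 2 == c) (1 : E) = 1 + psi 3 c.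
Proof.
have [->|c0] := eqVneq c 0.
  by rewrite psi0 addr0 (big_pred1 0) // => y; rewrite sqrf_eq0.
have [k Ek] : exists k, c = g ^+ k by exists (ind c); apply: indP.
have [/existsP [y /eqP Ey]|/existsPn no] := boolP [exists y : F, y ^+ 2 == c].
  have y0 : y != 0 by apply: contraNneq c0 => y0; rewrite -Ey y0 expr0n.
  have -> : psi 3 c = 1 by rewrite -Ey expr2 psiM -psiD (@psi_eq _ 0) // /psi (negPf y0).
  rewrite (bigD1 y) ?Ey ?eqxx //= (big_pred1 (- y)) // => v /=.
  rewrite -Ey eqf_sqr; case: (eqVneq v y) => [->|] /=; last by rewrite andbT.
  by rewrite -addr_eq0 -mulr2n -[y *+ 2]mulr_natl mulf_eq0 (negPf F_two_neq0) (negPf y0).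
rewrite big_pred0 => [|y]; last by apply/negbTE/no.
have ok : odd k.
  apply: contraT => ek; have := no (g ^+ (k %/ 2)); rewrite -exprM Ek.
  by rewrite (_ : (k %/ 2 * 2 = k)%N) ?eqxx // -[RHS](divnK (_ : 2 %| k)%N) // dvdn2.
by rewrite Ek psi_expr exprM zeta3 -signr_odd ok addrN.
Qed.

Lemma sum_sqr (h : F -> E) : \sum_(y : F) h (y ^+ 2) = \sum_c h c * (1 + psi 3 c).
Proof.
rewrite (partition_big (fun y : F => y ^+ 2) xpredT) //=; apply: eq_bigr => c _.
rewrite -card_sqrt mulr_sumr; apply: eq_bigr => y /eqP ->; by rewrite mulr1.
Qed.

(** Completing the square: [x = (y - 1) / 2] turns [x * (-1 - x)] into [(1 - y ^ 2) / 4]. *)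
Lemma T_diag n : T n n = psi n 4^-1 * \sum_c psi n (1 - c) * (1 + psi 3 c).
Proof.
have h2 := F_two_neq0; have h4 : 4 != 0 :> F.
  by rewrite (_ : 4 = 2 * 2) ?mulf_neq0 // -natrM.
have inj : injective (fun y : F => (y - 1) / 2).
  by move=> x y /(mulIf (invr_neq0 h2)) /addIr.
rewrite -(sum_sqr (fun c => psi n (1 - c))) mulr_sumr /T (reindex_inj inj) /=.
apply: eq_bigr => y _; rewrite -!psiM; congr (psi _ _).
have -> : 4 = 2 * 2 :> F by rewrite -natrM.
field; by rewrite ?h4 ?h2.
Qed.

(** The duplication formula for Jacobi sums, [psi 3] being the quadratic character. *)
Lemma T_dup n : ~~ (6 %| n)%N -> T n n = psi n 4^-1 * (- (-1) ^+ n * T 3 n).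
Proof.
move=> n6; rewrite T_diag; congr (_ * _).
under eq_bigr do rewrite mulrDr mulr1; rewrite big_split /=.
have inj : injective (fun x : F => 1 - x) by move=> x y /addrI /oppr_inj.
have -> : \sum_c psi n (1 - c) = 0 by have := sum_psi n6; rewrite (reindex_inj inj).
rewrite add0r (reindex_inj oppr_inj) /= mulr_sumr; apply: eq_bigr => x _.
have -> : 1 - - x = - (-1 - x) by ring.
rewrite !psiN; ring.
Qed.

(** For [c != 0] the factor [1 + psi 3 c] is 0 or 2, so only [c = 0] survives modulo 2. *)
Lemma psi2_mod2 : exists t : E, T 2 2 = psi 2 4^-1 + 2 * t.
Proof.
rewrite T_diag (bigD1 0) //= subr0 psi_1 mul1r psi0 addr0.
have [t Ht] : exists t : E, \sum_(c | c != 0) psi 2 (1 - c) * (1 + psi 3 c) = 2 * t.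
  exists (\sum_(c | c != 0) psi 2 (1 - c) * (if psi 3 c == 1 then 1 else 0)).
  rewrite mulr_sumr; apply: eq_bigr => c c0; rewrite mulrCA; congr (_ * _).
  by case: (psi3_cases c0) => ->.
by exists (psi 2 4^-1 * t); rewrite Ht; ring.
Qed.

(** Away from 0 the cubic character is 1 modulo [1 - omega], so each product of two differences is
    divisible by [(1 - omega) ^ 2], an associate of 3. Expanding leaves [T 2 2] and known sums. *)
Lemma T22_mod3 : exists t : E, T 2 2 = -1 + 3 * t.
Proof.
have [u Hu] : exists u : E, \sum_x (psi 2 x - psi 0 x) * (psi 2 (-1 - x) - psi 0 (-1 - x)) = 3 * u.
  have three (x y : F) : exists v : E, (psi 2 x - psi 0 x) * (psi 2 y - psi 0 y) = 3 * v.
    have c w : psi 2 w - psi 0 w = 0 \/ psi 2 w - psi 0 w = omega _ - 1 \/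
       psi 2 w - psi 0 w = omega _ ^+ 2 - 1.
      rewrite /psi; case: eqP => _; first by left.
      rewrite mul0n expr0 exprM -(_ : omega _ = zeta ^+ 2) // (divn_eq (ind w) 3) exprD mulnC exprM.
      rewrite omega3 expr1n mul1r; have := ltn_pmod (ind w) (isT : 0 < 3)%N.
      by move: (_ %% 3)%N => [|[|[|]]] // _; rewrite ?subrr; auto.
    by case: (c x) => [->|[->|->]]; case: (c y) => [->|[->|->]];
      [exists 0|exists 0|exists 0|exists 0|exists (- omega _)|exists 1|exists 0|exists 1|
       exists (1 + omega _)]; vm_compute.
  elim/big_ind: _ => [|a b [u ->] [v ->]|x _]; first by exists 0; rewrite mulr0.
    by exists (u + v); rewrite mulrDr.
  exact: three.
have E1 : \sum_x (psi 2 x - psi 0 x) * (psi 2 (-1 - x) - psi 0 (-1 - x)) = T 2 2 - T 2 0 - T 0 2 + T 0 0.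
  rewrite /T -!sumrB -big_split; apply: eq_bigr => x _ /=; ring.
rewrite E1 TC T0 // T00 N_eq in Hu.
have -> : T 2 2 = 3 * u - 2 - (6 * (2 * f + 1))%:R + 1.
  by rewrite -Hu; ring.
exists (u - (2 * (2 * f + 1))%:R).
by rewrite (_ : (6 * (2 * f + 1) = 3 * (2 * (2 * f + 1)))%N) ?natrM; [ring|lia].
Qed.

Lemma conj_psi m x : eis_conj (psi m x) = psi (5 * m) x.
Proof.
rewrite /psi; case: eqP => _; first by rewrite rmorph0.
by rewrite rmorphXn /= (_ : eis_conj zeta = zeta ^+ 5) // -exprM mulnA.
Qed.

Lemma conj_T m k : eis_conj (T m k) = T (5 * m) (5 * k).
Proof. by rewrite /T rmorph_sum; apply: eq_bigr => x _; rewrite rmorphM /= !conj_psi. Qed.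

(** The substitution [s = 1 / (1 + y)] makes the argument affine in [s]; a complete character sum
    results, up to the excluded points. *)
Lemma sum_moebius t : t != 1 -> \sum_(y | (y != 0) && (y != -1)) psi 2 ((1 + t * y) / (1 + y)) = - 1 - psi 2 t.
Proof.
move=> t1; have t1' : 1 - t != 0 by rewrite subr_eq0 eq_sym.
have inj1 : injective (fun s : F => s^-1 - 1) by move=> a b /addIr /invr_inj.
have inj2 : injective (fun s : F => t + (1 - t) * s) by move=> a b /addrI /(mulfI t1').
have H : \sum_(y | y != -1) psi 2 ((1 + t * y) / (1 + y)) = - psi 2 t.
  rewrite (reindex_inj inj1) /=.
  transitivity (\sum_(s | s != 0) psi 2 (t + (1 - t) * s)).
    have sE (s : F) : (s^-1 - 1 != -1) = (s != 0).
      by rewrite -[X in _ != X]add0r (inj_eq (addIr _)) invr_eq0.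
    apply: eq_big => s; first exact: sE.
    rewrite sE => s0; congr (psi _ _).
    have -> : 1 + (s^-1 - 1) = s^-1 by ring.
    rewrite invrK.
    by field.
  apply/eqP; rewrite -addr_eq0; apply/eqP.
  have : \sum_s psi 2 (t + (1 - t) * s) = 0 by have := @sum_psi 2 isT; rewrite (reindex_inj inj2).
  by rewrite (bigD1 0) //= mulr0 addr0 addrC.
rewrite -H [in RHS](bigD1 0) /=; last by rewrite eq_sym oppr_eq0 oner_eq0.
rewrite mulr0 !addr0 divr1 psi_1 addrA addNr add0r.
by apply: eq_bigl => y; rewrite andbC.
Qed.

(** Since [psi 4] is inverse to [psi 2], putting [x = t * y] reduces the product to
    [psi 2 t * psi 2 ((1 + t * y) / (1 + y))]. The diagonal [t = 1] gives [#|F| - 2], and the other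
    [t] add 2. *)
Lemma T_norm : T 2 2 * T 4 4 = #|F|%:R.
Proof.
pose D := [pred x : F | (x != 0) && (x != -1)].
have dom a : T a a = \sum_(x | D x) psi a x * psi a (-1 - x).
  rewrite /T [RHS]big_mkcond; apply: eq_bigr => x _ /=.
  have [->|x0] := eqVneq x 0; first by rewrite psi0 mul0r.
  by have [->|x1] := eqVneq x (-1); first rewrite subrr psi0 mulr0.
rewrite [T 4 4]dom mulr_sumr.
transitivity (\sum_(y | D y) \sum_t psi 2 t * psi 2 ((1 + t * y) / (1 + y))).
  apply: eq_bigr => y /andP [y0 y1]; have y1' : 1 + y != 0 by rewrite addrC addr_eq0.
  rewrite /T (reindex_inj (mulIf y0)) mulr_suml; apply: eq_bigr => t _.
  have V4 x : psi 4 x = psi 2 x^-1 by rewrite psiV; apply: psi_eq.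
  rewrite !V4 -!psiM; congr (psi _ _).
  have y2' : -1 - y != 0 by rewrite -opprD oppr_eq0.
  by field; rewrite ?y1' ?y0 ?y2'.
rewrite exchange_big /= (bigD1 1) //= psi_1.
have -> : \sum_(y | D y) 1 * psi 2 ((1 + 1 * y) / (1 + y)) = #|F|%:R - 2.
  rewrite (eq_bigr (fun _ => 1)) => [|y /andP [y0 y1]]; last first.
    by rewrite !mul1r divff ?psi_1 // addrC addr_eq0.
  rewrite sumr_const (_ : #|D| = (#|F| - 2)%N) ?natrB ?finNzRing_gt1 //.
  have -> : #|D| = #|[predC pred2 (0 : F) (-1)]|.
    by apply: eq_card => x; rewrite !inE negb_or.
  by rewrite -(cardC (pred2 (0 : F) (-1))) card2 eq_sym oppr_eq0 oner_eq0 /= addKn.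
rewrite (eq_bigr (fun t => - psi 2 t - psi 4 t)) => [|t t1]; last first.
  by rewrite -mulr_sumr sum_moebius // mulrBr mulrN1 -psiD.
rewrite sumrB sumrN.
have S m : ~~ (6 %| m)%N -> \sum_(t | t != 1) psi m t = -1.
  move=> /sum_psi H; apply/eqP; rewrite -addr_eq0; apply/eqP.
  by rewrite -[RHS]H [RHS](bigD1 1) //= psi_1 addrC.
rewrite !S //; ring.
Qed.

Definition zeta_tab (k : nat) : E :=
  nth 0 [:: Eis 1 0; Eis 1 1; Eis 0 1; Eis (-1) 0; Eis (-1) (-1); Eis 0 (-1)] (k %% 6).
Lemma zeta_tabE k : zeta ^+ k = zeta_tab k.
Proof.
rewrite -zeta_mod /zeta_tab; have := ltn_pmod k (isT : (0 < 6)%N).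
by move: (k %% 6)%N; do 6?[case=> [|] //].
Qed.

(** Cyclotomic numbers of order 6 for [x + y + 1 = 0], with [x] in class [i] and [y] in class
    [j]. *)
Definition cnt (i j : nat) : nat :=
  #|[pred x : F | [&& x != 0, -1 - x != 0, psi 1 x == zeta ^+ i & psi 1 (-1 - x) == zeta ^+ j]]|.

Lemma psi_pow m x : x != 0 -> psi m x = psi 1 x ^+ m.
Proof. by move=> /negPf x0; rewrite /psi x0 mul1n mulnC exprM. Qed.

Lemma psi_indicator i x : x != 0 ->
  \sum_(m < 6) zeta ^+ (5 * m * i) * psi m x = 6 * (psi 1 x == zeta ^+ i)%:R.
Proof.
move=> x0; set u := zeta ^+ (5 * i + ind x).
have -> : (psi 1 x == zeta ^+ i) = (u == 1).
  rewrite /psi (negPf x0) mul1n /u exprD; apply/eqP/eqP => [->|H].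
    by rewrite -exprD (_ : 5 * i + i = 6 * i)%N ?exprM ?zeta6 ?expr1n //; lia.
  rewrite -[LHS]mul1r -[X in X * _](_ : zeta ^+ i * zeta ^+ (5 * i) = 1) -?mulrA ?H ?mulr1 //.
  by rewrite -exprD (_ : i + 5 * i = 6 * i)%N ?exprM ?zeta6 ?expr1n //; lia.
transitivity (\sum_(m < 6) u ^+ m).
  apply: eq_bigr => m _; rewrite /psi (negPf x0) -exprD /u -exprM; congr (_ ^+ _); lia.
rewrite /u zeta_tabE; move: (5 * i + _)%N => k; rewrite /zeta_tab.
have := ltn_pmod k (isT : (0 < 6)%N); rewrite !big_ord_recl big_ord0.
by move: (k %% 6)%N; do 6?[case=> [|] //].
Qed.

Lemma cnt_fourier i j :
  36 * (cnt i j)%:R = \sum_(m < 6) \sum_(k < 6) zeta ^+ (5 * m * i) * zeta ^+ (5 * k * j) * T m k.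
Proof.
transitivity (\sum_x (\sum_(m < 6) zeta ^+ (5 * m * i) * psi m x) *
    (\sum_(k < 6) zeta ^+ (5 * k * j) * psi k (-1 - x))).
  rewrite /cnt -sum1_card natr_sum mulr_sumr big_mkcond; apply: eq_bigr => x _; rewrite inE.
  have [->|x0] /= := eqVneq x 0.
    by rewrite [X in X * _]big1 ?mul0r // => m _; rewrite psi0 mulr0.
  have [->|y0] /= := eqVneq (-1 - x) 0.
    by rewrite [X in _ * X]big1 ?mulr0 // => m _; rewrite psi0 mulr0.
  rewrite !psi_indicator //; case: (_ == _); case: (_ == _); rewrite /= ?mulr0 ?mul0r //.
under eq_bigr do rewrite mulr_suml; rewrite exchange_big /=; apply: eq_bigr => m _.
under eq_bigr do rewrite mulr_sumr; rewrite exchange_big /=; apply: eq_bigr => k _.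
by rewrite /T mulr_sumr; apply: eq_bigr => x _; ring.
Qed.

(** * Cyclotomic numbers of order 6 when 2 is a cube *)

Section TwoCubic.
Hypothesis psi4 : psi 1 4 = 1.

Lemma psi_quarter n : psi n 4^-1 = 1.
Proof.
have h4 : 4 != 0 :> F.
  by rewrite (_ : 4 = 2 * 2) ?mulf_neq0 ?F_two_neq0 // -natrM.
by rewrite psiV psi_pow // psi4 expr1n.
Qed.

(* [T m k] is the combination of [N - 1], [1], [T 2 2] and [T 4 4] with these coefficients. *)
Definition T_coef : seq (seq (seq int)) :=
  let o := [:: 0; 1; 0; 0] in let o' := [:: 0; -1; 0; 0] in
  let J := [:: 0; 0; 1; 0] in let j := [:: 0; 0; -1; 0] in
  let J' := [:: 0; 0; 0; 1] in let j' := [:: 0; 0; 0; -1] in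
  [:: [:: [:: 1; 0; 0; 0]; o; o'; o; o'; o];
      [:: o; j; j; j; j; o];
      [:: o'; j; J; j; o'; j'];
      [:: o; j; j; o; j'; j'];
      [:: o'; j; o'; j'; J'; j'];
      [:: o; o; j'; j'; j'; j']].
Definition coef m k r : E := eisC (nth 0 (nth [::] (nth [::] T_coef m) k) r).

Lemma T_tabE m k : (m < 6)%N -> (k < 6)%N ->
  T m k = coef m k 0 * (N%:R - 1) + coef m k 1 + coef m k 2 * T 2 2 + coef m k 3 * T 4 4.
Proof.
have D2 : T 3 2 = - T 2 2 by have := T_dup (isT : ~~ (6 %| 2)%N); rewrite psi_quarter => ->; ring.
have D1 : T 3 1 = T 1 1 by have := T_dup (isT : ~~ (6 %| 1)%N); rewrite psi_quarter => ->; ring.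
have D4 : T 3 4 = - T 4 4 by have := T_dup (isT : ~~ (6 %| 4)%N); rewrite psi_quarter => ->; ring.
have D5 : T 3 5 = T 5 5 by have := T_dup (isT : ~~ (6 %| 5)%N); rewrite psi_quarter => ->; ring.
have E31 : T 3 1 = - T 2 2 by rewrite -D2; apply: T_triple.
have E35 : T 3 5 = - T 4 4 by rewrite -D4; apply: T_triple.
have E11 : T 1 1 = - T 2 2 by rewrite -D1.
have E55 : T 5 5 = - T 4 4 by rewrite -D5.
have E21 : T 2 1 = - T 2 2 by rewrite -D2 [RHS]TC; apply: T_triple.
have E45 : T 4 5 = - T 4 4 by rewrite -D4 [RHS]TC; apply: T_triple.
have E14 : T 1 4 = - T 2 2 by rewrite -E11; apply: T_triple.
have E52 : T 5 2 = - T 4 4 by rewrite -E55; apply: T_triple.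
have E33 : T 3 3 = 1 by rewrite (T_triple (j := 0)) // TC T0 // (_ : (-1) ^+ 3 = -1) ?opprK.
have E15 : T 1 5 = 1 by rewrite (T_triple (j := 0)) // TC T0 // expr1 opprK.
have E24 : T 2 4 = -1 by rewrite (T_triple (j := 0)) // TC T0 // (_ : (-1) ^+ 2 = 1).
have E01 : T 0 1 = 1 by rewrite T0 // expr1 opprK.
have E02 : T 0 2 = -1 by rewrite T0 // (_ : (-1) ^+ 2 = 1).
have E03 : T 0 3 = 1 by rewrite T0 // (_ : (-1) ^+ 3 = -1) ?opprK.
have E04 : T 0 4 = -1 by rewrite T0 // (_ : (-1) ^+ 4 = 1).
have E05 : T 0 5 = 1 by rewrite T0 // (_ : (-1) ^+ 5 = -1) ?opprK.
have E00 := T00.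
have e0 : eisC 0 = 0 :> E by [].
have e1 : eisC 1 = 1 :> E by [].
have eN : eisC (-1) = -1 :> E by [].
move=> m6 k6; have C := TC m k; rewrite /coef.
by case: m m6 C => [|[|[|[|[|[|m]]]]]] // _; case: k k6 => [|[|[|[|[|[|k]]]]]] // _ C /=;
   rewrite ?e0 ?e1 ?eN ?mul0r ?mul1r ?mulN1r ?addr0 ?add0r;
   first [assumption | rewrite C; assumption].
Qed.

Definition cnt_coef i j r : E :=
  \sum_(m < 6) \sum_(k < 6) zeta_tab (5 * (m * i + k * j)) * coef m k r.

Lemma cnt_tab i j : 36 * (cnt i j)%:R =
  cnt_coef i j 0 * (N%:R - 1) + cnt_coef i j 1 + cnt_coef i j 2 * T 2 2 + cnt_coef i j 3 * T 4 4.
Proof.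
rewrite cnt_fourier /cnt_coef !mulr_suml -!big_split; apply: eq_bigr => m _ /=.
rewrite !mulr_suml -!big_split; apply: eq_bigr => k _ /=.
rewrite -exprD zeta_tabE (_ : 5 * m * i + 5 * k * j = 5 * (m * i + k * j))%N; last by lia.
rewrite T_tabE //; ring.
Qed.

Lemma T44_conj : T 4 4 = eis_conj (T 2 2).
Proof. by rewrite conj_T; apply: T_eq. Qed.

Lemma natE_eisC n : n%:R = Eis n%:Z 0 :> E.
Proof. by rewrite -[RHS]/(eisC n%:Z) -(natz n) rmorph_nat. Qed.

Lemma cnt_ere i j a b c d : cnt_coef i j 0 = eisC a -> cnt_coef i j 1 = eisC b ->
  cnt_coef i j 2 = c -> cnt_coef i j 3 = d ->
  36 * (cnt i j)%:Z = a * (N%:Z - 1) + b + ere (c * T 2 2 + d * T 4 4).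
Proof.
move=> Ha Hb Hc Hd; have := congr1 (@ere _) (cnt_tab i j).
by rewrite Ha Hb Hc Hd !natE_eisC !eisE /=; lia.
Qed.

Ltac compute_cnt := rewrite /cnt_coef !big_ord_recl !big_ord0; vm_compute; reflexivity.

Let FN : #|F| = N.+1.
Proof. by rewrite prednK // ltnW // finNzRing_gt1. Qed.

(** These are the pairs (1, 2) and (5, 4) with the first entry shifted by 3, because the count over
    [x - 1] is brought to the form [-1 - x] by a change of sign. The three extra pairs for [q = 7]
    are shifted likewise below. *)
Lemma cnt_main i j : (i, j) \in [:: (4, 2); (2, 4)]%N ->
  36 * (cnt i j)%:Z = #|F|%:Z + 1 + 2 * ere (T 2 2) - eim (T 2 2).
Proof.
have fin : 1 * (N%:Z - 1) + 3 + ere (1 * T 2 2 + 1 * T 4 4) = #|F|%:Z + 1 + 2 * ere (T 2 2) - eim (T 2 2).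
  by rewrite T44_conj FN !eisE /=; lia.
by rewrite !inE => /orP [] /eqP [-> ->]; rewrite -fin; apply: cnt_ere; compute_cnt.
Qed.

Lemma cnt_extra i j : (i, j) \in [:: (5, 0); (1, 1); (0, 5)]%N ->
  36 * (cnt i j)%:Z = #|F|%:Z + 1 + 2 * ere (T 2 2) + 5 * eim (T 2 2).
Proof.
have fin : 1 * (N%:Z - 1) + 3 + ere ((-1 - 4 * omega _) * T 2 2 + (3 + 4 * omega _) * T 4 4) =
    #|F|%:Z + 1 + 2 * ere (T 2 2) + 5 * eim (T 2 2).
  rewrite (_ : -1 - 4 * omega _ = Eis (-1) (-4)) // (_ : 3 + 4 * omega _ = Eis 3 4) //.
  by rewrite T44_conj FN !eisE /=; lia.
by rewrite !inE => /orP [|/orP []] /eqP [-> ->]; rewrite -fin; apply: cnt_ere; compute_cnt.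
Qed.
End TwoCubic.
End SexticCharacter.

(** * Reduction of the count to a congruence on an Eisenstein prime *)

Lemma finField_prim_root (F : finFieldType) : exists g : F, (#|F|.-1).-primitive_root g.
Proof.
have N0 : (0 < #|F|.-1)%N by case: #|F| (finNzRing_gt1 F) => [|[]].
pose r := [seq x <- enum F | x != 0].
have r1 : all (#|F|.-1).-unity_root r.
  by apply/allP => x; rewrite mem_filter => /andP [x0 _]; rewrite unity_rootE F_unity.
have ur : uniq r by rewrite filter_uniq // enum_uniq.
have sr : (#|F|.-1 <= size r)%N.
  by rewrite size_filter -sum1_count big_enum_cond /= sum1_card -(cardC1 (0 : F)).
by have /hasP [g _ pg] := has_prim_root N0 r1 ur sr; exists g.
Qed.

Lemma intr_Fp_eq0 p (k : int) : prime p -> (k%:~R == 0 :> 'F_p) = (p %| k)%Z.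
Proof. by move=> pr; rewrite intr_Zp_eq0 pdiv_id // prime_gt1. Qed.

Section PrimitiveSixthRoot.
Definition primes_1_mod_6 q := forall r, prime r -> (r %| q)%N -> (r %% 6 = 1)%N.

Lemma sixth_root_prime r : prime r -> (r %% 6 = 1)%N -> exists z : int, (r %| z ^+ 2 - z + 1)%Z.
Proof.
move=> pr r6; have [g pg] := finField_prim_root 'F_r.
rewrite card_Fp // in pg.
pose h := g ^+ (r.-1 %/ 6).
have r1 : (r.-1 = r.-1 %/ 6 * 6)%N by lia.
have rp := prime_gt1 pr.
have h6 : h ^+ 6 = 1 by rewrite -exprM -r1 (prim_expr_order pg).
have h3 : h ^+ 3 = -1.
  have : (h ^+ 3) ^+ 2 == 1 by rewrite -exprM h6.
  rewrite sqrf_eq1 => /orP [|/eqP //]; rewrite -exprM -(prim_order_dvd pg) => /dvdnP [k Hk].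
  move: Hk r1; case: k => [|k]; move: (r.-1 %/ 6)%N => m; lia || nia.
have h1 : h != -1.
  apply/eqP => E; have : h ^+ 2 = 1 by rewrite E sqrrN expr1n.
  move/eqP; rewrite -exprM -(prim_order_dvd pg) => /dvdnP [k Hk].
  move: Hk r1; case: k => [|k]; move: (r.-1 %/ 6)%N => m; lia || nia.
have : (h + 1) * (h ^+ 2 - h + 1) == 0.
  have id (R : comNzRingType) (y : R) : (y + 1) * (y ^+ 2 - y + 1) = y ^+ 3 + 1 by ring.
  by rewrite id h3 addNr.
rewrite mulf_eq0 addr_eq0 (negPf h1) /= => /eqP H.
exists (h : nat)%:Z; move: H => /eqP; rewrite -[in X in X -> _](natr_Zp h).
have -> : (h : nat)%:R ^+ 2 - (h : nat)%:R + 1 = (((h : nat)%:Z ^+ 2 - (h : nat)%:Z + 1)%:~R : 'F_r).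
  by rewrite rmorphD rmorphB rmorphXn.
by rewrite -intr_Fp_eq0.
Qed.

(** Induction on the prime factors: a new prime is handled by the Chinese remainder theorem, a
    repeated one by a Newton step. *)
Lemma sixth_root_mod q : (0 < q)%N -> primes_1_mod_6 q -> exists z : int, (q %| z ^+ 2 - z + 1)%Z.
Proof.
have [n] := ubnP q; elim: n q => // n IH q qn q0 gq.
have [q1|q1] := leqP q 1; first by exists 0; rewrite (_ : q = 1%N) ?dvd1z //; lia.
pose r := pdiv q; have pr : prime r by apply: pdiv_prime.
have rq : (r %| q)%N := pdiv_dvd q; have r1 := prime_gt1 pr.
have r6 := gq r pr rq.
have [q' Eq] := dvdnP rq.
have q'0 : (0 < q')%N by case: q' Eq => // E; rewrite E in q0.
have [|//|z Hz] := IH q' _ q'0; first nia.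
  by move=> s ps sq; apply: gq => //; rewrite Eq dvdn_mulr.
have [/dvdzP [s Hs]] := Hz; have [rq'|rq'] := boolP (r %| q')%N.
  (* The derivative is invertible because [(2 * z - 1) ^ 2 = 4 * (z ^ 2 - z + 1) - 3] and [r] does
     not divide 3. *)
  have cop : coprimez (2 * z - 1) r.
    rewrite coprimezE /= coprime_sym prime_coprime //; apply/negP => d.
    have : (r %| 3)%N.
      have : (r %| (2 * z - 1) * (2 * z - 1) - 4 * (z ^+ 2 - z + 1))%Z.
        by apply: rpredB; [apply: dvdz_mulr; rewrite dvdzE|rewrite Hs !dvdz_mull].
      by rewrite (_ : _ - _ = -3) ?dvdzE //; ring.
    by move/dvdn_leq => /(_ isT); lia.
  have /coprimezP [[u v] /= uv] := cop.
  have newton (R : comNzRingType) (Q x t : R) :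
      (x - Q * t) ^+ 2 - (x - Q * t) + 1 = (x ^+ 2 - x + 1) - Q * (t * (2 * x - 1)) + (Q * Q) * t ^+ 2.
    by ring.
  exists (z - q'%:Z * (s * u)); rewrite newton Hs -[s * u * _]mulrA (_ : u * (2 * z - 1) = 1 - v * r).
    rewrite mulrBr mulr1 mulrBr opprB [s * _]mulrC addrCA subrr addr0 Eq PoszM.
    apply: rpredD; last by apply: dvdz_mulr; apply: dvdz_mul => //; rewrite dvdzE.
    by apply: dvdz_mul => //; rewrite mulrA dvdz_mull.
  exact: (canRL (addrK _) uv).
have [z1 Hz1] := sixth_root_prime pr r6.
have cop : coprimez q' r by rewrite coprimezE /= coprime_sym prime_coprime.
exists (zchinese q' r z z1); rewrite Eq PoszM Gauss_dvdz //; apply/andP.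
have red (d x y : int) : (x = y %[mod d])%Z -> (d %| y ^+ 2 - y + 1)%Z -> (d %| x ^+ 2 - x + 1)%Z.
  move/eqP; rewrite eqz_mod_dvd => dxy dy.
  have -> : x ^+ 2 - x + 1 = (x - y) * (x + y - 1) + (y ^+ 2 - y + 1) by ring.
  by apply: rpredD => //; apply: dvdz_mulr.
by split; [apply: (red _ _ z) => //; apply: zchinese_modl|apply: (red _ _ z1) => //; apply: zchinese_modr].
Qed.
End PrimitiveSixthRoot.

(** * The cubic Jacobi sum as a primary prime *)

Section JacobiSumPrime.
Variables (F : finFieldType) (f : nat).
Local Notation N := #|F|.-1.
Hypothesis N_eq : N = (6 * (2 * f + 1))%N.

Lemma primary_dvd_eq_nrm x y : primary x -> primary y -> edvd x y -> nrm x = nrm y -> x = y.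
Proof.
move=> px py /edvdP [e Ey] Nxy; have pe : primary e by apply: (primary_cofactor px); rewrite -Ey.
have : nrm e = 1%N.
  by move: Nxy; rewrite Ey nrmM; have := primary_nrm_gt0 px; have := primary_nrm_gt0 pe; nia.
by move/(primary_nrm1 pe) => e1; rewrite Ey e1 mulr1.
Qed.

Lemma prim_rootV (g : F) : N.-primitive_root g -> N.-primitive_root g^-1.
Proof.
move=> gp; have N0 : (0 < N)%N by rewrite N_eq; lia.
have -> : g^-1 = g ^+ N.-1.
  apply: (mulfI (g_neq0 gp N_eq)); rewrite divff ?(g_neq0 gp N_eq) //.
  by rewrite -exprS prednK // (prim_expr_order gp).
by rewrite (prim_root_exp_coprime _ gp) -[X in coprime _ X](prednK N0) coprimenS.
Qed.

Lemma T_inv (g : F) (gp : N.-primitive_root g) (gp' : N.-primitive_root g^-1) :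
  T gp' 2 2 = eis_conj (T gp 2 2).
Proof.
rewrite conj_T; have psi_inv m x : psi gp' m x = psi gp (5 * m) x.
  have [->|x0] := eqVneq x 0; first by rewrite !psi0.
  rewrite (indP gp' x0) (psi_expr _ N_eq) exprVn (psiV _ N_eq) (psi_expr _ N_eq).
  by rewrite -[LHS]zeta_mod -[RHS]zeta_mod; congr (_ ^+ _); lia.
by apply: eq_bigr => x _; rewrite !psi_inv.
Qed.

(** By [T22_mod3], [- J] is primary, and it has norm [#|F|]. The prime [x] divides [J * eis_conj J],
    hence one factor, and equal norms leave no room for a cofactor. *)
Lemma T22_prime (g : F) (gp : N.-primitive_root g) (x : eis int) :
  eprime x -> nrm x = #|F| -> T gp 2 2 = - x \/ T gp 2 2 = - eis_conj x.
Proof.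
move=> ex Nx; set J := T gp 2 2.
have pJ : primary (- J).
  have [t E] := T22_mod3 gp N_eq; rewrite /J E.
  by apply/primaryP; exists (- ere t), (- eim t); apply: eis_eqP; rewrite !eisE /=; ring.
have NJ : J * eis_conj J = #|F|%:R by rewrite -(T_norm gp N_eq) T44_conj.
have nJ : nrm (- J) = #|F|.
  apply/eqP; rewrite -eqz_nat nrmE; apply/eqP.
  by move: NJ; rewrite mul_conj natE_eisC => -[<-]; rewrite /eis_norm /=; ring.
have px : primary x by case: ex.
have : edvd x (- J * - eis_conj J).
  rewrite mulrNN NJ -Nx; apply/edvdP; exists (eis_conj x).
  by rewrite mul_conj -nrmE natE_eisC.
case/(eprime_dvdM ex) => d; [left|right].
  by rewrite (primary_dvd_eq_nrm px pJ d) ?opprK // Nx nJ.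
have cJ : - eis_conj J = eis_conj (- J) by apply: eis_eqP; rewrite !eisE /=; ring.
rewrite (primary_dvd_eq_nrm px _ d) ?cJ ?primary_conj ?nrmJ ?nJ // eis_conjK.
by rewrite opprK.
Qed.

(** Modulo 2 the sum is the cubic residue symbol of 1/4, and [x = 1] modulo 2 forces it to be 1, as
    1, [omega], [omega ^ 2] are distinct modulo 2. Finally [psi 2] of 1/4 equals [psi 1] of 4, both
    being [psi 2] of 2. *)
Lemma two_cubic (g : F) (gp : N.-primitive_root g) (x : eis int) t :
  T gp 2 2 = - x -> x = 1 + 2 * t -> psi gp 1 4 = 1.
Proof.
move=> Tx xt; have two0 := F_two_neq0 gp N_eq.
have e4 : (4 : F) = 2 * 2 by ring.
have h : psi gp 1 4 = psi gp 2 4^-1.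
  by rewrite (psiV _ N_eq) e4 !(psiM _ N_eq) -!psiD; apply: psi_eq.
have [s] := psi2_mod2 gp N_eq; rewrite Tx xt h.
have n0 : (4^-1 : F) != 0 by rewrite invr_eq0 e4 mulf_neq0.
rewrite (indP gp n0) (psi_expr gp N_eq) zeta_tabE /zeta_tab.
have : (2 * ind gp 4^-1 %% 6)%N \in [:: 0; 2; 4]%N by rewrite !inE; lia.
by rewrite !mulr_natl !inE => /or3P [] /eqP -> //= /(congr1 (@eim _)); rewrite !eisE /=; lia.
Qed.

Lemma exists_oriented_root (x y : eis int) t :
  eprime x -> nrm x = #|F| -> x = 1 + 2 * t -> y = x \/ y = eis_conj x ->
  exists g (gp : N.-primitive_root g), T gp 2 2 = - y /\ psi gp 1 4 = 1.
Proof.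
move=> ex Nx xt yx; have [g gp] := finField_prim_root F; have gp' := prim_rootV gp.
have [s ys] : exists s, y = 1 + 2 * s.
  case: yx => ->; first by exists t.
  by exists (eis_conj t); rewrite xt !mulr_natl; apply: eis_eqP; rewrite !eisE /=; ring.
have fin g' (gp1 : N.-primitive_root g') : T gp1 2 2 = - y ->
    exists g (gp : N.-primitive_root g), T gp 2 2 = - y /\ psi gp 1 4 = 1.
  by move=> h; exists g', gp1; split=> //; apply: two_cubic h ys.
have cN (z : eis int) : eis_conj (- z) = - eis_conj z by apply: eis_eqP; rewrite !eisE /=; ring.
by case: (T22_prime gp ex Nx) => h; case: yx => yx;
  [apply: (fin _ gp)|apply: (fin _ gp')|apply: (fin _ gp')|apply: (fin _ gp)];
  rewrite ?(T_inv gp) h yx ?cN ?eis_conjK.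
Qed.
End JacobiSumPrime.

Section EvalOmega.
Variables (R : comNzRingType) (w : R).
Definition eis_eval (x : eis int) : R := (ere x)%:~R + (eim x)%:~R * w.

Lemma eis_evalB x y : eis_eval (x - y) = eis_eval x - eis_eval y.
Proof. by rewrite /eis_eval !eisE !intrB mulrBl opprD addrACA. Qed.
Lemma eis_eval1 : eis_eval 1 = 1.
Proof. by rewrite /eis_eval !eisE mul0r addr0. Qed.

Hypothesis w2 : w ^+ 2 = - w - 1.
Lemma eis_evalM x y : eis_eval (x * y) = eis_eval x * eis_eval y.
Proof.
have id (a b c d : R) : (a + b * w) * (c + d * w) =
   (a * c - b * d) + (a * d + b * c - b * d) * w + b * d * (w ^+ 2 - (- w - 1)) by ring.
by rewrite /eis_eval id w2 subrr mulr0 addr0 !eisE !(intrB, intrD, intrM).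
Qed.
End EvalOmega.

(** * The equation z ^ i = z ^ j + 1 modulo q *)

Section SixthRootDifferences.
Variable q : nat.
Hypotheses (q_gt1 : (1 < q)%N) (q_good : primes_1_mod_6 q).

(** The list holds the norms of the nonzero [zeta ^ i - zeta ^ j - 1]. Among the possible prime
    divisors only 7 is 1 modulo 6. *)
Lemma good_dvd_small n : n \in [:: 1; 3; 4; 7; 9]%N -> (q %| n)%N -> q = 7%N.
Proof.
have pr := pdiv_prime q_gt1; have r6 := q_good pr (pdiv_dvd q) => nin qn.
have rn := dvdn_trans (pdiv_dvd q) qn; have r1 := prime_gt1 pr.
have rle : (pdiv q <= 9)%N by apply: leq_trans (dvdn_leq _ rn) _; move: nin; rewrite !inE; lia.
have r7 : pdiv q = 7%N by lia.
have n7 : n = 7%N by move: nin rn; rewrite r7 !inE => /or4P [|||/orP []] /eqP ->.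
rewrite n7 in qn; have := dvdn_leq (isT : (0 < 7)%N) qn.
by have := pdiv_dvd q; rewrite r7 => /dvdnP [k Ek]; lia.
Qed.

Lemma good_unit n : n \in [:: 2; 3; 36]%N -> (n%:R : 'Z_q) \is a GRing.unit.
Proof.
move=> nin; rewrite unitZpE // coprime_sym; apply: contraT => nc.
have [r [pr rn rq]] : exists r, [/\ prime r, (r %| n)%N & (r %| q)%N].
  have d0 : (0 < gcdn n q)%N by rewrite gcdn_gt0 (ltnW q_gt1) orbT.
  have d1 : (1 < gcdn n q)%N by rewrite ltn_neqAle eq_sym nc.
  exists (pdiv (gcdn n q)); split; first exact: pdiv_prime.
    by apply: dvdn_trans (pdiv_dvd _) (dvdn_gcdl _ _).
  by apply: dvdn_trans (pdiv_dvd _) (dvdn_gcdr _ _).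
have r6 := q_good pr rq; have r1 := prime_gt1 pr.
have rn' : (r %| 6 * 6)%N by apply: dvdn_trans rn _; move: nin; rewrite !inE => /or3P [] /eqP ->.
have : (r %| 6)%N by move: rn'; rewrite Euclid_dvdM // orbb.
by move=> /(dvdn_leq (isT : (0 < 6)%N)); lia.
Qed.

Variable z : 'Z_q.
Hypothesis z2 : z ^+ 2 = z - 1.

Lemma root_sub1_sqr : (z - 1) ^+ 2 = - (z - 1) - 1.
Proof. by rewrite sqrrB1 z2; ring. Qed.

Let phi := eis_eval (z - 1).
Let phiX k : phi (zeta ^+ k) = z ^+ k.
Proof.
elim: k => [|k IH]; first by rewrite !expr0 /phi eis_eval1.
rewrite !exprS /phi (eis_evalM root_sub1_sqr) -/phi IH.
by rewrite /phi /eis_eval !eisE /= mul1r addrC subrK.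
Qed.

(** [phi] is the ring morphism sending [omega] to [z - 1], hence [zeta] to [z]. An element of its
    kernel has its norm in the kernel too. *)
Lemma root_diff_nrm i j : z ^+ i = z ^+ j + 1 -> (q %| nrm (zeta ^+ i - zeta ^+ j - 1)%R)%N.
Proof.
move=> E; set x := (_ - 1); have : phi x = 0 by rewrite /phi !eis_evalB eis_eval1 -/phi !phiX E [_ + 1]addrC addrK subrr.
move=> x0; have : phi (x * eis_conj x) = 0 by rewrite /phi (eis_evalM root_sub1_sqr) -/phi x0 mul0r.
rewrite mul_conj /phi /eis_eval /= mul0r addr0 => /eqP.
by rewrite intr_Zp_eq0 // -nrmE dvdzE.
Qed.

Lemma root_cube : z ^+ 3 = -1.
Proof. by rewrite exprS z2 mulrBr -expr2 z2 mulr1 addrAC subrr add0r. Qed.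

Lemma root_diff_pairs i j : q <> 7%N -> (i < 6)%N -> (j < 6)%N ->
  (z ^+ i == z ^+ j + 1) = ((i, j) \in [:: (1, 2); (5, 4)]%N).
Proof.
move=> q7 i6 j6; apply/eqP/idP; last first.
  rewrite !inE => /orP [] /eqP [-> ->]; first by rewrite z2 subrK.
  by rewrite (exprD _ 3 2) (exprD _ 3 1) root_cube z2 !mulN1r opprB addrC.
move/root_diff_nrm; move: i j i6 j6 => [|[|[|[|[|[|//]]]]]] [|[|[|[|[|[|//]]]]]] _ _ //.
all: by rewrite !zeta_tabE; vm_compute nrm => d; case: q7; apply: good_dvd_small d.
Qed.
End SixthRootDifferences.

Lemma root_diff_pairs7 i j : (i < 6)%N -> (j < 6)%N ->
  ((3 : 'Z_7) ^+ i == 3 ^+ j + 1) = ((i, j) \in [:: (1, 2); (5, 4); (2, 0); (4, 1); (3, 5)]%N).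
Proof.
by move: i j => [|[|[|[|[|[|//]]]]]] [|[|[|[|[|[|//]]]]]] _ _; vm_compute.
Qed.

Lemma zeta_eq a b : (zeta ^+ a == zeta ^+ b) = (a == b %[mod 6]).
Proof.
rewrite -(zeta_mod a) -(zeta_mod b).
have := ltn_pmod a (isT : (0 < 6)%N); have := ltn_pmod b (isT : (0 < 6)%N).
move: (a %% 6)%N (b %% 6)%N => [|[|[|[|[|[|//]]]]]] [|[|[|[|[|[|//]]]]]] _ _;
by vm_compute.
Qed.

Lemma natr_Zp_eq m a b : (1 < m)%N -> (a%:R == b%:R :> 'Z_m) = (a == b %[mod m]).
Proof. by move=> m1; rewrite -val_eqE /= !val_Zp_nat. Qed.

Lemma natr_Fp_eq p a b : prime p -> (a%:R == b%:R :> 'F_p) = (a == b %[mod p]).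
Proof. by move=> pr; rewrite -val_eqE /= !val_Fp_nat. Qed.

(** * From the intersection of S and S + 1 to cyclotomic numbers *)

Section ShiftCount.
Variables (p q f A0 : nat).
Hypotheses (p_prime : prime p) (q_gt1 : (1 < q)%N) (pq_cop : coprime p q).
Local Notation F := 'F_p.
Local Notation N := (#|F|.-1).
Hypothesis N_eq : N = (6 * (2 * f + 1))%N.
Local Notation g := (A0%:R : F).
Local Notation z := (A0%:R : 'Z_q).
Hypothesis g_prim : N.-primitive_root g.
Hypothesis z6 : z ^+ 6 = 1.
Local Notation A := (A0%:R : 'Z_(p * q)).

Let pq_gt1 : (1 < p * q)%N.
Proof. by have := prime_gt1 p_prime; nia. Qed.

Let crt a b : (a%:R == b%:R :> 'Z_(p * q)) = (a%:R == b%:R :> F) && (a%:R == b%:R :> 'Z_q).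
Proof. by rewrite (natr_Zp_eq _ _ pq_gt1) (natr_Zp_eq _ _ q_gt1) natr_Fp_eq // chinese_remainder. Qed.

Let zX k l : (k = l %[mod N])%N -> z ^+ k = z ^+ l.
Proof.
move=> H; have N6 : (6 %| N)%N by rewrite N_eq dvdn_mulr.
by rewrite -(expr_mod k z6) -(expr_mod l z6) -(modn_dvdm k N6) H modn_dvdm.
Qed.

Lemma expA_eq k l : (A ^+ k == A ^+ l) = (k == l %[mod N]).
Proof.
rewrite -!natrX crt !natrX (eq_prim_root_expr g_prim).
by case: eqP => //= /zX ->; rewrite eqxx.
Qed.

Lemma expA_eq_add1 k l : (A ^+ k == A ^+ l + 1) = (g ^+ k == g ^+ l + 1) && (z ^+ k == z ^+ l + 1).
Proof. by rewrite -!natrX !natr1 crt. Qed.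

Lemma ind_mod k : (ind g_prim (g ^+ k) = k %[mod N])%N.
Proof.
have gk : g ^+ k != 0 by rewrite expf_neq0 // (g_neq0 g_prim N_eq).
by have /eqP := indP g_prim gk; rewrite (eq_prim_root_expr g_prim) => /eqP.
Qed.

(** The order of [A] is [p - 1], as [z] has order dividing 6 and 6 divides [p - 1]. So elements of
    [S] correspond to nonzero residues modulo [p], and their residue modulo [q] is a function of the
    discrete logarithm. *)
Lemma card_shift : #|Spq p A :&: shift1 (Spq p A)| =
  #|[pred x : F | [&& x != 0, x - 1 != 0 & z ^+ ind g_prim x == z ^+ ind g_prim (x - 1) + 1]]|.
Proof.
set X := [pred x | _]; have pN : p.-1 = N by rewrite card_Fp.
have N0 : (0 < N)%N by rewrite N_eq; lia.
have Sin k : A ^+ k \in Spq p A.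
  have kp : (k %% N < p.-1)%N by rewrite pN ltn_pmod.
  by apply/imsetP; exists (Ordinal kp) => //=; apply/eqP; rewrite expA_eq modn_mod.
have inj : {in X &, injective (fun x => A ^+ ind g_prim x)}.
  move=> x y; rewrite !inE => /andP [x0 _] /andP [y0 _] /eqP; rewrite expA_eq => H.
  by rewrite (indP g_prim x0) (indP g_prim y0); apply/eqP; rewrite (eq_prim_root_expr g_prim).
rewrite -(card_in_imset inj); congr #|pred_of_set _|; apply/setP => s.
rewrite inE; apply/andP/imsetP => [[/imsetP [i _ ->] /imsetP [_ /imsetP [j _ ->] E]]|].
  move/eqP: E; rewrite expA_eq_add1 => /andP [/eqP gij zij].
  have gij' : g ^+ i - 1 = g ^+ j by rewrite gij addrK.
  exists (g ^+ i); last by apply/eqP; rewrite expA_eq ind_mod.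
  rewrite inE gij' !expf_neq0 ?(g_neq0 g_prim N_eq) //=.
  by rewrite (zX (ind_mod i)) (zX (ind_mod j)).
case=> x; rewrite inE => /and3P [x0 x1 E] ->; split=> //.
apply/imsetP; exists (A ^+ ind g_prim (x - 1)) => //; apply/eqP.
by rewrite expA_eq_add1 E andbT -(indP g_prim x0) -(indP g_prim x1) subrK.
Qed.

Lemma card_shift_cnt (L : seq (nat * nat)) : uniq L -> all (fun l => (l.1 < 6) && (l.2 < 6))%N L ->
  (forall i j, (i < 6)%N -> (j < 6)%N -> (z ^+ i == z ^+ j + 1) = ((i, j) \in L)) ->
  #|Spq p A :&: shift1 (Spq p A)| = (\sum_(l <- L) cnt g_prim ((l.1 + 3) %% 6) l.2)%N.
Proof.
move=> uL /allP L6 HL; rewrite card_shift.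
pose key (x : F) : nat * nat := (ind g_prim x %% 6, ind g_prim (x - 1)%R %% 6)%N.
transitivity (\sum_(x : F | (x != 0%R) && (x - 1 != 0)%R) \sum_(l <- L) (key x == l))%N.
  rewrite -sum1_card big_mkcond [RHS]big_mkcond; apply: eq_bigr => x _; rewrite inE.
  case: eqP => //= _; case: eqP => //= _.
  rewrite -(expr_mod _ z6) -(expr_mod (ind _ (x - 1)) z6) HL ?ltn_pmod // -/(key x).
  case: (boolP (key x \in L)) => kL.
    by rewrite (bigD1_seq (key x)) //= eqxx big1 // => l /negPf; rewrite eq_sym => ->.
  by rewrite big1_seq // => l /andP [_ lL]; case: eqP => // E; rewrite E lL in kL.
rewrite exchange_big /=; apply: eq_big_seq => -[i j] /= ijL.
have /andP [i6 j6] := L6 _ ijL; rewrite /= in i6 j6.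
(* The change of sign carries the pair [(x, x - 1)] to [(- x, x - 1)], of sum -1. Since
   [psi 1 (-1) = zeta ^ 3], the first index moves by 3. *)
rewrite /cnt -!sum1_card big_mkcond [RHS]big_mkcond [RHS](reindex_inj (@oppr_inj F)) /=.
apply: eq_bigr => x; rewrite -[x]/(x : F) !inE oppr_eq0 opprK addrC => _.
have [x0|x0] := eqVneq (x : F) 0; rewrite //=.
rewrite addrC; have [x1|x1] := eqVneq (x - 1 : F) 0; rewrite //=.
rewrite (psiN _ N_eq) expr1 -zeta3 /psi (negPf x0) (negPf x1) !mul1n -exprD !zeta_eq modn_mod.
rewrite /key xpair_eqE addnC eqn_modDr (modn_small i6) (modn_small j6).
by case: (_ && _).
Qed.
End ShiftCount.

Lemma exists_sixth_root q : (1 < q)%N -> primes_1_mod_6 q ->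
  exists z : 'Z_q, z ^+ 2 = z - 1 /\ (q = 7%N -> z = 3).
Proof.
move=> q1 gq; have [->|q7] := eqVneq q 7%N.
  by exists 3; split=> //; apply/eqP; vm_compute.
have [z Hz] := sixth_root_mod (ltnW q1) gq.
exists z%:~R; split=> [|q7']; last by rewrite q7' eqxx in q7.
apply/eqP; rewrite -subr_eq0 opprB addrA.
by rewrite -rmorphXn -[1]/(1%:~R) -rmorphD -rmorphB intr_Zp_eq0 // addrAC.
Qed.

(* Inverting the primitive root modulo [p] conjugates the Jacobi sum, so that for [q = 7]
   either of the two alternatives in the last hypothesis can be arranged. *)
Theorem shift_count_mod p q f pi t : prime p -> p = (6 * (2 * f + 1)).+1 ->
  (1 < q)%N -> primes_1_mod_6 q -> coprime p q -> eprime pi -> nrm pi = p -> pi = 1 + 2 * t ->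
  (q <> 7%N -> (q %| eis_norm (pi - 1) + 36)%Z) ->
  (q = 7%N -> (7 %| ere pi + 2 * eim pi - 2)%Z || (7 %| ere pi + 4 * eim pi - 2)%Z) ->
  exists a : 'Z_(p * q),
    [/\ a \is a GRing.unit, generates_units_mod p (val a), a ^+ (p.-1)./2 = -1 &
      (#|Spq p a :&: shift1 (Spq p a)| + 2 = 0 %[mod q])%N].
Proof.
move=> pr pf q1 gq cpq epi npi pit hq hq7.
have FN : #|'F_p|.-1 = (6 * (2 * f + 1))%N by rewrite card_Fp // pf.
have [z [z2 z7]] := exists_sixth_root q1 gq.
pose y := if (q == 7%N) && ~~ (7 %| ere pi + 4 * eim pi - 2)%Z then eis_conj pi else pi.
have npF : nrm pi = #|'F_p| by rewrite card_Fp.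
have yx : y = pi \/ y = eis_conj pi by rewrite /y; case: ifP; [right|left].
have [g [gp [Tg psi4]]] := exists_oriented_root FN epi npF pit yx.
pose A0 := chinese p q (val g) (val z).
have gA : g = A0%:R.
  by rewrite -[LHS]natr_Zp; apply/eqP; rewrite natr_Fp_eq // chinese_modl.
have zA : z = A0%:R.
  by rewrite -[LHS]natr_Zp; apply/eqP; rewrite natr_Zp_eq // chinese_modr.
move: gp Tg psi4; clearbody A0; subst g => gp Tg psi4; subst z.
have p1 := prime_gt1 pr; have pq1 : (1 < p * q)%N by nia.
have z3 := root_cube z2.
have z6 : (A0%:R : 'Z_q) ^+ 6 = 1 by rewrite (exprM _ 3 2) z3 sqrrN expr1n.
have g0 := g_neq0 gp FN.
have cpA : coprime p A0 by rewrite -unitFpE // unitfE.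
have cqA : coprime q A0.
  by rewrite -(unitZpE _ q1); apply/unitrP; exists (A0%:R ^+ 5); rewrite -exprS -exprSr z6.
have vA : (val (A0%:R : 'Z_(p * q)) = A0 %[mod p])%N.
  by rewrite /= val_Zp_nat // modn_dvdm // dvdn_mulr.
exists A0%:R; split.
- by rewrite unitZpE // coprimeMl cpA.
- split; first by rewrite coprime_sym -coprime_modr vA coprime_modr.
  move=> b bp; have b0 : (b%:R : 'F_p) != 0 by rewrite -unitfE unitFpE // coprime_sym.
  exists (ind gp b%:R); apply/eqP; rewrite -modnXm vA modnXm -natr_Fp_eq // natrX.
  by rewrite -(indP gp b0).
- have e : (p.-1./2 = 3 * (2 * f + 1))%N by rewrite pf /=; lia.
  apply/eqP; rewrite -addr_eq0 -natrX natr1 -[0]/(0%:R) natr_Zp_eq // chinese_remainder //.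
  rewrite -(natr_Zp_eq _ _ q1) -natr_Fp_eq //. rewrite -!natr1 !natrX !addr_eq0; apply/andP; split.
    have := g_half gp FN; rewrite FN (_ : (6 * _ %/ 2 = p.-1./2)%N) => [->//|].
    by rewrite e; lia.
  by rewrite e exprM z3 exprD exprM sqrrN !expr1n mul1r.
have c36 : coprime q 36 by rewrite -(unitZpE _ q1) good_unit.
(* The cyclotomic numbers are known through their multiples by 36, which is prime to [q]. *)
suff : (q%:Z %| 36%:Z * (#|Spq p (A0%:R : 'Z_(p * q)) :&: shift1 (Spq p A0%:R)| + 2)%:Z)%Z.
  by rewrite Gauss_dvdzr // dvdzE /= mod0n => /eqP.
have cardE L := @card_shift_cnt p q f A0 pr q1 cpq FN gp z6 L.
have pN : (#|'F_p|%:Z = eis_norm pi) by rewrite -npF nrmE.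
have main i j h := @cnt_main _ _ gp _ FN psi4 i j h.
have extra i j h := @cnt_extra _ _ gp _ FN psi4 i j h.
have [q7|q7] := eqVneq q 7%N; last first.
  have y1 : y = pi by rewrite /y (negPf q7).
  rewrite (cardE [:: (1, 2); (5, 4)]%N) // => [|i j i6 j6]; last by apply: root_diff_pairs => //; apply/eqP.
  have m1 := main 4%N 2%N isT; have m2 := main 2%N 4%N isT; rewrite Tg y1 pN in m1 m2.
  rewrite !big_cons big_nil addn0 -[in X in cnt gp X 2]/4%N -[in X in cnt gp X 4]/2%N.
  move: (cnt gp 4 2) (cnt gp 2 4) m1 m2 => c1 c2 m1 m2.
  have -> : 36%:Z * (c1 + c2 + 2)%:Z = 2 * (eis_norm (pi - 1) + 36).
    by clear -m1 m2; move: m1 m2; rewrite /eis_norm !eisE; case: pi => A B /=; lia.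
  by rewrite dvdz_mull ?hq //; apply/eqP.
have m1 := main 4%N 2%N isT; have m2 := main 2%N 4%N isT.
have m3 := extra 5%N 0%N isT; have m4 := extra 1%N 1%N isT; have m5 := extra 0%N 5%N isT.
rewrite Tg pN in m1 m2 m3 m4 m5.
rewrite (cardE [:: (1, 2); (5, 4); (2, 0); (4, 1); (3, 5)]%N) // => [|i j i6 j6]; last first.
  by rewrite z7 // q7 root_diff_pairs7.
rewrite !big_cons big_nil addn0 -[in X in cnt gp X 2]/4%N -[in X in cnt gp X 4]/2%N.
rewrite -[in X in cnt gp X 0]/5%N -[in X in cnt gp X 1]/1%N -[in X in cnt gp X 5]/0%N.
move: (cnt gp 4 2) (cnt gp 2 4) (cnt gp 5 0) (cnt gp 1 1) (cnt gp 0 5) m1 m2 m3 m4 m5 => c1 c2 c3 c4 c5 m1 m2 m3 m4 m5.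
have {}hq7 : (7 %| ere y + 4 * eim y - 2)%Z.
  rewrite /y q7 eqxx /=; case: (boolP (7 %| ere pi + 4 * eim pi - 2)%Z) => //= h.
  have := hq7 q7; rewrite (negPf h) orbF => /dvdzP [k Hk].
  by apply/dvdzP; exists (k - eim pi); clear -Hk; rewrite /=; lia.
have Ny : eis_norm pi = eis_norm y by case: yx => ->; rewrite ?eis_normJ.
have -> : 36%:Z * (c1 + (c2 + (c3 + (c4 + c5))) + 2)%:Z = 5 * (eis_norm y + 1) - 10 * ere y - 13 * eim y + 72.
  by clear -m1 m2 m3 m4 m5 Ny; move: m1 m2 m3 m4 m5; rewrite Ny !eisE; lia.
rewrite q7; have /dvdzP [k Hk] := hq7; have x_eq : ere y = 7 * k + 2 - 4 * eim y by clear -Hk; lia.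
rewrite /eis_norm x_eq; move: (eim y) => e; clear.
(* The witness is one seventh of the expression after substituting [7 * k + 2 - 4 * e] for the real
   coordinate. *)
apply/dvdzP; exists (5 * (7 * k ^+ 2 + 2 * k * (2 - 4 * e) - k * e) + 15 * e ^+ 2 - 9 * e + 11 - 10 * k).
ring.
Qed.

(** * Real characters trivial on the admissible classes *)

Lemma prime_dvd_ind (P : nat -> Prop) : P 1%N ->
  (forall q r, prime r -> (0 < q)%N -> P q -> P (q * r)%N) -> forall q, (0 < q)%N -> P q.
Proof.
move=> P1 Pm q; have [n] := ubnP q; elim: n q => // n IH q qn q0.
have [q1|q1] := leqP q 1; first by rewrite (_ : q = 1%N) //; lia.
have pr := pdiv_prime q1; have [k Ek] := dvdnP (pdiv_dvd q); have r1 := prime_gt1 pr.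
have k0 : (0 < k)%N by case: k Ek => // E; rewrite E in q0.
by rewrite Ek; apply: Pm => //; apply: IH => //; nia.
Qed.

(** Each prime factor [r] enters through [b ^ r - 1 = (b - 1) * (1 + b + ... + b ^ (r - 1))] with
    [b = a ^ q]; the second factor is [r = 0] modulo [r]. For odd [q] this shows that real
    characters modulo [q] only see the residues modulo the primes dividing [q]. *)
Lemma expr_mod1_radical q (a : int) : (0 < q)%N ->
  (forall r, prime r -> (r %| q)%N -> (r %| a - 1)%Z) -> (q %| a ^+ q - 1)%Z.
Proof.
move=> q0; move: q q0; apply: prime_dvd_ind => [|q r pr q0 IH] Ha; first by rewrite dvd1z.
have {}IH : (q %| a ^+ q - 1)%Z by apply: IH => s ps sq; apply: Ha => //; rewrite dvdn_mulr.
rewrite PoszM exprM subrX1 dvdz_mul //.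
have ar : (a%:~R : 'F_r) = 1.
  by apply/eqP; rewrite -subr_eq0 -[1]/(1%:~R) -rmorphB intr_Fp_eq0 // Ha // dvdn_mull.
rewrite -intr_Fp_eq0 // rmorph_sum (eq_bigr (fun=> 1)) => [|i _].
  by rewrite sumr_const card_ord pchar_Fp_0.
by rewrite /= !rmorphXn /= ar !expr1n.
Qed.

Lemma crt_choice (P : nat -> int -> int -> int -> Prop) :
  (forall (r : nat) (a b c a' b' c' : int), (r %| a - a')%Z -> (r %| b - b')%Z -> (r %| c - c')%Z ->
     P r a b c -> P r a' b' c') ->
  forall q, (0 < q)%N -> (forall r, prime r -> (r %| q)%N -> exists a b c, P r a b c) ->
  exists a b c, forall r, prime r -> (r %| q)%N -> P r a b c.
Proof.
move=> Pcong; apply: prime_dvd_ind => [_|q r pr q0 IH ex].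
  by exists 0, 0, 0 => r pr /dvdn_leq; have := prime_gt1 pr; lia.
have [|a [b [c H]]] := IH; first by move=> s ps sq; apply: ex => //; rewrite dvdn_mulr.
have [rq|rq] := boolP (r %| q)%N.
  by exists a, b, c => s ps; rewrite Euclid_dvdM // => /orP [sq|/dvdn_trans/(_ rq) sq]; apply: H.
have [a' [b' [c' H']]] := ex r pr (dvdn_mull _ (dvdnn r)).
have cop : coprimez q r by rewrite coprimezE /= coprime_sym prime_coprime.
have L x y : (q %| x - zchinese q r x y)%Z.
  by rewrite -eqz_mod_dvd; apply/eqP/esym/zchinese_modl.
have R x y : (r %| y - zchinese q r x y)%Z.
  by rewrite -eqz_mod_dvd; apply/eqP/esym/zchinese_modr.
exists (zchinese q r a a'), (zchinese q r b b'), (zchinese q r c c') => s ps.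
rewrite Euclid_dvdM // => /orP [sq|].
  by apply: Pcong (H s ps sq); apply: dvdz_trans (L _ _); rewrite dvdzE.
rewrite dvdn_prime2 // => /eqP ->.
by apply: Pcong H'; apply: R.
Qed.

(** * Square classes represented by the cubic attached to the target curve *)

Section SquareClassesPrime.
Variable r : nat.
Hypotheses (pr : prime r) (r6 : (r %% 6 = 1)%N).
Local Notation F := 'F_r.

(** The values of [t] for which the point [(1 + t, (t - 36) / t)] of [(u - 1) * (v - 1) = - 36] is
    defined with unit coordinates. *)
Definition valid (R : unitRingType) (s : R) :=
  [&& s \is a GRing.unit, s + 1 \is a GRing.unit & s - 36 \is a GRing.unit].
(** Up to squares, the product of the two coordinates [1 + s] and [(s - 36) / s]. *)
Definition cubic (R : pzRingType) (s : R) := s * (s + 1) * (s - 36).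

Lemma F_nonsquare_mul (x y : F) : x != 0 -> y != 0 ->
  (forall c, c ^+ 2 != x) -> (forall c, c ^+ 2 != y) -> exists2 c, c != 0 & c ^+ 2 = x * y.
Proof.
move=> x0 y0; have [g gp] := finField_prim_root F.
have N0 : (0 < #|F|.-1)%N by rewrite card_Fp //; have := prime_gt1 pr; lia.
rewrite (indP gp x0) (indP gp y0); move: (ind gp x) (ind gp y) => k l.
have odd_exp n : (forall c, c ^+ 2 != g ^+ n) -> odd n.
  move=> H; apply: contraT => en; have := H (g ^+ n./2).
  by rewrite -exprM muln2 halfK (negPf en) subn0 eqxx.
move=> /odd_exp ok /odd_exp ol; exists (g ^+ (k + l)./2).
  rewrite expf_neq0 //; apply/eqP => g0; have := prim_expr_order gp.
  by rewrite g0 expr0n gtn_eqF // => /eqP; rewrite eq_sym oner_eq0.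
by rewrite -exprM muln2 halfK oddD ok ol subn0 exprD.
Qed.

(** Up to a square, [cubic t * cubic (36 - t)] is [(t + 1) * (37 - t)], which has the class of a
    chosen nonsquare [w] when [t = (37 - w) / (1 + w)]. The construction needs 38 to be nonzero and
    several nonsquares, whence the explicit values for 19 and 7. *)
Lemma cubic_nonsquare : exists s t : F, [/\ valid s, valid t & forall c : F, c ^+ 2 != cubic s * cubic t].
Proof.
have [r7|r7] := eqVneq r 7%N.
  rewrite r7; exists 3, 4; split; [by vm_compute|by vm_compute|].
  by case=> [[|[|[|[|[|[|[|//]]]]]]] i]; vm_compute.
have [r19|r19] := eqVneq r 19%N.
  rewrite r19; exists 1, 3; split; [by vm_compute|by vm_compute|].
  by case; do 19?[case; first by vm_compute].
have [g gp] := finField_prim_root F; rewrite card_Fp // in gp.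
have nsq k : (k < 4)%N -> forall c, c ^+ 2 != g ^+ (2 * k).+1.
  move=> k4 c; apply/eqP => E.
  have c0 : c != 0.
    apply/eqP => c0; move: E; rewrite c0 expr0n /= => /esym/eqP; rewrite expf_eq0 => /andP [_ /eqP g0].
    by have := prim_expr_order gp; rewrite g0 expr0n gtn_eqF ?ltn_predRL ?prime_gt1 // => /eqP; rewrite eq_sym oner_eq0.
  have := F_unity c0; rewrite card_Fp // => c1.
  have h : (r.-1 = 2 * (r.-1)./2)%N by lia.
  have : g ^+ ((2 * k).+1 * (r.-1)./2) == 1 by rewrite exprM -E -exprM -h c1.
  rewrite -(prim_order_dvd gp) => /dvdnP [j]; have e0 : (0 < (r.-1)./2)%N by have := prime_gt1 pr; lia.
  rewrite [X in (_ = _ * X)%N]h mulnA => /eqP; rewrite eqn_pmul2r //.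
  by move=> /eqP; lia.
have r13 : (13 <= r)%N by have := prime_gt1 pr; lia.
pose ws := [seq g ^+ (2 * k).+1 | k <- iota 0 4].
have uws : uniq ws.
  rewrite map_inj_in_uniq ?iota_uniq // => k l; rewrite !mem_iota => /andP [_ k4] /andP [_ l4].
  by move=> /eqP; rewrite (eq_prim_root_expr gp) !modn_small; lia.
(* Four nonsquares against three forbidden values: -1 kills the denominator, 37 gives [t = 0], and
   its inverse gives [t = 36]. *)
have [w wws wex] : exists2 w, w \in ws & w \notin [:: -1; 37; 37^-1 : F].
  apply/hasP; rewrite has_predC; apply/negP => /allP sub.
  by have := uniq_leq_size uws sub.
have [k k4 wk] : exists2 k, (k < 4)%N & w = g ^+ (2 * k).+1.
  by case/mapP: wws => k; rewrite mem_iota => /andP [_ k4] ->; exists k.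
have w0 : w != 0 by apply/eqP => w0; have := nsq k k4 0; rewrite -wk w0 expr0n eqxx.
have {}nsq c : c ^+ 2 != w by rewrite wk nsq.
move: wex; rewrite !inE !negb_or => /and3P [w1 w2 w3].
have d0 : 1 + w != 0 by rewrite addrC addr_eq0.
have n0 (n : nat) : (n%:R : F) != 0 = ~~ (r %| n)%N.
  by rewrite -[0]/(0%:R) natr_Fp_eq // mod0n.
have h38 : 38 != 0 :> F.
  rewrite n0 (_ : 38 = 2 * 19)%N // Euclid_dvdM // negb_or !dvdn_prime2 // r19 andbT.
  by rewrite neq_ltn (leq_trans _ r13) ?orbT.
pose t := (37 - w) / (1 + w).
have t1 : t + 1 = 38 / (1 + w) by rewrite /t; field.
have t36 : t - 36 = (1 - 37 * w) / (1 + w) by rewrite /t; field.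
have t37 : 37 - t = 38 * w / (1 + w) by rewrite /t; field.
have vt0 : t != 0 by rewrite mulf_neq0 ?invr_eq0 // subr_eq0 eq_sym.
clearbody t.
have vt1 : t + 1 != 0 by rewrite t1 mulf_neq0 ?invr_eq0.
have vt36 : t - 36 != 0.
  rewrite t36 mulf_neq0 ?invr_eq0 // subr_eq0; apply: contra w3 => /eqP E.
  have h37 : 37 != 0 :> F by apply/eqP => h; move/eqP: E; rewrite h mul0r oner_eq0.
  by rewrite -(mulKf h37 w) -E mulr1.
have vt37 : 37 - t != 0 by rewrite t37 !mulf_neq0 ?invr_eq0.
exists t, (36 - t); split.
- by rewrite /valid !unitfE vt0 vt1.
- rewrite /valid !unitfE -oppr_eq0 opprB vt36 (_ : 36 - t + 1 = 37 - t) ?vt37; last by ring.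
  by rewrite addrAC subrr add0r oppr_eq0.
move=> c; apply: contra (nsq (c / (t * (t - 36) * (t + 1)))) => /eqP E.
have m0 : t * (t - 36) * (t + 1) != 0 by rewrite !mulf_neq0.
rewrite expr_div_n E; apply/eqP.
have -> : cubic t * cubic (36 - t) = (t * (t - 36)) ^+ 2 * ((t + 1) * (37 - t)) by rewrite /cubic; ring.
have -> : (t + 1) * (37 - t) = (t + 1) ^+ 2 * w by rewrite t37 t1; field.
by rewrite mulrA -exprMn mulrAC divff ?mul1r ?expf_neq0.
Qed.

(** A square [D] is served by [s = t]; a nonsquare one by the pair of [cubic_nonsquare], the product
    of two nonsquares being a square. *)
Lemma cubic_square_class (D : F) : D != 0 -> exists s t y : F,
  [/\ valid s, valid t, y != 0 & D * cubic s * cubic t = y ^+ 2].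
Proof.
have cv (s : F) : valid s -> cubic s != 0.
  by rewrite /valid !unitfE => /and3P [a b c]; rewrite !mulf_neq0.
move=> D0; have [s [t [vs vt nst]]] := cubic_nonsquare.
have [/existsP [c /eqP cD]|nD] := boolP [exists c : F, c ^+ 2 == D].
  exists s, s, (c * cubic s); split=> //; last by rewrite -cD; ring.
  rewrite mulf_neq0 ?cv //; apply/eqP => c0.
  by move: D0; rewrite -cD c0 expr0n eqxx.
have nD' c : c ^+ 2 != D by apply: contra nD => /eqP h; apply/existsP; exists c; rewrite h.
have [y y0 Ey] := F_nonsquare_mul D0 (mulf_neq0 (cv _ vs) (cv _ vt)) nD' nst.
by exists s, t, y; rewrite -mulrA.
Qed.
End SquareClassesPrime.

Section RealCharacters.
Variable q : nat.
Hypotheses (q_gt1 : (1 < q)%N) (q_good : primes_1_mod_6 q).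

Lemma unit_intr (k : int) :
  (forall r, prime r -> (r %| q)%N -> ~~ (r %| k)%Z) -> (k%:~R : 'Z_q) \is a GRing.unit.
Proof.
move=> H; have : coprime q `|k|%N.
  rewrite /coprime; apply: contraT => g1; pose d := gcdn q `|k|%N.
  have d0 : (0 < d)%N by rewrite gcdn_gt0 ltnW.
  have d1 : (1 < d)%N by rewrite ltn_neqAle eq_sym g1.
  have := H _ (pdiv_prime d1) (dvdn_trans (pdiv_dvd _) (dvdn_gcdl _ _)).
  by rewrite dvdzE /= (dvdn_trans (pdiv_dvd _) (dvdn_gcdr _ _)).
case: k {H} => k cop; first by rewrite -pmulrn unitZpE.
by rewrite NegzE mulrNz unitrN -pmulrn unitZpE.
Qed.

Definition real_char (R : unitRingType) (alpha : R -> bool) :=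
  {in GRing.unit &, forall a b, alpha (a * b) = alpha a (+) alpha b}.

Section Theory.
Variables (R : unitRingType) (alpha : R -> bool).
Hypothesis charM : real_char alpha.
Lemma real_char1 : alpha 1 = false.
Proof. by have := charM (unitr1 R) (unitr1 R); rewrite mulr1 addbb. Qed.
Lemma real_char_sqr a : a \is a GRing.unit -> alpha (a ^+ 2) = false.
Proof. by move=> ua; rewrite expr2 charM // addbb. Qed.
Lemma real_charX a n : a \is a GRing.unit -> alpha (a ^+ n) = odd n && alpha a.
Proof.
move=> ua; elim: n => [|n IH]; first by rewrite real_char1.
by rewrite exprS charM ?unitrX // IH /=; case: (odd n); case: (alpha a).
Qed.
End Theory.

Lemma good_odd : odd q.
Proof.
apply: contraT => eq; have := q_good (isT : prime 2); rewrite dvdn2 => /(_ eq).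
by [].
Qed.

(** The solutions modulo the primes are glued into [s], [t], [y]. The quotient [a] of
    [D * cubic s * cubic t] by [y ^ 2] is 1 modulo every prime of [q], so [a ^ q = 1], and [q] is
    odd: every real character is trivial at [a]. *)
Lemma square_class (D : 'Z_q) : D \is a GRing.unit -> exists s t : 'Z_q,
  [/\ valid s, valid t & forall alpha : 'Z_q -> bool, real_char alpha ->
     alpha D = alpha (cubic s) (+) alpha (cubic t)].
Proof.
move=> uD; pose d : int := (val D)%:Z.
have dD : d%:~R = D by rewrite /d -pmulrn natr_Zp.
pose P (r : nat) (s t y : int) := [/\ valid (s%:~R : 'F_r), valid (t%:~R : 'F_r),
  (y%:~R : 'F_r) != 0 & (d%:~R * cubic s%:~R * cubic t%:~R : 'F_r) = y%:~R ^+ 2].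
have [|r pr rq|s [t [y H]]] := @crt_choice (fun r s t y => prime r -> P r s t y) _ q (ltnW q_gt1).
- move=> r a b c a' b' c' ha hb hc + pr => /(_ pr).
  have e x x' : (r %| x - x')%Z -> (x%:~R : 'F_r) = x'%:~R.
    by rewrite -intr_Fp_eq0 // rmorphB subr_eq0 => /eqP.
  by rewrite /P (e _ _ ha) (e _ _ hb) (e _ _ hc).
- have D0 : (d%:~R : 'F_r) != 0.
    rewrite intr_Fp_eq0 // dvdzE /= -prime_coprime //.
    by apply: coprime_dvdl rq _; rewrite -unit_nat_Zp // natr_Zp.
  have [s [t [y [vs vt y0 E]]]] := cubic_square_class pr (q_good pr rq) D0.
  by exists (s : nat)%:Z, (t : nat)%:Z, (y : nat)%:Z => _; split; rewrite -!pmulrn !natr_Zp.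
have nd r k : prime r -> (r %| q)%N -> (k%:~R : 'F_r) \is a GRing.unit -> ~~ (r %| k)%Z.
  by move=> pr rq; rewrite unitfE intr_Fp_eq0.
have intr1 (R : pzRingType) x : (x + 1)%:~R = x%:~R + 1 :> R by rewrite intrD.
have intr36 (R : pzRingType) x : (x - 36)%:~R = x%:~R - 36 :> R by rewrite intrB rmorph_nat.
have lift_valid (x : int) : (forall r, prime r -> (r %| q)%N -> valid (x%:~R : 'F_r)) -> valid (x%:~R : 'Z_q).
  move=> v; rewrite /valid -intr36 -intr1.
  by apply/and3P; split; apply: unit_intr => r pr rq; apply: nd => //;
    have /and3P [a b c] := v r pr rq; rewrite ?intr1 ?intr36.
exists s%:~R, t%:~R.
have vs : valid (s%:~R : 'Z_q) by apply: lift_valid => r pr rq; have [] := H r pr rq pr.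
have vt : valid (t%:~R : 'Z_q) by apply: lift_valid => r pr rq; have [] := H r pr rq pr.
have uy : (y%:~R : 'Z_q) \is a GRing.unit.
  by apply: unit_intr => r pr rq; have [_ _ y0 _] := H r pr rq pr; rewrite -intr_Fp_eq0.
split=> // alpha aM.
pose yb : int := (val ((y%:~R : 'Z_q)^-1))%:Z.
have ybE : (yb%:~R : 'Z_q) = y%:~R^-1 by rewrite /yb -pmulrn natr_Zp.
pose cub (x : int) := x * (x + 1) * (x - 36).
have cubE (R : pzRingType) x : (cub x)%:~R = cubic (x%:~R : R).
  by rewrite /cub /cubic !intrM intr1 intr36.
clearbody cub.
pose a := d * cub s * cub t * yb ^+ 2.
have intra (R : comPzRingType) : a%:~R = d%:~R * cubic s%:~R * cubic t%:~R * yb%:~R ^+ 2 :> R.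
  by rewrite /a !expr2 !intrM !cubE.
have a1 : (q %| a ^+ q - 1)%Z.
  apply: expr_mod1_radical => [|r pr rq]; first exact: ltnW.
  have [_ _ _ E] := H r pr rq pr.
  rewrite -intr_Fp_eq0 // intrB subr_eq0 intra E -exprMn -intrM.
  have : (q %| y * yb - 1)%Z by rewrite -intr_Zp_eq // intrM ybE divrr.
  move=> qy; have : (r %| y * yb - 1)%Z by apply: dvdz_trans qy; rewrite dvdzE.
  by rewrite -intr_Fp_eq0 // intrB subr_eq0 => /eqP ->; rewrite expr1n.
have uc (x : 'Z_q) : valid x -> cubic x \is a GRing.unit.
  by move=> /and3P [u1 u2 u3]; rewrite /cubic !unitrM u1 u2 u3.
have aE : (a%:~R : 'Z_q) = D * cubic s%:~R * cubic t%:~R * (y%:~R^-1) ^+ 2.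
  by rewrite intra ybE dD.
have ua : (a%:~R : 'Z_q) \is a GRing.unit.
  by rewrite aE unitrMl ?unitrX ?unitrV // unitrMl ?uc // unitrMl ?uc.
have : alpha (a%:~R ^+ q) = false.
  have -> : (a%:~R : 'Z_q) ^+ q = 1 by apply/eqP; rewrite -rmorphXn (@intr_Zp_eq _ _ _ 1).
  exact: (real_char1 aM).
rewrite real_charX // good_odd /= aE aM ?unitrX ?unitrV //; last by rewrite unitrMl ?uc // unitrMl ?uc.
rewrite real_char_sqr ?unitrV // addbF aM ?uc //; last by rewrite unitrMl ?uc.
rewrite aM ?uc //.
by case: (alpha D); case: (alpha _); case: (alpha _).
Qed.
End RealCharacters.

(** * Coordinates on Z[omega] modulo 4 q: a residue modulo 4 and two reductions modulo q *)

Section EisensteinCoordinates.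
Variable q : nat.
Hypotheses (q_gt1 : (1 < q)%N) (q_good : primes_1_mod_6 q).
Variable z : 'Z_q.
Hypothesis z2 : z ^+ 2 = z - 1.
Local Notation m := (4 * q)%N.
Local Notation U := (eis_eval (z - 1)).
Local Notation V := (eis_eval (- z)).
Implicit Types x y : eis int.

Let m_gt1 : (1 < m)%N. Proof. by lia. Qed.

Lemma coprime4_good : coprime 4 q.
Proof. by rewrite -[4%N]/(2 ^ 2)%N coprime_pexpl // coprime2n (good_odd q_good). Qed.

Lemma root_opp_sqr : (- z) ^+ 2 = - - z - 1.
Proof. by rewrite sqrrN z2 opprK. Qed.

Lemma U_V_nrm x : U x * V x = (nrm x)%:R.
Proof.
have -> : V x = U (eis_conj x) by rewrite /eis_eval /= !(intrB, intrN); ring.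
rewrite -(eis_evalM (root_sub1_sqr z2)) mul_conj /eis_eval /= mul0r addr0 -nrmE.
by rewrite -pmulrn.
Qed.

(** Modulo [q] the system [a + b * (z - 1) = u], [a - b * z = v] gives [b * (2 * z - 1) = u - v],
    and [(2 * z - 1) ^ 2 = -3] explains the factor [- (3^-1)]. *)
Definition from_coords (tau : eis int) (u v : 'Z_q) : eis int :=
  let b := (u - v) * (2 * z - 1) * - (3^-1) in
  let a := u - b * (z - 1) in
  Eis (zchinese 4 q (ere tau) (a : nat)%:Z) (zchinese 4 q (eim tau) (b : nat)%:Z).

Lemma from_coordsP tau u v :
  [/\ ered 4 (from_coords tau u v) = ered 4 tau, U (from_coords tau u v) = u & V (from_coords tau u v) = v].
Proof.
have cop : coprimez 4 q by rewrite coprimezE /= coprime4_good.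
have L a b : ((zchinese 4 q a b)%:~R : 'Z_4) = a%:~R.
  by apply/eqP; rewrite intr_Zp_eq // -eqz_mod_dvd; apply/eqP/zchinese_modl.
have R a (b : 'Z_q) : ((zchinese 4 q a (b : nat)%:Z)%:~R : 'Z_q) = b.
  rewrite -[RHS]natr_Zp; apply/eqP; rewrite [X in _ == X]pmulrn intr_Zp_eq // -eqz_mod_dvd.
  by apply/eqP/zchinese_modr.
have u3 : (3 : 'Z_q) \is a GRing.unit by apply: good_unit.
pose b : 'Z_q := (u - v) * (2 * z - 1) * - (3^-1); pose a : 'Z_q := u - b * (z - 1).
rewrite -[from_coords tau u v]/(Eis (zchinese 4 q (ere tau) (a : nat)%:Z) (zchinese 4 q (eim tau) (b : nat)%:Z)).
have aU : a + b * (z - 1) = u by rewrite /a subrK.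
have aV : a + b * - z = v.
  have e (R' : comNzRingType) (u' v' y s : R') :
      u' - (u' - v') * (2 * y - 1) * - s * (y - 1) + (u' - v') * (2 * y - 1) * - s * - y =
      v' + (u' - v') * (1 - 3 * s) + 4 * ((u' - v') * s) * (y ^+ 2 - (y - 1)) by ring.
  by rewrite /a /b e z2 subrr mulr0 addr0 divrr // subrr mulr0 addr0.
clearbody a b; split; first by rewrite /ered /= !L.
  by rewrite /eis_eval /= !R.
by rewrite /eis_eval /= !R.
Qed.

Lemma ered_coords x y : ered 4 x = ered 4 y -> U x = U y -> V x = V y -> ered m x = ered m y.
Proof.
move=> /eqP; rewrite ered_eq // => /andP [a4 b4] Ux Vx; apply/eqP; rewrite ered_eq //.
have u3 : (3 : 'Z_q) \is a GRing.unit by apply: good_unit.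
pose a : 'Z_q := (ere x)%:~R - (ere y)%:~R; pose b : 'Z_q := (eim x)%:~R - (eim y)%:~R.
have e1 : a + b * (z - 1) = 0.
  by apply/eqP; rewrite /a /b mulrBl addrACA -opprD subr_eq0; apply/eqP.
have e2 : a + b * - z = 0.
  by apply/eqP; rewrite /a /b mulrBl addrACA -opprD subr_eq0; apply/eqP.
have b0 : b = 0.
  have e (R' : comNzRingType) (a' b' y' : R') : 3 * b' =
    (2 * y' - 1) * ((a' + b' * - y') - (a' + b' * (y' - 1))) + 4 * b' * (y' ^+ 2 - (y' - 1)) by ring.
  have : 3 * b = 0 by rewrite (e _ a b z) e1 e2 z2 !subrr !mulr0 addr0.
  by move/(congr1 (fun c => 3^-1 * c)); rewrite mulKr // mulr0.
have a0 : a = 0 by move: e1; rewrite b0 mul0r addr0.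
rewrite /cong; apply/andP; rewrite PoszM !Gauss_dvdz ?coprimezE ?coprime4_good //.
have qd j k : (j%:~R - k%:~R : 'Z_q) = 0 -> (q %| j - k)%Z.
  by move/eqP; rewrite subr_eq0 intr_Zp_eq.
by rewrite a4 b4 !qd.
Qed.

Lemma coords_ered x y : ered m x = ered m y -> [/\ ered 4 x = ered 4 y, U x = U y & V x = V y].
Proof.
move=> /eqP; rewrite ered_eq // => /andP [a b].
have red d : (d %| m)%N -> (d %| ere x - ere y)%Z /\ (d %| eim x - eim y)%Z.
  by move=> dm; split; [apply: dvdz_trans a|apply: dvdz_trans b]; rewrite dvdzE.
have [a4 b4] := red 4%N (dvdn_mulr _ (dvdnn _)); have [aq bq] := red q (dvdn_mull _ (dvdnn _)).
have aE : (ere x)%:~R = (ere y)%:~R :> 'Z_q by apply/eqP; rewrite intr_Zp_eq.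
have bE : (eim x)%:~R = (eim y)%:~R :> 'Z_q by apply/eqP; rewrite intr_Zp_eq.
by split; rewrite /eis_eval ?aE ?bE //; apply/eqP; rewrite ered_eq // /cong a4 b4.
Qed.

Lemma unit_coords x : (ered m x \is a GRing.unit) =
  [&& ered 4 x \is a GRing.unit, U x \is a GRing.unit & V x \is a GRing.unit].
Proof.
by rewrite !ered_unit // coprimeMl -unitrM U_V_nrm unit_nat_Zp.
Qed.
End EisensteinCoordinates.

(** Replacing [t] by [- 36 / t] exchanges [alpha] and [beta] in the hypothesis. Adding both
    relations makes [alpha (+) beta] trivial on values of [cubic], hence on all units by
    [square_class]; then [alpha] is the constant [c] on these values, and the two copies of [c]
    cancel. *)
Lemma real_char_cubic q (alpha beta : 'Z_q -> bool) c : (1 < q)%N -> primes_1_mod_6 q ->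
  real_char alpha -> real_char beta ->
  (forall t : 'Z_q, valid t -> alpha (1 + t) (+) beta (t * (t - 36)) = c) ->
  forall u, u \is a GRing.unit -> alpha u = false /\ beta u = false.
Proof.
move=> q1 gq aM bM H.
have u36 : (36 : 'Z_q) \is a GRing.unit by apply: good_unit.
have vs (t : 'Z_q) : valid t -> [/\ t \is a GRing.unit, t + 1 \is a GRing.unit & t - 36 \is a GRing.unit].
  by move=> /and3P.
have ac (t : 'Z_q) : valid t -> alpha (cubic t) = alpha (1 + t) (+) alpha (t * (t - 36)).
  by move=> /vs [t0 t1 t36]; rewrite [1 + t]addrC -aM ?unitrMl // /cubic mulrCA mulrA.
have bc (t : 'Z_q) : valid t -> beta (cubic t) = beta (1 + t) (+) beta (t * (t - 36)).
  by move=> /vs [t0 t1 t36]; rewrite [1 + t]addrC -bM ?unitrMl // /cubic mulrCA mulrA.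
have H' (t : 'Z_q) : valid t -> beta (1 + t) (+) alpha (t * (t - 36)) = c.
  move=> vt; have [t0 t1 t36] := vs t vt.
  pose s := - 36 / t.
  have s1 : s + 1 = (t - 36) / t by rewrite /s mulrBl divrr // addrC mulNr.
  have s36 : s - 36 = - 36 * (t + 1) / t by rewrite /s mulrDr mulr1 mulrDl mulrK // addrC.
  have vs' : valid s.
    by rewrite /valid s1 s36 /s !(unitrM, unitrV, unitrN) t0 t1 t36 u36.
  rewrite -(H s vs') addrC [1 + s]addrC addbC s1; congr (_ (+) _).
    have -> : t * (t - 36) = (t - 36) / t * t ^+ 2 by rewrite expr2 mulrA divrK // mulrC.
    by rewrite aM ?unitrX ?unitrMl ?unitrV // real_char_sqr // addbF.
  have -> : s * (s - 36) = (t + 1) * (36 / t) ^+ 2.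
    have e (R : comNzRingType) (i x : R) : (- 36 * i) * (- 36 * x * i) = x * (36 * i) ^+ 2 by ring.
    by rewrite s36 /s e.
  by rewrite bM ?unitrX ?unitrMl ?unitrV // real_char_sqr ?addbF ?unitrMl ?unitrV.
have gM : real_char (fun u => alpha u (+) beta u).
  by move=> a b ua ub /=; rewrite aM // bM //; case: (alpha a); case: (alpha b); case: (beta a); case: (beta b).
have g0 u : u \is a GRing.unit -> alpha u (+) beta u = false.
  move=> uu; have [s [t [vs0 vt0 E]]] := square_class q1 gq uu.
  have h x : valid x -> alpha (cubic x) (+) beta (cubic x) = false.
    move=> vx; rewrite ac // bc //; have := H x vx; have := H' x vx.
    by case: c {H H'}; case: (alpha _); case: (beta _); case: (alpha _); case: (beta _).
  by rewrite (E _ gM) !h.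
have a0 u : u \is a GRing.unit -> alpha u = false.
  move=> uu; have [s [t [vs0 vt0 E]]] := square_class q1 gq uu.
  have h x : valid x -> alpha (cubic x) = c.
    move=> vx; have [x0 x1 x36] := vs x vx; rewrite ac // -(H x vx); congr (_ (+) _).
    have ux : x * (x - 36) \is a GRing.unit by rewrite unitrMl.
    by have := g0 _ ux; case: (alpha _); case: (beta _).
  by rewrite (E _ aM) !h // addbb.
by move=> u uu; split; [exact: a0|have := g0 u uu; rewrite a0].
Qed.

Section TargetClass.
Variable q : nat.
Hypotheses (q_gt1 : (1 < q)%N) (q_good : primes_1_mod_6 q).
Variable z : 'Z_q.
Hypothesis z2 : z ^+ 2 = z - 1.
Local Notation m := (4 * q)%N.
Local Notation U := (eis_eval (z - 1)).
Local Notation V := (eis_eval (- z)).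
Implicit Types x y : eis int.

Let m_gt1 : (1 < m)%N. Proof. by lia. Qed.

(** [(U x - 1) * (V x - 1)] is [N(x - 1)] modulo [q]. For [q = 7], where [z] is chosen to be 3, [U]
    and [V] are [a + 2 b] and [a + 4 b], which gives the two linear alternatives of
    [shift_count_mod]. *)
Definition target x :=
  (ered 4 x == Eis 1 2) || (ered 4 x == Eis 3 2) /\
  if q == 7%N then (U x == 2) || (V x == 2) else (U x - 1) * (V x - 1) == - 36.

(** A boolean character takes the same value at [y] and [y ^ 3], so modulo 4 only the group
    generated by the two target residues matters. *)
Lemma eis4_cube (y : eis 'Z_4) : y \is a GRing.unit ->
  y ^+ 3 \in [:: 1; Eis 1 2 * Eis 3 2; Eis 1 2; Eis 3 2].
Proof.
by case: y => -[[|[|[|[|//]]]] i] -[[|[|[|[|//]]]] j]; vm_compute.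
Qed.

Lemma eis4_norm (y : eis 'Z_4) : y * y != Eis 1 2 /\ y * y != Eis 3 2.
Proof.
by case: y => -[[|[|[|[|//]]]] i] -[[|[|[|[|//]]]] j]; vm_compute.
Qed.

Section Character.
Variable chi : {unit eis 'Z_m} -> bool.
Hypothesis chiM : forall g h, chi (g * h)%g = chi g (+) chi h.
Hypothesis chi_target : forall x, ered m x \is a GRing.unit -> target x -> chi (eclass m x) = false.

Let F x := chi (eclass m x).
Let cop x := ered m x \is a GRing.unit.
Let X := @from_coords q z.

Let FM x y : cop x -> cop y -> F (x * y) = F x (+) F y.
Proof. by move=> cx cy; rewrite /F eclassM // chiM. Qed.

Let F_eq x y : ered 4 x = ered 4 y -> U x = U y -> V x = V y -> F x = F y.
Proof. by move=> h4 hU hV; rewrite /F /eclass (ered_coords q_gt1 q_good z2 h4 hU hV). Qed.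

Let X4 tau u v : ered 4 (X tau u v) = ered 4 tau.
Proof. by have [] := from_coordsP q_gt1 q_good z2 tau u v. Qed.
Let XU tau u v : U (X tau u v) = u.
Proof. by have [] := from_coordsP q_gt1 q_good z2 tau u v. Qed.
Let XV tau u v : V (X tau u v) = v.
Proof. by have [] := from_coordsP q_gt1 q_good z2 tau u v. Qed.
Let UM := eis_evalM (root_sub1_sqr z2).
Let VM := eis_evalM (root_opp_sqr z2).

Let copX tau u v : ered 4 tau \is a GRing.unit -> u \is a GRing.unit -> v \is a GRing.unit ->
  cop (X tau u v).
Proof. by move=> ht hu hv; rewrite /cop (unit_coords q_gt1 z2) X4 XU XV ht hu. Qed.

Let FX tau u v : ered 4 tau \is a GRing.unit -> u \is a GRing.unit -> v \is a GRing.unit ->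
  F (X tau u v) = F (X tau 1 1) (+) F (X 1 u 1) (+) F (X 1 1 v).
Proof.
move=> ht hu hv; have o4 : ered 4 1 \is a GRing.unit by rewrite ered1 unitr1.
have o1 := unitr1 'Z_q.
have c1 : cop (X tau 1 1) by apply: copX.
have c2 : cop (X 1 u 1) by apply: copX.
have c3 : cop (X 1 1 v) by apply: copX.
have c12 : cop (X tau 1 1 * X 1 u 1) by rewrite /cop eredM unitrMl.
rewrite -FM // -FM //; apply: F_eq.
- by rewrite !eredM !X4 ered1 !mulr1.
- by rewrite !UM !XU mul1r mulr1.
- by rewrite !VM !XV !mul1r.
Qed.

Let alpha u := F (X 1 u 1).
Let beta v := F (X 1 1 v).

Let alphaM : real_char alpha.
Proof.
move=> u v uu uv; have o4 : ered 4 1 \is a GRing.unit by rewrite ered1 unitr1.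
rewrite /alpha -FM ?copX ?unitr1 //; apply: F_eq.
- by rewrite !eredM !X4 ered1 !mulr1.
- by rewrite !UM !XU.
- by rewrite !VM !XV !mul1r.
Qed.
Let betaM : real_char beta.
Proof.
move=> u v uu uv; have o4 : ered 4 1 \is a GRing.unit by rewrite ered1 unitr1.
rewrite /beta -FM ?copX ?unitr1 //; apply: F_eq.
- by rewrite !eredM !X4 ered1 !mulr1.
- by rewrite !UM !XU !mul1r.
- by rewrite !VM !XV.
Qed.

Let tau1 : eis int := Eis 1 2.
Let tau3 : eis int := Eis 3 2.
Let tau1_unit : ered 4 tau1 \is a GRing.unit. Proof. by rewrite ered_unit. Qed.
Let tau3_unit : ered 4 tau3 \is a GRing.unit. Proof. by rewrite ered_unit. Qed.

Let F_target tau u v : ered 4 tau \in [:: Eis 1 2; Eis 3 2] -> u \is a GRing.unit -> v \is a GRing.unit ->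
  (if q == 7%N then (u == 2) || (v == 2) else (u - 1) * (v - 1) == - 36) ->
  F (X tau 1 1) (+) alpha u (+) beta v = false.
Proof.
rewrite !inE => ht hu hv h.
have ut : ered 4 tau \is a GRing.unit by case/orP: ht => /eqP ->; [exact: tau1_unit|exact: tau3_unit].
rewrite -FX //; apply: chi_target; first exact: copX.
by rewrite /target X4 XU XV.
Qed.

Let one_unit : ered 4 1 \is a GRing.unit. Proof. by rewrite ered1 unitr1. Qed.

Let F_one : F (X 1 1 1) = false.
Proof. exact: (real_char1 alphaM). Qed.

Lemma exists_valid : exists t : 'Z_q, valid t.
Proof. by have [s [_ [vs _ _]]] := square_class q_gt1 q_good (unitr1 'Z_q); exists s. Qed.

(** For [q = 7], 2 is the square of 3, so [u = 2] leaves [v] free and the other way round. For other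
    [q] the points [(1 + t, (t - 36) / t)] feed [real_char_cubic], with the value at the residue
    modulo 4 as the constant [c]. *)
Let coords_trivial : [/\ forall u, u \is a GRing.unit -> alpha u = false,
  forall v, v \is a GRing.unit -> beta v = false,
  F (X tau1 1 1) = false & F (X tau3 1 1) = false].
Proof.
have in1 : ered 4 tau1 \in [:: Eis 1 2; Eis 3 2] by [].
have in3 : ered 4 tau3 \in [:: Eis 1 2; Eis 3 2] by [].
have [q7|q7] := eqVneq q 7%N.
  have q7b : (q == 7%N) = true by apply/eqP.
  have u2 : (2 : 'Z_q) \is a GRing.unit by apply: good_unit.
  have u3 : (3 : 'Z_q) \is a GRing.unit by apply: good_unit.
  have e2 : (2 : 'Z_q) = 3 ^+ 2 by rewrite -natrX; apply/eqP; rewrite natr_Zp_eq // q7.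
  have a2 : alpha 2 = false by rewrite e2 (real_char_sqr alphaM).
  have b2 : beta 2 = false by rewrite e2 (real_char_sqr betaM).
  have hb tau v : ered 4 tau \in [:: Eis 1 2; Eis 3 2] -> v \is a GRing.unit -> F (X tau 1 1) = beta v.
    move=> ht hv; have := F_target ht u2 hv; rewrite q7b eqxx /= => /(_ isT).
    by rewrite a2 addbF; case: (F _); case: (beta _).
  have ha tau u : ered 4 tau \in [:: Eis 1 2; Eis 3 2] -> u \is a GRing.unit -> F (X tau 1 1) = alpha u.
    move=> ht hu; have := F_target ht hu u2; rewrite q7b eqxx orbT /= => /(_ isT).
    by rewrite b2 addbF; case: (F _); case: (alpha _).
  have t1 := hb _ _ in1 (unitr1 _); have t3 := hb _ _ in3 (unitr1 _).
  rewrite (real_char1 betaM) in t1 t3.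
  by split=> // [u hu|v hv]; [rewrite -(ha _ _ in1 hu)|rewrite -(hb _ _ in1 hv)].
have key tau t : ered 4 tau \in [:: Eis 1 2; Eis 3 2] -> valid t ->
    alpha (1 + t) (+) beta (t * (t - 36)) = F (X tau 1 1).
  move=> ht /and3P [t0 t1 t36].
  have uv : (t - 36) / t \is a GRing.unit by rewrite unitrMl ?unitrV.
  have ut : 1 + t \is a GRing.unit by rewrite addrC.
  have -> : t * (t - 36) = (t - 36) / t * t ^+ 2 by rewrite expr2 mulrA divrK // mulrC.
  rewrite betaM ?unitrX // (real_char_sqr betaM) // addbF.
  have := F_target ht ut uv; rewrite (negPf q7) => h.
  have /h : (1 + t - 1) * ((t - 36) / t - 1) == - 36.
    by rewrite [1 + t]addrC addrK mulrBr mulr1 mulrC divrK // addrAC subrr add0r.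
  by case: (F _); case: (alpha _); case: (beta _).
have [a0 b0] : (forall u, u \is a GRing.unit -> alpha u = false) /\ (forall v, v \is a GRing.unit -> beta v = false).
  have H := real_char_cubic q_gt1 q_good alphaM betaM (fun t vt => key _ t in1 vt).
  by split=> u /H [].
have [t vt] := exists_valid; have /and3P [t0 t1 t36] := vt.
have ut : 1 + t \is a GRing.unit by rewrite addrC.
have utt : t * (t - 36) \is a GRing.unit by rewrite unitrMl.
by split=> //; [rewrite -(key _ t in1 vt)|rewrite -(key _ t in3 vt)]; rewrite a0 ?b0.
Qed.

Lemma char_trivial g : chi g = false.
Proof.
have [a0 b0 F1 F3] := coords_trivial.
have F4 x : cop x -> F x = F (X x 1 1).
  move=> cx; have := cx; rewrite /cop (unit_coords q_gt1 z2) => /and3P [h4 hU hV].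
  rewrite -[RHS]addbF -[in RHS](b0 _ hV) -[X in X (+) _]addbF -[in X in X (+) _](a0 _ hU) -FX //.
  by apply: F_eq; rewrite ?X4 ?XU ?XV.
have F4_eq x y : cop x -> cop y -> ered 4 x = ered 4 y -> F x = F y.
  by move=> cx cy h; rewrite (F4 x) // (F4 y) //; apply: F_eq; rewrite ?X4 ?XU ?XV.
have all0 x : cop x -> F x = false.
  move=> cx; have cX k : cop (x ^+ k) by rewrite /cop eredX unitrX.
  have -> : F x = F (x ^+ 3).
    by rewrite !exprS expr0 mulr1 !FM //; [case: (F x)|rewrite -expr2].
  have u4 : ered 4 x \is a GRing.unit by move: cx; rewrite /cop (unit_coords q_gt1 z2) => /and3P [].
  have c1 : cop (X tau1 1 1) by apply: copX; rewrite ?unitr1.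
  have c3 : cop (X tau3 1 1) by apply: copX; rewrite ?unitr1.
  have c0 : cop (X 1 1 1) by apply: copX; rewrite ?unitr1.
  have := eis4_cube u4; rewrite -eredX !inE => /or4P [] /eqP h.
  - by rewrite (F4_eq _ (X 1 1 1)) // X4 h.
  - rewrite (F4_eq _ (X tau1 1 1 * X tau3 1 1)) ?FM ?F1 ?F3 //.
      by rewrite /cop eredM unitrMl.
    by rewrite eredM !X4 h.
  - by rewrite (F4_eq _ (X tau1 1 1)) // X4 h.
  - by rewrite (F4_eq _ (X tau3 1 1)) // X4 h.
pose x : eis int := Eis (ere (val g) : nat)%:Z (eim (val g) : nat)%:Z.
have xg : ered m x = val g.
  by apply: eis_eqP; rewrite /= -pmulrn natr_Zp.
have cx : cop x by rewrite /cop xg; exact: (valP g).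
rewrite -(all0 x cx) /F; congr chi; apply: val_inj.
by rewrite val_eclass.
Qed.
End Character.
End TargetClass.

Lemma eprime_dvd_prime pi (n : nat) : eprime pi -> (0 < n)%N -> edvd pi (eisC n%:Z) ->
  exists l, prime l /\ edvd pi (eisC l%:Z).
Proof.
move=> epi n0; move: n n0; apply: prime_dvd_ind => [/edvd_nrm|n l pl n0 IH].
  by rewrite nrm1 dvdn1 => /eqP N1; have := eprime_nrm_gt1 epi; rewrite N1.
rewrite PoszM rmorphM => /(eprime_dvdM epi) [/IH //|h].
by exists l.
Qed.

(** [pi] divides its norm, hence a rational prime [l], so its norm is [l] or [l ^ 2]; a square is
    not 3 modulo 4. *)
Lemma eprime_nrm_prime pi : eprime pi -> (nrm pi %% 4 = 3)%N -> prime (nrm pi).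
Proof.
move=> epi N4; have N1 := eprime_nrm_gt1 epi.
have : edvd pi (eisC (nrm pi)%:Z).
  by apply/edvdP; exists (eis_conj pi); rewrite mul_conj nrmE.
case/(eprime_dvd_prime epi (ltnW N1)) => l [pl /edvd_nrm].
have -> : nrm (eisC l%:Z) = (l ^ 2)%N.
  by apply/eqP; rewrite -eqz_nat nrmE -mulnn PoszM /eis_norm /=; apply/eqP; ring.
case/(dvdn_pfactor _ _ pl) => [[|[|[|//]]]] _ E; rewrite E in N1 N4 *; [by []|by []|].
move: N4; rewrite -mulnn -modnMm; have := ltn_pmod l (isT : (0 < 4)%N).
by move: (l %% 4)%N => [|[|[|[|//]]]].
Qed.

Section Existence.
Variable q : nat.
Hypotheses (q_gt1 : (1 < q)%N) (q_good : primes_1_mod_6 q).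
Variable z : 'Z_q.
Hypothesis z2 : z ^+ 2 = z - 1.
Local Notation m := (4 * q)%N.
Let m_gt1 : (1 < m)%N. Proof. by lia. Qed.

Lemma exists_target_eprime N : exists pi, [/\ eprime pi, target z pi & (N < nrm pi)%N].
Proof.
pose S : {pred {unit eis 'Z_m}} :=
  [pred g | `[< exists x, [/\ ered m x \is a GRing.unit, eclass m x = g & target z x] >]].
have tau1_unit : ered 4 (Eis 1 2) \is a GRing.unit by rewrite ered_unit.
have Sne : exists g, g \in S.
  have [t vt] := exists_valid q_gt1 q_good; have /and3P [t0 t1 t36] := vt.
  have [u [v [uu uv h]]] : exists u v : 'Z_q, [/\ u \is a GRing.unit, v \is a GRing.unit &
    if q == 7%N then (u == 2) || (v == 2) else (u - 1) * (v - 1) == - 36].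
    case: (q == 7%N); first by exists 2, 1; rewrite eqxx unitr1 good_unit.
    exists (1 + t), ((t - 36) / t); rewrite addrC t1 unitrMl ?unitrV //; split=> //.
    by rewrite addrK mulrBr mulr1 mulrC divrK // addrAC subrr add0r.
  have [x4 xU xV] := from_coordsP q_gt1 q_good z2 (Eis 1 2) u v.
  exists (eclass m (from_coords z (Eis 1 2) u v)); rewrite inE; apply/asboolP.
  exists (from_coords z (Eis 1 2) u v); split=> //.
    by rewrite (unit_coords q_gt1 z2) x4 xU xV tau1_unit uu.
  by rewrite /target x4 xU xV.
(* Already modulo 4 the two target residues are not squares. *)
have Ssq g h : g \in S -> g <> (h * h)%g.
  rewrite inE => /asboolP [x [ux <- [t4 _]]] E.
  pose y : eis int := Eis (ere (val h) : nat)%:Z (eim (val h) : nat)%:Z.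
  have yh : ered m y = val h by apply: eis_eqP; rewrite /= -pmulrn natr_Zp.
  have : ered m x = ered m (y * y) by rewrite -(val_eclass ux) E FinRing.val_unitM eredM yh.
  case/(coords_ered q_gt1 z) => + _ _; rewrite eredM => x4; have [n1 n3] := eis4_norm (ered 4 y).
  by move: t4; rewrite x4 (negPf n1) (negPf n3).
have Sch (f : {unit eis 'Z_m} -> bool) : (forall x y, f (x * y)%g = f x (+) f y) ->
    (exists g, f g) -> exists2 g, g \in S & f g.
  move=> fM [g fg]; apply: contrapT => no.
  have := char_trivial q_gt1 q_good z2 fM; move=> /(_ _ g); rewrite fg => H.
  suff : true = false by []. apply: H => x ux tx; apply: contrapT => /eqP; rewrite eqbF_neg negbK => fx.
  by apply: no; exists (eclass m x) => //; rewrite inE; apply/asboolP; exists x.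
have m3 : coprime m 3.
  by rewrite coprimeMl /= -(unitZpE _ q_gt1) good_unit.
have [pi [epi upi Spi Npi]] := @dirichlet_eis Rdefinitions.R m S m_gt1 m3 Sne Ssq Sch N.
exists pi; split=> //; move: Spi; rewrite inE => /asboolP [x [ux Ex tx]].
have : ered m x = ered m pi by rewrite -(val_eclass ux) -(val_eclass upi) Ex.
by case/(coords_ered q_gt1 z) => x4 xU xV; move: tx; rewrite /target x4 xU xV.
Qed.
End Existence.

Lemma target_shift_count q (z : 'Z_q) x : (1 < q)%N -> primes_1_mod_6 q ->
  z ^+ 2 = z - 1 -> (q = 7%N -> z = 3) -> eprime x -> target z x -> (q < nrm x)%N ->
  prime (nrm x) /\ exists a : 'Z_(nrm x * q),
    [/\ a \is a GRing.unit, generates_units_mod (nrm x) (val a), a ^+ (nrm x).-1./2 = -1 &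
      (#|Spq (nrm x) a :&: shift1 (Spq (nrm x) a)| + 2 = 0 %[mod q])%N].
Proof.
move=> q1 gq z2 z7 ex [x4 xq] qx; have px : primary x by case: ex.
have N4 : (nrm x %% 4 = 3)%N.
  apply/eqP; rewrite -[3%N]/(3 %% 4)%N -natr_Zp_eq //.
  have -> : (nrm x)%:R = eis_norm (ered 4 x) by rewrite eis_norm_ered -nrmE -pmulrn.
  by case/orP: x4 => /eqP ->; vm_compute.
have [t xt] : exists t, x = 1 + 2 * t.
  have [h1 h2] : (2 %| ere x - 1)%Z /\ (2 %| eim x)%Z.
    have : cong 4 (Eis 1 2) x || cong 4 (Eis 3 2) x by rewrite -!ered_eq.
    by rewrite /cong /=; case/orP => /andP [/dvdzP [k hk] /dvdzP [l hl]];
      split; apply/dvdzP; [exists (2 * k)|exists (2 * l + 1)|exists (2 * k + 1)|exists (2 * l + 1)]; lia.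
  have [[k hk] [l hl]] := (dvdzP h1, dvdzP h2).
  by exists (Eis k l); rewrite mulr_natl; apply: eis_eqP; rewrite !eisE /=; lia.
have pr := eprime_nrm_prime ex N4.
have N3 := primary_nrm_mod3 px.
(* Norm 3 modulo 4 and 1 modulo 3 means 7 modulo 12, that is [12 * f + 7] with [f] the quotient by
   12. *)
have pf : nrm x = (6 * (2 * (nrm x %/ 12) + 1)).+1 by lia.
have cpq : coprime (nrm x) q.
  by rewrite prime_coprime //; apply/negP => /(dvdn_leq (ltnW q1)); rewrite leqNgt qx.
split=> //; apply: (shift_count_mod pr pf q1 gq cpq ex erefl xt) => [/eqP/negPf q7|q7].
  move: xq; rewrite q7 -intr_Zp_eq0 // intrD -nrmE -pmulrn -(U_V_nrm z2).
  by rewrite !eis_evalB !eis_eval1 => /eqP ->; rewrite rmorph_nat addNr.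
move: xq; rewrite (introT eqP q7) /eis_eval z7 // => xq.
have dvd7 k : (k%:~R == 0 :> 'Z_q) = (7 %| k)%Z by rewrite intr_Zp_eq0 // q7.
have lin (R : comNzRingType) (a b : int) (c : nat) :
    (a + c%:R * b - 2)%:~R = a%:~R + c%:R * b%:~R - 2 :> R.
  by rewrite intrB intrD intrM !rmorph_nat.
rewrite -!dvd7 (lin _ _ _ 2%N) (lin _ _ _ 4%N); case/orP: xq => /eqP E; apply/orP; [left|right].
  by rewrite -[X in _ - X]E; apply/eqP; ring.
(* The coefficient [- z = -3] of [V] must be read as 4. *)
have e7 : (7 : 'Z_q) = 0 by apply/eqP; rewrite (natr_Zp_eq 7 0) // q7.
rewrite -[X in _ - X]E; apply/eqP.
by rewrite -[RHS](mul0r (eim x)%:~R) -e7; ring.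
Qed.

Local Close Scope ring_scope.

Theorem mainTheorem19 (q : nat) :
  1 < q ->
  (forall r : nat, prime r -> r %| q -> r %% 6 = 1) ->
  forall N : nat, exists p : nat,
    [/\ N < p, prime p &
      exists a : 'Z_(p * q),
        [/\ a \is a GRing.unit,
            generates_units_mod p (val a),
            (a ^+ (p.-1)./2 = -1)%R &
            (#|Spq p a :&: shift1 (Spq p a)| + 2 = 0 %[mod q])]].
Proof.
move=> q1 gq N; have [z [z2 z7]] := exists_sixth_root q1 gq.
(* The norm must exceed [N] as required, and also [q], so that [p] is coprime to [q]. *)
have [x [ex tx]] := exists_target_eprime q1 gq z2 (maxn N q).
rewrite gtn_max => /andP [Nx qx].
by have [pr Ha] := target_shift_count q1 gq z2 z7 ex tx qx; exists (nrm x).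
Qed.
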